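(* For all $f,g\in\Lambda^\circ\subset C(\Omega)$, $$-\int_\Omega(A_{z,z'}f)(\omega)g(\omega)\,P_{z,z'}(d\omega)=\int_\Omega\Gamma(f,g)(\omega)\,P_{z,z'}(d\omega),$$ where, viewing $f,g$ as polynomials in the moment coordinates $q_1,q_2,\dots$, $$\Gamma(f,g)(\omega)=\sum_{i,j=1}^\infty\Gamma_{ij}(\omega)\frac{\partial f}{\partial q_i}(\omega)\frac{\partial g}{\partial q_j}(\omega),\qquad\Gamma_{ij}(\omega)=(i+1)(j+1)\big(q_{i+j}(\omega)-q_i(\omega)q_j(\omega)\big)$$ (a finite sum).
   Context: Young diagrams: $\mathbb Y_n$ is the set of Young diagrams with $n$ boxes; $\mu\nearrow\lambda$ means $\mu\subset\lambda$, $|\lambda|=|\mu|+1$; $(z)_\theta=\prod_{(i,j)\in\theta}(z+j-i)$ for a (skew) diagram $\theta$ ($(i,j)$ = row $i$, column $j$), $(z)_n=z(z+1)\cdots(z+n-1)$; $\dim\lambda$ = number of standard Young tableaux of shape $\lambda$. Modified Frobenius coordinates $\lambda=(a_1,\dots,a_d\mid b_1,\dots,b_d)$: $d$ the number of diagonal boxes, $a_i=\lambda_i-i+\frac12$, $b_i=\lambda'_i-i+\frac12$. $(z,z')$ is fixed in the principal series ($z\notin\mathbb R$, $z'=\bar z$) or complementary series ($z,z'\in(N,N+1)$, $N\in\mathbb Z$). z-measure: $M_n(\lambda)=\frac{(z)_\lambda(z')_\lambda}{(zz')_n}\frac{(\dim\lambda)^2}{n!}$. Thoma simplex $\Omega$: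 pairs $\omega=(\alpha,\beta)$ of nonincreasing sequences of nonnegative reals with $\sum_i(\alpha_i+\beta_i)\le1$ (compact); $\iota_n:\mathbb Y_n\to\Omega$, $\alpha_i=a_i/n$, $\beta_i=b_i/n$ ($i\le d$), 0 otherwise. $P_{z,z'}$ (boundary z-measure) is the weak limit of $\iota_n(M_n)$. Moment coordinates $q_k(\omega)=\sum_i\alpha_i^{k+1}+(-1)^k\sum_i\beta_i^{k+1}$, $k\ge1$, algebraically independent; $\Lambda^\circ=\mathbb R[q_1,q_2,\dots]\subset C(\Omega)$, which is also $\Lambda/(p_1-1)$ for the symmetric functions $\Lambda=\mathbb R[p_1,p_2,\dots]$ with $p^\circ_{k+1}=q_k$, $p_1^\circ=1$; $s^\circ_\mu$ denotes the image of the Schur function $s_\mu$. $A_{z,z'}:\Lambda^\circ\to\Lambda^\circ$ is the linear operator $A_{z,z'}s^\circ_\mu=-m(m-1+zz')s^\circ_\mu+\sum_{\mu_\bullet\nearrow\mu}(z)_{\mu/\mu_\bullet}(z')_{\mu/\mu_\bullet}s^\circ_{\mu_\bullet}$, $m=|\mu|$. *)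

(* Defs.v *)
From HB Require Import structures.
From mathcomp Require Import all_boot all_order all_algebra.
From mathcomp Require Import all_classical all_reals all_analysis.
From mathcomp Require Import complex.
From mathcomp Require mpoly.
Import (canonicals, coercions) mpoly.

Set Implicit Arguments.
Unset Strict Implicit.
Unset Printing Implicit Defensive.

Import Order.TTheory GRing.Theory Num.Theory.
Import numFieldNormedType.Exports.

Local Open Scope classical_set_scope.
Local Open Scope ring_scope.

(* Young diagrams, encoded as partitions: seq nat, nonincreasing,       *)
(* positive parts.  Rows and columns are 0-indexed below: the box       *)
(* (i,j) of the paper (1-indexed) is (i-1,j-1) here; contents j-i are   *)
(* unchanged.                                                           *)

Definition is_part (s : seq nat) : bool :=
  sorted geq s && all (fun x => 0 < x)%N s.

(* Y_n : the list (without repetition) of all Young diagrams with n boxes.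
   Every partition of n has at most n parts, each at most n, hence is
   obtained from some n-tuple in 'I_(n+1) by deleting zeros. *)
Definition Yn (n : nat) : seq (seq nat) :=
  undup [seq s <- [seq [seq x <- map (@nat_of_ord n.+1) (tval t) | (0 < x)%N]
                   | t <- enum {: n.-tuple 'I_n.+1}]
        | is_part s && (sumn s == n)].

Definition in_diag (lam : seq nat) (i j : nat) : bool := (j < nth 0 lam i)%N.

Definition conj_part (lam : seq nat) (j : nat) : nat := count (fun x => j < x)%N lam.

Definition subdiag (mu lam : seq nat) : bool :=
  all (fun i => nth 0 mu i <= nth 0 lam i)%N (iota 0 (size mu)).

(* dim lam = number of standard Young tableaux of shape lam, n = |lam|:
   fillings T of the boxes by 1..n, bijective (injective on the n boxes),
   increasing along rows and down columns.  Boxes of a diagram with n boxes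
   have both coordinates < n; T is 0 outside the diagram. *)
Definition syt (lam : seq nat) (n : nat) (T : {ffun 'I_n * 'I_n -> 'I_n.+1}) : bool :=
  [forall c : 'I_n * 'I_n, in_diag lam c.1 c.2 == (0 < T c)%N] &&
  [forall c : 'I_n * 'I_n, forall c' : 'I_n * 'I_n,
     [&& in_diag lam c.1 c.2, in_diag lam c'.1 c'.2 & T c == T c'] ==> (c == c')] &&
  [forall c : 'I_n * 'I_n, forall c' : 'I_n * 'I_n,
     [&& in_diag lam c.1 c.2, in_diag lam c'.1 c'.2 &
        ((c'.1 == c.1 :> nat) && (c'.2 == (c.2).+1 :> nat)) ||
        ((c'.1 == (c.1).+1 :> nat) && (c'.2 == c.2 :> nat))]
     ==> (T c < T c')%N].

Definition dimY (lam : seq nat) : nat :=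
  #|[pred T : {ffun 'I_(sumn lam) * 'I_(sumn lam) -> 'I_(sumn lam).+1}
     | syt lam T]|.

Section ZMeasure.
Variable R : realType.
Local Notation C := (R[i]).

Definition cprod (z : C) (lam mu : seq nat) : C :=
  \prod_(i < size lam) \prod_(nth 0 mu i <= j < nth 0 lam i) (z + j%:R - i%:R).

Definition poch (x : C) (n : nat) : C := \prod_(k < n) (x + k%:R).

Definition principal_series (z z' : C) : Prop :=
  complex.Im z != 0 /\ z' = conjc z.

Definition complementary_series (z z' : C) : Prop :=
  exists N : int, [/\ complex.Im z = 0, complex.Im z' = 0,
    N%:~R < complex.Re z < N%:~R + 1 & N%:~R < complex.Re z' < N%:~R + 1].

(* M_n(lam) = (z)_lam (z')_lam / (zz')_n * (dim lam)^2 / n!  (a real number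
   under either series assumption; we take its real part) *)
Definition zmeasure (z z' : C) (n : nat) (lam : seq nat) : R :=
  complex.Re (cprod z lam [::] * cprod z' lam [::] / poch (z * z') n)
  * (((dimY lam)%:R : R) ^+ 2 / (n`!)%:R).

(* a point is a pair (alpha, beta) of real sequences (0-indexed) *)
Local Notation Tpt := ((nat -> R) * (nat -> R))%type.

Definition Omega : set Tpt :=
  [set w | [/\ forall i, 0 <= w.1 i, forall i, 0 <= w.2 i,
              forall i, w.1 i.+1 <= w.1 i, forall i, w.2 i.+1 <= w.2 i &
              forall n, \sum_(i < n) (w.1 i + w.2 i) <= 1]].

Definition ndiag (lam : seq nat) : nat := count (fun i => i < nth 0 lam i)%N (iota 0 (size lam)).

(* iota_n : Y_n -> Omega, via modified Frobenius coordinates: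
   alpha_i = (lam_i - i + 1/2)/n, beta_i = (lam'_i - i + 1/2)/n (1-indexed i <= d) *)
Definition iota_n (n : nat) (lam : seq nat) : Tpt :=
  (fun i => if (i < ndiag lam)%N then ((nth 0 lam i)%:R - i%:R - 2^-1) / n%:R else 0,
   fun i => if (i < ndiag lam)%N then ((conj_part lam i)%:R - i%:R - 2^-1) / n%:R else 0).

Definition qmom (k : nat) (w : Tpt) : R :=
  limn (series (fun i => w.1 i ^+ k.+1)) + (-1) ^+ k * limn (series (fun i => w.2 i ^+ k.+1)).

(* measurable structure: sigma-algebra generated by the coordinate maps
   alpha_k, beta_k (= Borel sigma-algebra of the product topology) *)
Definition cylinders : set (set Tpt) :=
  [set A | exists (k : nat) (b : bool) (B : set R),
     measurable B /\ A = [set w | B ((if b then w.1 else w.2) k)]].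

Local Notation TM := (g_sigma_algebraType cylinders).

(* continuity on Omega (Omega carries the topology of coordinatewise
   convergence, which is metrizable, so sequential continuity) *)
Definition continuous_on_Omega (phi : Tpt -> R) : Prop :=
  forall (w : nat -> Tpt) (x : Tpt), (forall m, Omega (w m)) -> Omega x ->
    (forall k, (fun m => (w m).1 k) @ \oo --> x.1 k) ->
    (forall k, (fun m => (w m).2 k) @ \oo --> x.2 k) ->
    (fun m => phi (w m)) @ \oo --> phi x.

Definition boundary_zmeasure (z z' : C) (P : probability TM R) : Prop :=
  P Omega = 1%E /\
  forall phi : Tpt -> R, continuous_on_Omega phi ->
    (fun n => \sum_(lam <- Yn n) zmeasure z z' n lam * phi (iota_n n lam))
      @ \oo --> Rintegral P Omega phi.

(* Lambda° as polynomials in q_1, ..., q_N: variable X_k <-> q_(k+1)    *)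
Section Lambda.
Variable N : nat.
Local Notation Pol := (mpoly.mpoly N R).

Definition qvar (k : nat) : Pol :=
  oapp (fun i : 'I_N => mpoly.mpolyX R (mpoly.mnm1 i)) 0 (insub k).

(* image of the power sum p_r in Lambda° = Lambda/(p_1 - 1):
   p°_1 = 1, p°_(k+1) = q_k *)
Definition pcirc (r : nat) : Pol :=
  match r with 0 => 1 | 1 => 1 | r'.+2 => qvar r' end.

Definition zrho (rho : seq nat) : nat :=
  (\prod_(1 <= i < (sumn rho).+1) (i ^ count_mem i rho * (count_mem i rho)`!))%N.

(* complete homogeneous h_k = sum_{rho |- k} p_rho / z_rho  (Macdonald I (2.14')) *)
Definition hcirc (k : nat) : Pol :=
  \sum_(rho <- Yn k) ((zrho rho)%:R^-1 : R) *: \prod_(r <- rho) pcirc r.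

Definition hcircZ (a : int) : Pol :=
  match a with Posz k => hcirc k | Negz _ => 0 end.

(* Schur function (Jacobi-Trudi): s_mu = det (h_{mu_i - i + j}) *)
Definition scirc (mu : seq nat) : Pol :=
  \det (\matrix_(i < size mu, j < size mu)
          hcircZ ((nth 0 mu i)%:Z - (i : nat)%:Z + (j : nat)%:Z)).

(* an element of Lambda° given as a finite R-combination of Schur functions
   s°_mu with |mu| <= N (so that all variables involved are among q_1..q_N) *)
Definition wf_comb (F : seq (seq nat * R)) : bool :=
  all (fun x => is_part x.1 && (sumn x.1 <= N)%N) F.

Definition comb (F : seq (seq nat * R)) : Pol :=
  \sum_(x <- F) x.2 *: scirc x.1.

Definition Aschur (z z' : C) (mu : seq nat) : Pol :=
  let m := sumn mu in
  (- m%:R * (m%:R - 1 + complex.Re (z * z'))) *: scirc mu +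
  \sum_(nu <- Yn m.-1 | ((sumn nu).+1 == m) && subdiag nu mu)
      complex.Re (cprod z mu nu * cprod z' mu nu) *: scirc nu.

Definition Acomb (z z' : C) (F : seq (seq nat * R)) : Pol :=
  \sum_(x <- F) x.2 *: Aschur z z' x.1.

Definition qvec (w : Tpt) : 'I_N -> R := fun i => qmom (i : nat).+1 w.
Definition evalO (p : Pol) (w : Tpt) : R := mpoly.meval (qvec w) p.

(* Gamma(f,g) = sum_{i,j} (i+1)(j+1)(q_{i+j} - q_i q_j) df/dq_i dg/dq_j;
   here variable index i (0-based) stands for q_(i+1) *)
Definition Gamma (f g : Pol) (w : Tpt) : R :=
  \sum_(i < N) \sum_(j < N)
     ((i : nat).+2%:R * (j : nat).+2%:R *
      (qmom ((i : nat).+1 + (j : nat).+1) w - qmom (i : nat).+1 w * qmom (j : nat).+1 w))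
     * evalO (mpoly.mderiv i f) w * evalO (mpoly.mderiv j g) w.

End Lambda.
End ZMeasure.

Notation Tpt R := ((nat -> R) * (nat -> R))%type.
Notation TM R := (g_sigma_algebraType (@cylinders R)).

(* Main.v *)
Require Import Defs.
From HB Require Import structures.
From mathcomp Require Import all_boot all_order all_algebra.
From mathcomp Require Import all_classical all_reals all_analysis.
From mathcomp Require Import complex.
From mathcomp Require mpoly.
Import (canonicals, coercions) mpoly.
From mathcomp Require Import fingroup perm zify ring lra.
Import Order.TTheory GRing.Theory Num.Theory.
Import numFieldNormedType.Exports.
Set Implicit Arguments.
Unset Strict Implicit.
Unset Printing Implicit Defensive.
Local Open Scope ring_scope.

(** For a diagram mu with m boxes let d_mu(lambda) = dim(mu, lambda) / dim(lambda)
    be the relative dimension.  The up-down Markov chain on Y_n attached to the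
    z-measure M_n acts on these functions exactly as A_{z,z'} acts on Schur
    functions: (n+1)(n+zz')(T_n - 1) d_f = d_{A f}.  As T_n is reversible, a
    summation by parts gives
      - sum_{Y_n} M_n d_{A f} d_g
        = (n+1)(n+zz') sum_{lambda in Y_{n+1}} M_{n+1}(lambda) Cov_lambda(d_f, d_g),
    the covariance being taken with respect to the removal of a random box from
    lambda.  The theorem is the limit of this identity.

    For the limit one needs d_mu(lambda) = s_mu(iota_n(lambda)) + O(1/n), with
    control of the increments.  Multiplied by dim(lambda)/n!, the functions
    n(n-1)...(n-m+1) d_mu become eigenvectors, with eigenvalue m, of T = n - U,
    where U sums over the removable boxes.  The sums D_k over addable boxes
    weighted by content^k satisfy (T + 1) D_k - D_k T = e_k, where e_k is a
    combination of the content power sums pi_j.  This commutation relation alone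
    shows that multiplication by pi_j raises the T-degree by at most j + 1, and
    that X = D_0 - 1 and Y = D_1 act on leading terms as d/dp_1 and
    sum_k (k+1) p_k d/dp_{k+1}, where p_k = k pi_{k-1}.  Both the leading terms
    and the Schur functions obey X s_mu = sum s_nu and Y s_mu = sum c(mu/nu) s_nu
    over the diagrams nu obtained by removing a box, and a function killed by X
    and Y modulo degree < k has degree <= k; so they coincide. *)

(** * Young diagrams *)

(** The covariance is multiplied by (n+1)(n+zz'), of order n^2, while d_f changes by O(1/n) when a
    box is removed. Hence the increments themselves are needed up to O(1/n^2), and a pointwise
    approximation of d_mu by s_mu would not suffice. The form of Gamma is read off at this order:
    removing a box of content xi n subtracts (xi n)^k from pi_k and replaces n by n - 1, so that
    p_{k+1} / n^{k+1} changes by (k+1)(q_k - xi^k)/n up to O(1/n^2). Under the random removal xi^k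
    has mean q_k + O(1/n), whence the covariance q_{i+j} - q_i q_j of xi^i and xi^j. The filtration
    leaves the lower-degree terms of d_mu unspecified. They are combinations of functions
    n(n-1)...(n-j+1) d_nu with j = |nu| < m, and division by n(n-1)...(n-m+1) makes both their
    values and their increments negligible. The relation p_1 = 1 appears by itself, because p_1 is
    the size n. *)

Definition part := {s : seq nat | is_part s}.
Definition rows (l : part) (i : nat) : nat := nth 0%N (val l) i.
Definition psz (l : part) : nat := sumn (val l).
Definition part0 : part := exist _ [::] isT.

Lemma is_part_cons x s : is_part (x :: s) -> (0 < x)%N /\ is_part s.
Proof.
by case/andP=> /= so /andP[x0 al]; split=> //; rewrite /is_part (path_sorted so) al.
Qed.

Lemma size_part_sumn s : is_part s -> (size s <= sumn s)%N.
Proof. elim: s => //= x s IH /is_part_cons[x0 /IH]; lia. Qed.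

Lemma rows_noninc l i : (rows l i.+1 <= rows l i)%N.
Proof.
rewrite /rows; case: l => s /= /andP[so _].
have [Hi|Hi] := ltnP i.+1 (size s); last by rewrite nth_default.
by move/(sortedP 0%N): so => /(_ _ Hi).
Qed.

Lemma rows_mono l i j : (i <= j)%N -> (rows l j <= rows l i)%N.
Proof.
move=> /subnK <-; elim: (j - i)%N => //= d; apply: leq_trans; exact: rows_noninc.
Qed.

Lemma rows_default l i : (psz l <= i)%N -> rows l i = 0%N.
Proof.
case: l => s Hs; rewrite /psz /rows /= => Hi; rewrite nth_default //.
by apply: leq_trans Hi; apply: size_part_sumn.
Qed.

Lemma part_seq_ext s t : is_part s -> is_part t ->
  (forall i, nth 0%N s i = nth 0%N t i) -> s = t.
Proof.
move=> Hs Ht H.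
have szle a b : is_part a -> is_part b -> (forall i, nth 0%N a i = nth 0%N b i) ->
    (size a <= size b)%N.
  move=> Ha Hb Hab; rewrite leqNgt; apply/negP => Hlt.
  case/andP: Ha => _ /(all_nthP 0%N) /(_ _ Hlt).
  by rewrite Hab nth_default.
apply: (@eq_from_nth _ 0%N) => //.
by apply/eqP; rewrite eqn_leq !szle.
Qed.

Lemma rows_inj l m : rows l =1 rows m -> l = m.
Proof.
case: l m => s Hs [t Ht] H; apply/val_inj => /=; exact: part_seq_ext.
Qed.

Lemma nth_filter_pos s i : sorted geq s ->
  nth 0%N [seq x <- s | (0 < x)%N] i = nth 0%N s i.
Proof.
elim: s i => //= x s IH i so.
case: x so => [|x] so /=; last by case: i => //= i; apply: IH; apply: path_sorted so.
have al : all (pred1 0%N) s.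
  apply/allP => y ys; move: so; rewrite path_sortedE; last by move=> ? ? ?; lia.
  by case/andP=> /allP /(_ _ ys); rewrite /geq /=; lia.
have -> : [seq x <- s | (0 < x)%N] = [::].
  apply/eqP; rewrite -(negbK (_ == _)) -has_filter; apply/hasPn => y /(allP al) /eqP ->.
  by [].
rewrite nth_nil; case: i => //= i.
have [/(mem_nth 0%N)/(allP al)/eqP -> //|/(nth_default 0%N) ->//] := ltnP i (size s).
Qed.

(** Diagrams are built from their row lengths; [B] must bound the number of nonzero rows. The
    default [part0] can occur only when [f] is not nonincreasing. *)
Definition mkp (f : nat -> nat) (B : nat) : part :=
  insubd part0 [seq x <- mkseq f B | (0 < x)%N].

Lemma rows_mkp f B : (forall i, (f i.+1 <= f i)%N) -> f B = 0%N -> rows (mkp f B) =1 f.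
Proof.
move=> nf fB i.
have so : sorted geq (mkseq f B).
  apply/(sortedP 0%N) => j; rewrite size_mkseq => Hj; rewrite !nth_mkseq //; last by lia.
  exact: nf.
have fz j : (B <= j)%N -> f j = 0%N.
  by move=> /subnK <-; elim: (j - B)%N => // d; have := nf (d + B)%N; rewrite addSn; lia.
rewrite /rows val_insubd ifT; last first.
  rewrite /is_part filter_all andbT sorted_filter //.
  by move=> ? ? ?; rewrite /geq /=; lia.
rewrite nth_filter_pos //.
have [Hi|Hi] := ltnP i B; first by rewrite nth_mkseq.
by rewrite nth_default ?size_mkseq // fz.
Qed.

Definition addable (l : part) (i : nat) : bool := (i == 0%N) || (rows l i < rows l i.-1)%N.
Definition removable (l : part) (i : nat) : bool := (rows l i.+1 < rows l i)%N.
Definition padd (l : part) (i : nat) : part := mkp (fun j => rows l j + (j == i))%N (psz l).+1.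
Definition prem (l : part) (i : nat) : part := mkp (fun j => rows l j - (j == i))%N (psz l).

Lemma addable_bound l i : addable l i -> (i <= psz l)%N.
Proof.
case/orP=> [/eqP-> //|]; case: i => // i /=; case: (ltnP i (psz l)) => // /rows_default ->.
by rewrite ltn0.
Qed.

Lemma removable_bound l i : removable l i -> (i < psz l)%N.
Proof. rewrite /removable; case: (ltnP i (psz l)) => // /rows_default ->; lia. Qed.

Lemma rows_padd l i j : addable l i -> rows (padd l i) j = (rows l j + (j == i))%N.
Proof.
move=> ai; rewrite rows_mkp //.
  move=> k; have := rows_noninc l k; move: ai; rewrite /addable.
  by case: (eqVneq k.+1 i) => [<-|_] /=; lia.
rewrite rows_default //; have := addable_bound ai; lia.
Qed.

Lemma rows_prem l i j : removable l i -> rows (prem l i) j = (rows l j - (j == i))%N.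
Proof.
move=> ri; rewrite rows_mkp //.
  move=> k; have := rows_noninc l k; move: ri; rewrite /removable.
  by case: (eqVneq k i) => [->|_]; lia.
by rewrite rows_default.
Qed.

Lemma sumn_nth s B : (size s <= B)%N -> sumn s = (\sum_(i < B) nth 0 s i)%N.
Proof.
elim: s B => [|x s IH] [|B] //=; rewrite ?big_ord0 // => HB.
  by rewrite big1 // => i _; rewrite nth_nil.
by rewrite big_ord_recl /= (IH B).
Qed.

Lemma psz_rows l B : (psz l <= B)%N -> psz l = (\sum_(i < B) rows l i)%N.
Proof.
case: l => s Hs; rewrite /psz /rows /= => H; apply: sumn_nth.
by apply: leq_trans H; exact: size_part_sumn.
Qed.

Lemma rows_le_psz l i : (rows l i <= psz l)%N.
Proof.
have [/rows_default -> //|Hi] := leqP (psz l) i.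
by rewrite [X in (_ <= X)%N](@psz_rows l (psz l)) // (bigD1 (Ordinal Hi)) //= leq_addr.
Qed.

Lemma psz_bound l B : (forall i, (B <= i)%N -> rows l i = 0%N) ->
  psz l = (\sum_(i < B) rows l i)%N.
Proof.
move=> H; rewrite (@psz_rows l (B + psz l)) ?leq_addl //.
rewrite big_split_ord /= [X in (_ + X)%N]big1 ?addn0 // => i _; rewrite H //=; lia.
Qed.

Lemma psz_padd l i : addable l i -> psz (padd l i) = (psz l).+1.
Proof.
move=> ai; have Hi := addable_bound ai.
rewrite (@psz_bound _ (psz l).+1); last first.
  move=> j Hj; rewrite rows_padd // rows_default; lia.
under eq_bigr => j _ do rewrite rows_padd //.
rewrite big_split /= -psz_rows //.
rewrite (bigD1 (Ordinal (n := (psz l).+1) (m := i) Hi)) //= eqxx big1 ?addn0 ?addn1 //.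
by move=> j /negP Hj; case: eqP => // E; case: Hj; apply/eqP/val_inj.
Qed.

Lemma prem_padd l i : addable l i -> removable (padd l i) i /\ prem (padd l i) i = l.
Proof.
move=> ai; have R : removable (padd l i) i.
  rewrite /removable !rows_padd // eqxx; have := rows_noninc l i; lia.
split=> //; apply: rows_inj => j; rewrite rows_prem // rows_padd //; lia.
Qed.

Lemma padd_prem l i : removable l i -> addable (prem l i) i /\ padd (prem l i) i = l.
Proof.
move=> ri; have A : addable (prem l i) i.
  rewrite /addable; case: i ri => //= i ri; rewrite !rows_prem //=.
  rewrite eqxx; have := rows_noninc l i; move: ri; rewrite /removable; lia.
split=> //; apply: rows_inj => j; rewrite rows_padd // rows_prem //.
by move: ri; rewrite /removable; case: eqP => [->|]; lia.
Qed.

Lemma psz_prem l i : removable l i -> psz l = (psz (prem l i)).+1.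
Proof. by move=> /padd_prem[A {1}<-]; rewrite psz_padd. Qed.

Lemma edge_eq l m i : (addable l i && (padd l i == m)) = (removable m i && (prem m i == l)).
Proof.
apply/andP/andP => -[H /eqP <-].
  by have [-> ->] := prem_padd H.
by have [-> ->] := padd_prem H.
Qed.

(** Corners in distinct rows do not interfere, which cancels the off-diagonal terms in the
    commutator of [opD] and [opU]. The delicate case is j = i - 1, where both sides require row j to
    exceed row i by at least two. *)
Lemma add_rem_swap l i j : i != j ->
  (addable l i && removable (padd l i) j) = (removable l j && addable (prem l j) i).
Proof.
move=> ij; case ai: (addable l i) => /=; case rj: (removable l j) => //=.
- rewrite {1}/removable {1}/addable !rows_padd // !rows_prem //.
  move: ai rj; rewrite /addable /removable.
  case: i ij => [|i] ij /=; first by rewrite !(eq_sym j 0%N) (negbTE ij) /= addn0; lia.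
  rewrite (eq_sym j) (negbTE ij) eqSS; case: (eqVneq j i) => [->|]; lia.
- apply/negbTE; rewrite {1}/removable !rows_padd //.
  move: rj; rewrite /removable (eq_sym j) (negbTE ij); lia.
- apply/esym/negbTE; rewrite {1}/addable !rows_prem // (negbTE ij).
  by move: ai; rewrite /addable; case: (i) => //= i'; lia.
Qed.

Lemma padd_prem_swap l i j : i != j -> addable l i -> removable (padd l i) j ->
  prem (padd l i) j = padd (prem l j) i.
Proof.
move=> ij ai rj; have /esym := add_rem_swap l ij; rewrite ai rj /= => /andP[rj' ai'].
apply: rows_inj => k; rewrite rows_prem // rows_padd // rows_padd // rows_prem //.
case: (eqVneq k j) => [->|]; last by lia.
move: rj'; rewrite /removable (eq_sym j) (negbTE ij); lia.
Qed.

Lemma exists_removable l : (0 < psz l)%N ->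
  exists r, removable l r /\ forall i, (r < i)%N -> rows l i = 0%N.
Proof.
move=> Hl; have ex : exists i, (rows l i == 0)%N by exists (psz l); rewrite rows_default.
case: (ex_minnP ex) => -[|r] /eqP E rmin.
  suff : psz l = 0%N by move=> E0; rewrite E0 in Hl.
  by rewrite (@psz_bound l 0) ?big_ord0 // => i _; have := rows_mono l (leq0n i); lia.
have nr : rows l r != 0%N by apply/negP => /rmin; rewrite ltnn.
exists r; split; first by rewrite /removable E; lia.
by move=> i ri; have := rows_mono l ri; lia.
Qed.

Lemma psz0_part0 l : psz l = 0%N -> l = part0.
Proof.
move=> Hl; apply: rows_inj => i; rewrite rows_default; last by lia.
by rewrite /rows /= nth_nil.
Qed.

Lemma mem_Yn n s : (s \in Yn n) = is_part s && (sumn s == n).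
Proof.
rewrite mem_undup mem_filter; case H: (is_part s && (sumn s == n)) => //=; case/andP: H => Hs /eqP Hn.
have szs : (size s <= n)%N by rewrite -Hn size_part_sumn.
(* The tuple is [s] padded to length n by zeros, which the filter deletes again. *)
apply/mapP; exists [tuple inord (nth 0%N s i) | i < n]; first by rewrite mem_enum.
have nle i : (nth 0%N s i <= n)%N.
  have [Hi|Hi] := ltnP i (size s); last by rewrite nth_default.
  by rewrite -Hn (sumn_nth (leqnn _)) (bigD1 (Ordinal Hi)) //= leq_addr.
have -> : map (@nat_of_ord n.+1) [tuple inord (nth 0%N s i) | i < n] = s ++ nseq (n - size s) 0%N.
  apply: (@eq_from_nth _ 0%N).
    by rewrite size_map size_tuple size_cat size_nseq subnKC.
  move=> i; rewrite size_map size_tuple => Hi.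
  rewrite (nth_map ord0) ?size_tuple // -[ i ]/(nat_of_ord (Ordinal Hi)) -tnth_nth tnth_mktuple /=.
  rewrite inordK ?ltnS //; rewrite nth_cat; case: ltnP => // H.
  by rewrite nth_nseq if_same nth_default.
rewrite filter_cat [X in _ ++ X](_ : _ = [::]) ?cats0; last by elim: (n - size s)%N.
by apply/esym/all_filterP; case/andP: Hs.
Qed.

Definition Yp n : seq part := pmap insub (Yn n).

Lemma mem_Yp n l : (l \in Yp n) = (psz l == n).
Proof.
by rewrite mem_pmap_sub mem_Yn; case: l => s Hs /=; rewrite Hs.
Qed.

Lemma Yp_uniq n : uniq (Yp n).
Proof. by apply: pmap_sub_uniq; apply: undup_uniq. Qed.

Lemma val_Yp n : map val (Yp n) = Yn n.
Proof.
rewrite /Yp (pmap_filter (@insubK _ _ _)); apply/all_filterP/allP => s; rewrite mem_Yn => /andP[Hs _].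
by rewrite insubT.
Qed.

(** * Box addition and removal operators *)

Section Ops.
Variable R : realFieldType.
Implicit Types (F : part -> R) (l : part).

(** This is the content of the box that can be added to row i; the last box already present in row i
    has content [content l i - 1]. *)
Definition content l i : R := (rows l i)%:R - i%:R.
Definition opU F l : R := \sum_(i < (psz l).+1 | removable l i) F (prem l i).
Definition opD k F l : R :=
  \sum_(i < (psz l).+1 | addable l i) content l i ^+ k * F (padd l i).
Definition boxsum (g : R -> R) l : R :=
  \sum_(i < psz l) \sum_(j < rows l i) g (j%:R - i%:R).

Lemma contentE l i : content l i = (rows l i)%:R - i%:R.
Proof. by []. Qed.

Lemma widen_add B l (h : nat -> R) : (psz l < B)%N ->
  \sum_(i < (psz l).+1 | addable l i) h i = \sum_(i < B | addable l i) h i.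
Proof.
move=> HB; rewrite (big_ord_widen_cond B) //; apply: eq_bigl => i.
by case ai: (addable l i) => //=; rewrite ltnS addable_bound.
Qed.

Lemma widen_rem B l (h : nat -> R) : (psz l < B)%N ->
  \sum_(i < (psz l).+1 | removable l i) h i = \sum_(i < B | removable l i) h i.
Proof.
move=> HB; rewrite (big_ord_widen_cond B) //; apply: eq_bigl => i.
by case ai: (removable l i) => //=; rewrite ltnS ltnW ?removable_bound.
Qed.

Lemma boxsum_widen B g l : (psz l <= B)%N ->
  boxsum g l = \sum_(i < B) \sum_(j < rows l i) g (j%:R - i%:R).
Proof.
move=> HB; rewrite /boxsum (big_ord_widen B (fun i : nat => \sum_(j < rows l i) g (j%:R - i%:R))) //.
rewrite [RHS](bigID (fun i : 'I_B => (i < psz l)%N)) /=.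
rewrite [X in _ = _ + X]big1 ?addr0 // => i; rewrite -leqNgt => Hi.
by rewrite rows_default // big_ord0.
Qed.

Lemma boxsum_padd g l i : addable l i -> boxsum g (padd l i) = boxsum g l + g (content l i).
Proof.
move=> ai; have Hi := addable_bound ai.
rewrite (@boxsum_widen (psz l).+2) ?psz_padd // (@boxsum_widen (psz l).+2 g l); last lia.
have Hi' : (i < (psz l).+2)%N by lia.
rewrite (bigD1 (Ordinal Hi')) //= [in RHS](bigD1 (Ordinal Hi')) //=.
rewrite rows_padd // eqxx addn1 big_ord_recr /= -!addrA; congr (_ + _).
rewrite addrC; congr (_ + _); apply: eq_bigr => j Hj.
rewrite rows_padd //; case: eqP => [E|]; last by rewrite addn0.
by case/negP: Hj; apply/eqP/val_inj.
Qed.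

Lemma boxsumD g h l : boxsum (fun c => g c + h c) l = boxsum g l + boxsum h l.
Proof. by rewrite -big_split; apply: eq_bigr => i _; rewrite -big_split. Qed.

Lemma boxsumZ a g l : boxsum (fun c => a * g c) l = a * boxsum g l.
Proof. by rewrite mulr_sumr; apply: eq_bigr => i _; rewrite mulr_sumr. Qed.

Lemma boxsum_sum I (s : seq I) (g : I -> R -> R) l :
  boxsum (fun c => \sum_(k <- s) g k c) l = \sum_(k <- s) boxsum (g k) l.
Proof.
rewrite exchange_big; apply: eq_bigr => i _; exact: exchange_big.
Qed.

Lemma eq_boxsum g h l : g =1 h -> boxsum g l = boxsum h l.
Proof. by move=> gh; apply: eq_bigr => i _; apply: eq_bigr => j _. Qed.

Definition pisum k l : R := boxsum (fun c => c ^+ k) l.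

Lemma pisumE k l : pisum k l = boxsum (fun c => c ^+ k) l.
Proof. by []. Qed.

Lemma pisum0 l : pisum 0 l = (psz l)%:R.
Proof.
rewrite (@psz_rows l (psz l)) // natr_sum; apply: eq_bigr => i _.
by under eq_bigr => j _ do rewrite expr0; rewrite sumr_const card_ord.
Qed.

Lemma pisum_padd k l i : addable l i -> pisum k (padd l i) = pisum k l + content l i ^+ k.
Proof. exact: boxsum_padd. Qed.

(** The power sum of Kerov's interlacing coordinates: contents of addable boxes against contents of
    removable ones. *)
Definition esum k l : R :=
  \sum_(i < (psz l).+1 | addable l i) content l i ^+ k
  - \sum_(i < (psz l).+1 | removable l i) (content l i - 1) ^+ k.

Lemma content_prem l i : removable l i -> content (prem l i) i = content l i - 1.
Proof.
move=> ri; rewrite /content rows_prem // eqxx natrB; last by move: ri; rewrite /removable; lia.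
by rewrite addrAC.
Qed.

Lemma content_prem_neq l i j : removable l j -> i != j -> content (prem l j) i = content l i.
Proof. by move=> rj ij; rewrite /content rows_prem // (negbTE ij) subn0. Qed.

(** Only the moves that return to [l], adding and removing in the same row, differ between the two
    orders: one order weights them by the addable boxes, the other by the removable ones. Moves in
    distinct rows cancel by [add_rem_swap]. *)
Lemma opD_opU k F l : opD k (opU F) l = opU (opD k F) l + esum k l * F l.
Proof.
set B := (psz l).+3.
have -> : opD k (opU F) l = \sum_(i < B | addable l i) \sum_(j < B | removable (padd l i) j)
    content l i ^+ k * F (prem (padd l i) j).
  rewrite /opD (@widen_add B _ (fun i => content l i ^+ k * opU F (padd l i))); last by rewrite /B; lia.
  apply: eq_bigr => i ai; rewrite /opU mulr_sumr.
  by rewrite (@widen_rem B _ (fun j => content l i ^+ k * F (prem (padd l i) j))) // psz_padd.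
have -> : opU (opD k F) l = \sum_(j < B | removable l j) \sum_(i < B | addable (prem l j) i)
    content (prem l j) i ^+ k * F (padd (prem l j) i).
  rewrite /opU (@widen_rem B _ (fun j => opD k F (prem l j))); last by rewrite /B; lia.
  apply: eq_bigr => j rj; rewrite /opD.
  rewrite (@widen_add B _ (fun i => content (prem l j) i ^+ k * F (padd (prem l j) i))) //.
  by have := psz_prem rj; rewrite /B; lia.
rewrite /esum (@widen_add B _ (fun i => content l i ^+ k)); last by rewrite /B; lia.
rewrite (@widen_rem B _ (fun i => (content l i - 1) ^+ k)); last by rewrite /B; lia.
have -> : \sum_(i < B | addable l i) \sum_(j < B | removable (padd l i) j)
    content l i ^+ k * F (prem (padd l i) j) =
  \sum_(i < B | addable l i) content l i ^+ k * F l +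
  \sum_(i < B) \sum_(j < B) (if (i != j) && (addable l i && removable (padd l i) j)
    then content l i ^+ k * F (prem (padd l i) j) else 0).
  rewrite [X in _ = _ + X](bigID (fun i : 'I_B => addable l i)) /= [X in _ + (_ + X)]big1 ?addr0.
    rewrite -big_split /=; apply: eq_bigr => i ai.
    have [ri pi] := prem_padd ai.
    rewrite (bigD1 i) //= pi; congr (_ + _).
    rewrite -big_mkcond /=; apply: eq_bigl => j; rewrite ai andbC /= andbC.
    by rewrite -val_eqE eq_sym andbC.
  by move=> i /negbTE ai; rewrite big1 // => j _; rewrite ai andbF.
have -> : \sum_(j < B | removable l j) \sum_(i < B | addable (prem l j) i)
    content (prem l j) i ^+ k * F (padd (prem l j) i) =
  \sum_(j < B | removable l j) (content l j - 1) ^+ k * F l +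
  \sum_(j < B) \sum_(i < B) (if (i != j) && (removable l j && addable (prem l j) i)
    then content l i ^+ k * F (padd (prem l j) i) else 0).
  rewrite [X in _ = _ + X](bigID (fun j : 'I_B => removable l j)) /= [X in _ + (_ + X)]big1 ?addr0.
    rewrite -big_split /=; apply: eq_bigr => j rj.
    have [ai pi] := padd_prem rj.
    rewrite (bigD1 j) //= pi content_prem //; congr (_ + _).
    rewrite -big_mkcond /= rj /=.
    apply: eq_big => i; first by rewrite andbC.
    by move=> /andP[_ ij]; rewrite content_prem_neq.
  by move=> j /negbTE rj; rewrite big1 // => i _; rewrite rj andbF.
rewrite -!mulr_suml mulrBl.
rewrite [X in _ = _ + X + _]exchange_big /=.
have -> : \sum_(i < B) \sum_(j < B) (if (i != j) && (addable l i && removable (padd l i) j)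
    then content l i ^+ k * F (prem (padd l i) j) else 0) =
  \sum_(i < B) \sum_(j < B) (if (i != j) && (removable l j && addable (prem l j) i)
    then content l i ^+ k * F (padd (prem l j) i) else 0).
  apply: eq_bigr => i _; apply: eq_bigr => j _.
  case: (eqVneq i j) => //= ij; rewrite -val_eqE in ij.
  rewrite add_rem_swap //; case: ifP => // H.
  by rewrite padd_prem_swap //; move: H; rewrite -add_rem_swap // => /andP[].
ring.
Qed.

(** If row i is not removable, row i + 1 is not addable and [content l i.+1 = content l i - 1], so
    the two missing terms would cancel and the corner conditions may be dropped. The contribution of
    each row is then a telescoping sum of second differences over its boxes. *)
Lemma esumE k l : esum k l =
  0 ^+ k + boxsum (fun c => (c + 1) ^+ k + (c - 1) ^+ k - c ^+ k *+ 2) l.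
Proof.
set L := psz l.
have -> : esum k l = content l L ^+ k +
    \sum_(i < L) (content l i ^+ k - (content l i - 1) ^+ k).
  rewrite /esum -/L big_mkcond big_ord_recl /= {1}/addable /=.
  rewrite [X in _ - X]big_mkcond big_ord_recr /=.
  have -> : removable l L = false by rewrite /removable [X in (_ < X)%N]rows_default.
  rewrite addr0 big_split /= sumrN.
  have -> : content l L ^+ k + (\sum_(i < L) content l i ^+ k - \sum_(i < L) (content l i - 1) ^+ k) =
     \sum_(i < L.+1) content l i ^+ k - \sum_(i < L) (content l i - 1) ^+ k.
    by rewrite big_ord_recr /=; ring.
  rewrite big_ord_recl /= -!addrA; congr (_ + _).
  rewrite -!sumrB; apply: eq_bigr => i _.
  rewrite /bump leq0n !add1n /addable /removable /= ?add0n; case: ifP => H.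
    by ring.
  have E : rows l i.+1 = rows l i by have := rows_noninc l i; lia.
  by rewrite /content E -[i.+1%:R]natr1 opprD addrA !subrr.
have tele : forall (h : nat -> R) n, \sum_(j < n) (h j.+1 - h j) = h n - h 0%N.
  move=> h n; elim: n => [|n IH]; first by rewrite big_ord0 subrr.
  by rewrite big_ord_recr /= IH; ring.
have -> : boxsum (fun c => (c + 1) ^+ k + (c - 1) ^+ k - c ^+ k *+ 2) l =
  \sum_(i < L) ((content l i ^+ k - (content l i - 1) ^+ k) +
     ((- i.+1%:R) ^+ k - (- i%:R) ^+ k)).
  apply: eq_bigr => i _.
  pose h j : R := (j%:R - i%:R) ^+ k - (j%:R - i%:R - 1) ^+ k.
  rewrite (eq_bigr (fun j : 'I__ => h j.+1 - h j)).
    by rewrite tele /h /content mulr0n !sub0r -[i.+1%:R]natr1 [- (i%:R + 1)]opprD; ring.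
  move=> j _; rewrite /h -[j.+1%:R]natr1.
  have -> : j%:R + 1 - i%:R = j%:R - i%:R + 1 :> R by ring.
  by rewrite addrK; ring.
(* The row starts telescope to (-L)^k - 0^k, and -L is the content of the box that would open row
   L. *)
rewrite [in RHS]big_split /= (tele (fun i => (- i%:R) ^+ k)) /content rows_default // sub0r oppr0.
ring.
Qed.

Definition ecoef k j : R := ((1 + (-1) ^+ (k - j)) * 'C(k, j)%:R).

Lemma esum0 l : esum 0 l = 1.
Proof.
rewrite esumE expr0 [boxsum _ _]big1 ?addr0 // => i _; rewrite big1 // => j _.
by rewrite !expr0; ring.
Qed.

Lemma esum1 l : esum 1 l = 0.
Proof.
rewrite esumE expr1 [boxsum _ _]big1 ?addr0 // => i _; rewrite big1 // => j _.
by rewrite !expr1; ring.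
Qed.

(** The second difference of c^(k+2) starts with the second derivative; the terms c^(k+2) and
    c^(k+1) drop out, the latter by parity. *)
Lemma esumS k l : esum k.+2 l = (k.+2 * k.+1)%:R * pisum k l
  + \sum_(j < k) ecoef k.+2 j * pisum j l.
Proof.
rewrite esumE expr0n add0r /pisum.
under [X in _ = _ + X]eq_bigr => j _ do rewrite -boxsumZ.
rewrite -(boxsum_sum (index_enum 'I_k) (fun j c => ecoef k.+2 j * c ^+ j)) -boxsumZ -boxsumD.
apply: eq_boxsum => c.
rewrite [c + 1]addrC [c - 1]addrC !exprDn.
rewrite -big_split /=.
rewrite (eq_bigr (fun i : 'I__ => ecoef k.+2 i * c ^+ i)); last first.
  move=> i _; rewrite /ecoef expr1n -mulrnDl -mulrDl mulr_natr.
  by rewrite mulrnAl.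
rewrite 3!big_ord_recr /=.
have -> : ecoef k.+2 k = (k.+2 * k.+1)%:R.
  rewrite /ecoef -[X in (-1) ^+ X](_ : 2 = _)%N; last by lia.
  rewrite sqrrN expr1n (_ : 1 + 1 = 2%:R) // -natrM; congr (_%:R).
  have -> : 'C(k.+2, k) = 'C(k.+2, 2) by rewrite -(@bin_sub k.+2 2) // !subSS subn0.
  by rewrite bin2 mul2n -[RHS]odd_double_half oddM /= negbK; case: odd.
have -> : ecoef k.+2 k.+1 = 0.
  by rewrite /ecoef subSn // subnn expr1 subrr mul0r.
have -> : ecoef k.+2 k.+2 = 2 by rewrite /ecoef subnn binn expr0 mulr1.
by rewrite mul0r addr0 -[X in _ - X]mulr_natl addrK addrC.
Qed.

End Ops.

(** * The filtration by degree *)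

Section Filtration.
Variable R : realFieldType.
Implicit Types (F G K : part -> R) (l : part) (a : R).
Local Notation content := (content R).

Definition opT F l : R := (psz l)%:R * F l - opU F l.
Definition opTs a F l : R := opT F l - a * F l.
Definition opX F l : R := opD 0 F l - F l.
Definition opY F l : R := opD 1 F l.

(* F is a sum of eigenvectors of T with eigenvalues in {0, ..., k - 1}: the
   functions of "degree" < k. *)
Fixpoint gdeg k F : Prop :=
  if k is k'.+1 then gdeg k' (opTs k'%:R F) else forall l, F l = 0.

Lemma opU_lin a b F G : opU (fun l => a * F l + b * G l) = fun l => a * opU F l + b * opU G l.
Proof. by apply: funext => l; rewrite /opU big_split /= -!mulr_sumr. Qed.

Lemma opD_lin k a b F G : opD k (fun l => a * F l + b * G l) =
  fun l => a * opD k F l + b * opD k G l.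
Proof.
apply: funext => l; rewrite /opD !mulr_sumr -big_split /=.
by apply: eq_bigr => i _; ring.
Qed.

Lemma opT_lin a b F G : opT (fun l => a * F l + b * G l) =
  fun l => a * opT F l + b * opT G l.
Proof. by apply: funext => l; rewrite /opT opU_lin; ring. Qed.

Lemma opTs_lin c a b F G : opTs c (fun l => a * F l + b * G l) =
  fun l => a * opTs c F l + b * opTs c G l.
Proof. by apply: funext => l; rewrite /opTs opT_lin; ring. Qed.

Lemma opTsE a F : opTs a F = fun l => 1 * opT F l + (- a) * F l.
Proof. by apply: funext => l; rewrite /opTs; ring. Qed.

Lemma opTs_comm a b F : opTs a (opTs b F) = opTs b (opTs a F).
Proof.
by apply: funext => l; rewrite [opTs b F]opTsE [opTs a F]opTsE !opTs_lin /opTs; ring.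
Qed.

Lemma gdeg_lin k a b F G : gdeg k F -> gdeg k G -> gdeg k (fun l => a * F l + b * G l).
Proof.
elim: k F G => [|k IH] F G /= HF HG; last by rewrite opTs_lin; apply: IH.
by move=> l; rewrite HF HG !mulr0 addr0.
Qed.

Lemma gdeg_eq k F G : F =1 G -> gdeg k F -> gdeg k G.
Proof. by move=> /funext ->. Qed.

Lemma gdeg_0 k : gdeg k (fun _ => 0).
Proof.
elim: k => //= k; apply: gdeg_eq => l.
by rewrite /opTs /opT /opU big1 // !mulr0 !subr0.
Qed.

Lemma gdeg_Z k a F : gdeg k F -> gdeg k (fun l => a * F l).
Proof.
move=> H; apply: gdeg_eq (gdeg_lin a 0 H H) => l; ring.
Qed.
Lemma gdeg_D k F G : gdeg k F -> gdeg k G -> gdeg k (fun l => F l + G l).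
Proof.
move=> H H'; apply: gdeg_eq (gdeg_lin 1 1 H H') => l; ring.
Qed.
Lemma gdeg_B k F G : gdeg k F -> gdeg k G -> gdeg k (fun l => F l - G l).
Proof.
move=> H H'; apply: gdeg_eq (gdeg_lin 1 (-1) H H') => l; ring.
Qed.

Lemma gdeg_sum I (s : seq I) (P : pred I) k (F : I -> part -> R) :
  (forall i, P i -> gdeg k (F i)) -> gdeg k (fun l => \sum_(i <- s | P i) F i l).
Proof.
move=> H; elim: s => [|x s IH].
  by apply: gdeg_eq (gdeg_0 k) => l; rewrite big_nil.
case Px : (P x).
  by apply: gdeg_eq (gdeg_D (H _ Px) IH) => l; rewrite big_cons Px.
by apply: gdeg_eq IH => l; rewrite big_cons Px.
Qed.

Lemma gdeg_Ts k a F : gdeg k F -> gdeg k (opTs a F).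
Proof.
elim: k F => [|k IH] F /= HF; last by rewrite opTs_comm; apply: IH.
by move=> l; rewrite /opTs /opT /opU HF big1 // !mulr0 !subr0.
Qed.

Lemma gdegS k F : gdeg k F -> gdeg k.+1 F.
Proof. by move=> H /=; apply: gdeg_Ts. Qed.

Lemma gdeg_mono k m F : (k <= m)%N -> gdeg k F -> gdeg m F.
Proof. by move=> /subnK <-; elim: (m - k)%N => //= d IH H; apply: gdegS; apply: IH. Qed.

Lemma opU_below n F l : (forall m, (psz m < n)%N -> F m = 0) -> (psz l <= n)%N -> opU F l = 0.
Proof.
move=> H Hl; rewrite /opU big1 // => i ri; apply: H.
by have := psz_prem ri; lia.
Qed.

(** [opT] is triangular with respect to size, with diagonal entry n on level n. Hence an
    eigenfunction is determined by its values on the level equal to its eigenvalue. The bound [B]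
    covers eigenvalue equations known on small diagrams only. *)
Lemma level_zero B a F :
  (forall l, (psz l < B)%N -> opT F l = a * F l) ->
  (forall l, (psz l < B)%N -> (psz l)%:R = a -> F l = 0) ->
  forall l, (psz l < B)%N -> F l = 0.
Proof.
move=> HT H0 l; move: {2}(psz l) (leqnn (psz l)) => n.
elim/ltn_ind: n l => n IH l Hn HB.
have := HT l HB; rewrite /opT (@opU_below (psz l)) //; last first.
  by move=> m Hm; apply: (IH (psz m)); lia.
rewrite subr0 => /eqP; rewrite -subr_eq0 -mulrBl mulf_eq0 subr_eq0.
by case/orP=> /eqP // /(H0 l HB).
Qed.

(** T has no Jordan blocks. The function K = (T - k)F is an eigenfunction, so it vanishes below
    level k, and then so does F; on level k both terms of (n - k)F - UF vanish, so K is zero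
    everywhere. *)
Lemma opTs_sq (k : nat) F : (forall l, opTs k%:R (opTs k%:R F) l = 0) ->
  forall l, opTs k%:R F l = 0.
Proof.
set K := opTs _ F => HK.
have TK l : opT K l = k%:R * K l by apply/eqP; rewrite -subr_eq0; apply/eqP/HK.
have nk l : (psz l < k)%N -> (psz l)%:R = k%:R :> R -> False.
  by move=> H /eqP; rewrite eqr_nat; lia.
have K0 : forall l, (psz l < k)%N -> K l = 0.
  by apply: (level_zero (a := k%:R)) => // l H /(nk _ H).
have F0 : forall l, (psz l < k)%N -> F l = 0.
  apply: (level_zero (a := k%:R)) => [l /K0 /eqP|l H /(nk _ H) //].
  by rewrite subr_eq0 => /eqP.
move=> l; apply: (level_zero (a := k%:R) (B := (psz l).+1)) => // m _ /eqP.
rewrite eqr_nat => /eqP E; rewrite /K /opTs /opT E (@opU_below k) //; last by rewrite E.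
ring.
Qed.

Lemma gdeg_TsI_neg1 k F : gdeg k (opTs (-1) F) -> gdeg k F.
Proof.
elim: k F => [|k IH] F /= HF; last by apply: IH; rewrite opTs_comm.
move=> l; apply: (level_zero (a := -1) (B := (psz l).+1)) => // m _.
  by apply/eqP; rewrite -subr_eq0; apply/eqP/HF.
move=> E; have := ler0n R (psz m); rewrite E; lra.
Qed.

(** The factor T - a already occurs in the product that defines [gdeg k], and by [opTs_sq] a
    repeated factor can be cancelled. *)
Lemma gdeg_TsI k (a : nat) F : (a < k)%N -> gdeg k (opTs a%:R F) -> gdeg k F.
Proof.
elim: k F => // k IH F ak /= HF.
have [E|ne] := eqVneq a k; last by apply: IH; [lia|rewrite opTs_comm].
subst a.
have Q : forall j G, gdeg j (opTs k%:R (opTs k%:R G)) -> gdeg j (opTs k%:R G).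
  elim=> [|j IHj] G /=; first exact: opTs_sq.
  by move=> H; rewrite opTs_comm; apply: IHj; rewrite (opTs_comm _ j%:R) (opTs_comm _ j%:R).
exact: Q.
Qed.

Lemma opD_opT k F l : opD k (opT F) l = opT (opD k F) l + opD k F l - esum R k l * F l.
Proof.
have -> : opD k (opT F) l = (psz l).+1%:R * opD k F l - opD k (opU F) l.
  rewrite /opD mulr_sumr -sumrB; apply: eq_bigr => i ai.
  by rewrite /opT psz_padd //; ring.
rewrite opD_opU /opT -natr1; ring.
Qed.

(** The term e_0 = 1 of the commutation relation is absorbed by the -1 in [opX], and e_1 = 0 settles
    [opY]. So X and Y lower T-eigenvalues by one exactly, whereas for D_k with k >= 2 the term e_k
    remains. *)
Lemma opX_opTs a F : opX (opTs a F) = opTs (a - 1) (opX F).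
Proof.
apply: funext => l; rewrite /opX {2}/opTs.
rewrite opTsE opD_lin opD_opT esum0 mul1r /opTs.
have -> : (fun l0 => opD 0 F l0 - F l0) = fun l0 => 1 * opD 0 F l0 + (-1) * F l0.
  by apply: funext => ?; ring.
rewrite opT_lin; ring.
Qed.

Lemma opY_opTs a F : opY (opTs a F) = opTs (a - 1) (opY F).
Proof.
apply: funext => l; rewrite /opY opTsE opD_lin opD_opT esum1 /opTs.
ring.
Qed.

Lemma opX_lin a b F G : opX (fun l => a * F l + b * G l) = fun l => a * opX F l + b * opX G l.
Proof. by apply: funext => l; rewrite /opX opD_lin; ring. Qed.

Lemma opY_lin a b F G : opY (fun l => a * F l + b * G l) = fun l => a * opY F l + b * opY G l.
Proof. exact: opD_lin. Qed.

(** Macdonald's statistic n(lambda), which grows by i when a box is added to row i. *)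
Definition nrank l : nat := (\sum_(i < psz l) i * rows l i)%N.

Lemma nrank_padd l i : addable l i -> nrank (padd l i) = (nrank l + i)%N.
Proof.
move=> ai; have Hi := addable_bound ai.
rewrite /nrank psz_padd //.
have -> : (\sum_(j < psz l) j * rows l j = \sum_(j < (psz l).+1) j * rows l j)%N.
  by rewrite big_ord_recr /= [rows l (psz l)]rows_default // muln0 addn0.
under eq_bigr => j _ do rewrite rows_padd // mulnDr.
rewrite big_split /=; congr (_ + _)%N.
have Hi' : (i < (psz l).+1)%N by lia.
rewrite (bigD1 (Ordinal Hi')) //= eqxx muln1 big1 ?addn0 // => j /negP Hj.
by case: eqP => [E|]; [case: Hj; apply/eqP/val_inj|rewrite muln0].
Qed.

(* In the combination D_1 - c D_0, with c the content of the
   box opening row r + 1 of nu, that box drops out; every remaining box other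
   than the one giving l lies in a row above r, which lowers nrank. *)
Lemma opD01_inj n K :
  (forall l, psz l = n -> opD 0 K l = 0) -> (forall l, psz l = n -> opD 1 K l = 0) ->
  forall l, psz l = n.+1 -> K l = 0.
Proof.
move=> H0 H1 l; move: {2}(nrank l) (leqnn (nrank l)) => d.
elim/ltn_ind: d l => d IH l Hd Hl.
have [r [rr rz]] : exists r, removable l r /\ forall i, (r < i)%N -> rows l i = 0%N.
  by apply: exists_removable; rewrite Hl.
set nu := prem l r; have [ar lE] := padd_prem rr; rewrite -/nu in ar lE.
have Hnu : psz nu = n by have := psz_prem rr; rewrite -/nu Hl; lia.
have nrk : nrank l = (nrank nu + r)%N by rewrite -lE nrank_padd.
have rr' := removable_bound rr.
have : \sum_(i < (psz nu).+1 | addable nu i) (content nu i - content nu r.+1) * K (padd nu i) = 0.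
  transitivity (opD 1 K nu - content nu r.+1 * opD 0 K nu); last by rewrite H0 // H1 //; ring.
  by rewrite /opD mulr_sumr -sumrB; apply: eq_bigr => i _; ring.
have Hr : (r < (psz nu).+1)%N by have := addable_bound ar; lia.
rewrite (bigD1 (Ordinal Hr)) //= lE big1 ?addr0 => [|i /andP[ai ir]].
  move=> /eqP; rewrite mulf_eq0 => /orP[|/eqP//].
  have nz : rows nu r.+1 = 0%N by rewrite /nu rows_prem // (rz r.+1).
  rewrite !contentE nz mulr0n.
  move=> /eqP E; exfalso.
  have : (rows nu r).+1%:R = 0 :> R by rewrite -E -[r.+1%:R]natr1 -natr1; ring.
  by move/eqP; rewrite pnatr_eq0.
have {}ir : i != r :> nat by apply: contraNneq ir => e; apply/eqP/val_inj.
have [lt|ge] := ltnP i r.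
  rewrite (IH (nrank (padd nu i))) ?mulr0 // ?psz_padd ?Hnu // nrank_padd //; lia.
have [->|ne] := eqVneq (i : nat) r.+1; first by rewrite subrr mul0r.
exfalso; move: ai; rewrite /addable.
have Hi : (r < i.-1)%N by move: (i : nat) ge ir ne => m; lia.
have -> : rows nu i.-1 = 0%N by rewrite /nu rows_prem // (rz _ Hi) sub0n.
by rewrite ltn0 orbF; lia.
Qed.

Lemma opXY_inj K : (forall l, opX K l = 0) -> (forall l, opY K l = 0) -> K part0 = 0 ->
  forall l, K l = 0.
Proof.
move=> HX HY H0.
suff H : forall n l, psz l = n -> K l = 0 by move=> l; apply: H erefl.
elim=> [|n IH].
  move=> l Hl; suff -> : l = part0 by [].
  apply: rows_inj => i; rewrite rows_default; last by lia.
  by rewrite /rows /= nth_nil.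
apply: opD01_inj => l Hl; last exact: HY.
by have /eqP := HX l; rewrite /opX (IH _ Hl) subr0 => /eqP.
Qed.

(** Since X and Y intertwine T - (k+1) with T - k, one factor at a time is peeled off. At the
    bottom, TF is killed by X and Y, and it vanishes at the empty diagram because T does there, so
    [opXY_inj] applies. *)
Lemma gdeg_XY k F : gdeg k (opX F) -> gdeg k (opY F) -> gdeg k.+1 F.
Proof.
elim: k F => [|k IH] F HX HY.
  apply: opXY_inj.
  - rewrite opX_opTs; exact: (gdeg_Ts (k := 0)).
  - rewrite opY_opTs; exact: (gdeg_Ts (k := 0)).
  - by rewrite /opTs /opT (@opU_below 0) // mulr0n !mul0r !subr0.
suff : gdeg k.+1 (opTs k.+1%:R F) by [].
have E : k.+1%:R - 1 = k%:R :> R by rewrite -natr1 addrK.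
by apply: IH; rewrite ?opX_opTs ?opY_opTs E.
Qed.

(** The intertwining reduces this to TF = 0; then XF is an eigenfunction with eigenvalue -1, which
    is not the size of any diagram. *)
Lemma gdeg_X k F : gdeg k.+1 F -> gdeg k (opX F).
Proof.
elim: k F => [|k IH] F HF.
  have TF l : opT F l = 0.
    by have := HF l; rewrite /opTs mul0r subr0.
  have : gdeg 0 (opX (opTs 0 F)).
    by move=> l; rewrite /opX /opD HF big1 ?subrr // => i _; rewrite HF mulr0.
  by rewrite opX_opTs sub0r; apply: gdeg_TsI_neg1.
have E : k.+1%:R - 1 = k%:R :> R by rewrite -natr1 addrK.
have H : gdeg k.+1 (opTs k.+1%:R F) by [].
by have := IH _ H; rewrite opX_opTs E.
Qed.

Lemma gdeg_Y k F : gdeg k.+1 F -> gdeg k (opY F).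
Proof.
elim: k F => [|k IH] F HF.
  have TF l : opT F l = 0.
    by have := HF l; rewrite /opTs mul0r subr0.
  have : gdeg 0 (opY (opTs 0 F)).
    by move=> l; rewrite /opY /opD big1 // => i _; rewrite HF mulr0.
  by rewrite opY_opTs sub0r; apply: gdeg_TsI_neg1.
have E : k.+1%:R - 1 = k%:R :> R by rewrite -natr1 addrK.
have H : gdeg k.+1 (opTs k.+1%:R F) by [].
by have := IH _ H; rewrite opY_opTs E.
Qed.

Lemma opD_pi k j F l :
  opD k (fun l => pisum R j l * F l) l = pisum R j l * opD k F l + opD (k + j) F l.
Proof.
rewrite /opD mulr_sumr -big_split; apply: eq_bigr => i ai.
by rewrite pisum_padd //= exprD; ring.
Qed.

End Filtration.

(** * Symbols of multiplication operators *)

Section Symbols.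
Variable R : realFieldType.
Implicit Types (F G K f g : part -> R) (l : part) (a : R).
Local Notation pisum := (pisum R).

Lemma opTs_opD a j F : opTs a (opD j F) =
  fun l => opD j (opTs (a + 1) F) l + esum R j l * F l.
Proof.
by apply: funext => l; rewrite (opTsE (a + 1)) opD_lin opD_opT /opTs; ring.
Qed.

Lemma gdeg0 k F : gdeg 0 F -> gdeg k F.
Proof. exact: gdeg_mono. Qed.

Definition pi_stable j := forall k F, gdeg k F -> gdeg (k + j.+1) (fun l => pisum j l * F l).

Lemma gdeg_esum j k F : (forall i, (i < j)%N -> pi_stable i) -> gdeg k F ->
  gdeg (k + j) (fun l => esum R j.+1 l * F l).
Proof.
case: j => [|j] IH HF.
  by apply: gdeg_eq (gdeg_0 R _) => l; rewrite esum1 mul0r.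
apply: (@gdeg_eq _ _ (fun l => (j.+2 * j.+1)%:R * (pisum j l * F l) +
   \sum_(i < j) ecoef R j.+2 i * (pisum i l * F l))).
  by move=> l; rewrite esumS mulrDl [X in _ = _ + X]mulr_suml; congr (_ + _); [ring|apply: eq_bigr => i _; ring].
apply: gdeg_D; first by apply: gdeg_Z; apply: IH.
apply: gdeg_sum => i _; apply: gdeg_Z; apply: (@gdeg_mono _ (k + i.+1)).
  by have := ltn_ord i; lia.
by apply: IH => //; have := ltn_ord i; lia.
Qed.

(** Applying T - a to D_{j+1} F moves the shifted factor T - (a+1) onto F, which lowers its degree,
    at the price of e_{j+1} F. As e_{j+1} contains only pi_i with i < j, the hypothesis controls
    that term; the factor T - a is then cancelled. *)
Lemma gdeg_opD_aux j k F : (forall i, (i < j)%N -> pi_stable i) -> gdeg k F ->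
  gdeg (k + j) (opD j.+1 F).
Proof.
move=> IH; elim: k F => [|k IHk] F HF.
  by apply: gdeg0 => l; rewrite /opD big1 // => i _; rewrite HF mulr0.
have H a : a + 1 = k%:R -> gdeg (k.+1 + j) (opTs a (opD j.+1 F)).
  move=> E; rewrite opTs_opD E; apply: gdeg_D; last exact: gdeg_esum.
  by rewrite addSn; apply: gdegS; apply: IHk.
case: k HF IHk H => [|k] HF IHk H.
  by apply: gdeg_TsI_neg1; apply: H; rewrite addNr.
by apply: (@gdeg_TsI _ _ k); [lia|apply: H; rewrite natr1].
Qed.

(** X and Y applied to pi_j F produce pi_j XF and pi_j YF, covered by induction on k, and the extra
    terms D_j F and D_{j+1} F. The latter involve only pi_i with i < j, so induction on j closes.
    For j = 0 the extra term is D_0 F = F + XF. *)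
Lemma pi_stableP j : pi_stable j.
Proof.
elim/ltn_ind: j => j IH k; elim: k => [|k IHk] F HF.
  by apply: gdeg0 => l; rewrite HF mulr0.
rewrite addSn; apply: gdeg_XY.
- apply: (@gdeg_eq _ _ (fun l => pisum j l * opX F l + opD j F l)).
    by move=> l; rewrite /opX opD_pi; ring.
  apply: gdeg_D; first by apply: IHk; apply: gdeg_X.
  case: j IH IHk => [|j] IH IHk.
    apply: (@gdeg_eq _ _ (fun l => F l + opX F l)); first by move=> l; rewrite /opX; ring.
    rewrite addn1; apply: gdeg_D => //; apply: gdegS; exact: gdeg_X.
  apply: (@gdeg_mono _ (k.+1 + j)); first by lia.
  by apply: gdeg_opD_aux => // i Hi; apply: IH; lia.
- apply: (@gdeg_eq _ _ (fun l => pisum j l * opY F l + opD j.+1 F l)).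
    by move=> l; rewrite /opY opD_pi.
  apply: gdeg_D; first by apply: IHk; apply: gdeg_Y.
  apply: (@gdeg_mono _ (k.+1 + j)); first by lia.
  by apply: gdeg_opD_aux.
Qed.

Lemma gdeg_opD j k F : gdeg k F -> gdeg (k + j) (opD j.+1 F).
Proof. by apply: gdeg_opD_aux => i _; exact: pi_stableP. Qed.

(** Let F have degree at most k. Modulo lower degree T acts on D_{j+2} F as k + j + 1, while the
    commutation relation gives (T - (k-1)) D_{j+2} F = (j+2)(j+1) pi_j F. Comparison shows (j+2)
    D_{j+2} F = (j+2)(j+1) pi_j F modulo lower degree. *)
Lemma opD_lead j k F : gdeg k F ->
  gdeg (k + j) (fun l => opD j.+2 F l - j.+1%:R * pisum j l * F l).
Proof.
case: k => [|k] HF.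
  apply: gdeg0 => l; rewrite HF /opD big1 ?mulr0 ?subr0 // => i _; by rewrite HF mulr0.
have HA := gdeg_opD j.+1 HF.
have H1 : gdeg (k.+1 + j) (opTs (k + j.+1)%:R (opD j.+2 F)).
  by have : gdeg (k + j.+1).+1 (opD j.+2 F) by []; rewrite /= addnS.
have H2 : gdeg (k.+1 + j) (opD j.+2 (opTs k%:R F)).
  by rewrite addSnnS; apply: gdeg_opD.
have H3 : gdeg (k.+1 + j) (fun l => \sum_(i < j) ecoef R j.+2 i * (pisum i l * F l)).
  apply: gdeg_sum => i _; apply: gdeg_Z; apply: (@gdeg_mono _ (k.+1 + i.+1)).
    by have := ltn_ord i; lia.
  exact: pi_stableP.
have := gdeg_Z j.+2%:R^-1 (gdeg_B (gdeg_D H2 H3) H1); apply: gdeg_eq => l.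
have E : opTs (k%:R - 1) (opD j.+2 F) l = opD j.+2 (opTs k%:R F) l + esum R j.+2 l * F l.
  by rewrite opTs_opD addrNK.
have E2 : esum R j.+2 l * F l = (j.+2 * j.+1)%:R * pisum j l * F l +
    \sum_(i < j) ecoef R j.+2 i * (pisum i l * F l).
  rewrite esumS mulrDl [X in _ + X = _]mulr_suml; congr (_ + _); apply: eq_bigr => i _; ring.
have n0 : j.+2%:R != 0 :> R by rewrite pnatr_eq0.
apply: (mulfI n0); rewrite mulVKf //.
have -> : opD j.+2 (opTs k%:R F) l =
   opTs (k%:R - 1) (opD j.+2 F) l - (j.+2 * j.+1)%:R * pisum j l * F l -
    \sum_(i < j) ecoef R j.+2 i * (pisum i l * F l) by rewrite E E2; ring.
by rewrite /opTs natrD natrM -!natr1; ring.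
Qed.

(* Multiplication by f raises the degree by at most r and, modulo lower degree,
   X and Y act on it as derivations with f |-> f0 and f |-> f1. *)
Definition has_symbol r f f0 f1 := forall k F, gdeg k F ->
  [/\ gdeg (k + r) (fun l => f l * F l),
      gdeg (k + r - 2) (fun l => opX (fun l => f l * F l) l - f l * opX F l - f0 l * F l)
    & gdeg (k + r - 2) (fun l => opY (fun l => f l * F l) l - f l * opY F l - f1 l * F l)].

Lemma symbol_eq r f f0 f1 g g0 g1 : f =1 g -> f0 =1 g0 -> f1 =1 g1 ->
  has_symbol r f f0 f1 -> has_symbol r g g0 g1.
Proof. by move=> /funext -> /funext -> /funext ->. Qed.

Lemma symbol_lin r a b f f0 f1 g g0 g1 : has_symbol r f f0 f1 -> has_symbol r g g0 g1 ->
  has_symbol r (fun l => a * f l + b * g l) (fun l => a * f0 l + b * g0 l)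
       (fun l => a * f1 l + b * g1 l).
Proof.
move=> Hf Hg k F HF; have [f_ fX fY] := Hf k F HF; have [g_ gX gY] := Hg k F HF.
have E : (fun l => (a * f l + b * g l) * F l) = fun l => a * (f l * F l) + b * (g l * F l).
  by apply: funext => l; ring.
split.
- by rewrite E; apply: gdeg_lin.
- apply: gdeg_eq (gdeg_lin a b fX gX) => l; rewrite E opX_lin; ring.
- apply: gdeg_eq (gdeg_lin a b fY gY) => l; rewrite E opY_lin; ring.
Qed.

Lemma symbol_0 r : has_symbol r (fun _ => 0) (fun _ => 0) (fun _ => 0).
Proof.
have E F : (fun l => 0 * F l) = fun l => 0 * F l + 0 * F l by apply: funext => l; ring.
move=> k F HF; split; apply: gdeg0 => l; rewrite ?E ?opX_lin ?opY_lin; ring.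
Qed.

Lemma symbol_1 : has_symbol 0 (fun _ => 1) (fun _ => 0) (fun _ => 0).
Proof.
have E F : (fun l => 1 * F l) = F by apply: funext => l; ring.
move=> k F HF; rewrite E; split; rewrite ?addn0 //.
  by apply: gdeg0 => l; ring.
by apply: gdeg0 => l; ring.
Qed.

Lemma symbol_mul r s f f0 f1 g g0 g1 : has_symbol r f f0 f1 -> has_symbol s g g0 g1 ->
  has_symbol (r + s) (fun l => f l * g l) (fun l => f0 l * g l + f l * g0 l)
       (fun l => f1 l * g l + f l * g1 l).
Proof.
move=> Hf Hg k F HF; have [g_ gX gY] := Hg k F HF.
have [f_ fX fY] := Hf _ _ g_.
have E : (fun l => f l * g l * F l) = fun l => f l * (g l * F l).
  by apply: funext => l; ring.
have ft G : gdeg (k + s - 2) G -> gdeg (k + (r + s) - 2) (fun l => f l * G l).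
  (* Here the truncated subtraction gives 0, so the remainder is identically zero rather than of
     small degree. *)
  have [lt|ge] := ltnP (k + s) 2.
    have -> : (k + s - 2 = 0)%N by lia.
    by move=> HG; apply: gdeg0 => l; rewrite HG mulr0.
  move=> HG; have [fG _ _] := Hf _ _ HG; apply: gdeg_mono fG; lia.
have eq : (k + s + r = k + (r + s))%N by lia.
rewrite eq in f_ fX fY.
rewrite E; split => //.
- apply: gdeg_eq (gdeg_D (ft _ gX) fX) => l; ring.
- apply: gdeg_eq (gdeg_D (ft _ gY) fY) => l; ring.
Qed.

Lemma symbol_sum I (s : seq I) r (f f0 f1 : I -> part -> R) :
  (forall i, has_symbol r (f i) (f0 i) (f1 i)) ->
  has_symbol r (fun l => \sum_(i <- s) f i l) (fun l => \sum_(i <- s) f0 i l)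
     (fun l => \sum_(i <- s) f1 i l).
Proof.
move=> H; elim: s => [|x s IH].
  by apply: symbol_eq (symbol_0 r) => l; rewrite big_nil.
by apply: symbol_eq (symbol_lin 1 1 (H x) IH) => l; rewrite big_cons !mul1r.
Qed.

Lemma symbol_prod (I : eqType) (s : seq I) (r : I -> nat) (f f0 f1 : I -> part -> R) :
  uniq s -> (forall i, has_symbol (r i) (f i) (f0 i) (f1 i)) ->
  has_symbol (\sum_(i <- s) r i)%N (fun l => \prod_(i <- s) f i l)
     (fun l => \sum_(i <- s) \prod_(j <- s) (if j == i then f0 j l else f j l))
     (fun l => \sum_(i <- s) \prod_(j <- s) (if j == i then f1 j l else f j l)).
Proof.
move=> us H; elim: s us => [_|x s IH /= /andP[xs us]].
  by rewrite big_nil; apply: symbol_eq symbol_1 => l; rewrite ?big_nil.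
have E (d : I -> part -> R) l : d x l * \prod_(i <- s) f i l +
  f x l * \sum_(i <- s) \prod_(j <- s) (if j == i then d j l else f j l) =
  \sum_(i <- x :: s) \prod_(j <- x :: s) (if j == i then d j l else f j l).
  rewrite [in RHS]big_cons !big_cons eqxx; congr (_ * _ + _).
    apply: eq_big_seq => j js.
    by case: eqP => // E; rewrite -E js in xs.
  rewrite mulr_sumr; apply: eq_big_seq => i is_.
  by rewrite big_cons; case: eqP => // E; rewrite E is_ in xs.
rewrite big_cons; apply: symbol_eq (symbol_mul (H x) (IH us)) => l.
- by rewrite big_cons.
- exact: E.
- exact: E.
Qed.

(* k pi_{k-1} stands for the power sum p_k, to leading order; junk 0 at k = 0. *)
Definition psym k l : R := k%:R * pisum k.-1 l.

Lemma psymE k l : psym k l = k%:R * pisum k.-1 l.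
Proof. by []. Qed.

(** The commutators of pi_j with X and Y are D_j and D_{j+1}. Of these, D_0 is 1 modulo lower
    degree, D_j with j >= 1 is negligible in X, and [opD_lead] gives the leading term j pi_{j-1} of
    D_{j+1}. *)
Lemma symbol_psym j : has_symbol j.+1 (psym j.+1) (fun _ => (j == 0%N)%:R)
  (fun l => j.+1%:R * psym j l).
Proof.
have E F : (fun l => psym j.+1 l * F l) =
    fun l => j.+1%:R * (pisum j l * F l) + 0 * F l.
  by apply: funext => l; rewrite /psym /=; ring.
move=> k F HF; split.
- by rewrite E; apply: gdeg_lin; [exact: pi_stableP|apply: gdeg_mono HF; lia].
- apply: (@gdeg_eq _ _ (fun l => j.+1%:R * opD j F l - (j == 0%N)%:R * F l)).
    by move=> l; rewrite E opX_lin /psym /= /opX opD_pi; ring.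
  case: j E => [|j] _.
    case: k HF => [HF|k HF].
      by apply: gdeg0 => l; rewrite HF /opD big1 ?mulr0 ?subr0 // => i _; rewrite HF mulr0.
    have -> : (k.+1 + 1 - 2 = k)%N by lia.
    apply: gdeg_eq (gdeg_X HF) => l; rewrite /opX /= !mul1r //.
  have -> : (k + j.+2 - 2 = k + j)%N by lia.
  apply: gdeg_eq (gdeg_Z j.+2%:R (gdeg_opD j HF)) => l; rewrite /= mulr0n; ring.
- apply: (@gdeg_eq _ _ (fun l => j.+1%:R * (opD j.+1 F l - psym j l * F l))).
    by move=> l; rewrite E opY_lin /psym /= /opY opD_pi; ring.
  apply: gdeg_Z; case: j E => [|j] _.
    case: k HF => [HF|k HF].
      by apply: gdeg0 => l; rewrite HF /opD big1 ?mulr0 ?subr0 // => i _; rewrite HF mulr0.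
    have -> : (k.+1 + 1 - 2 = k)%N by lia.
    apply: gdeg_eq (gdeg_Y HF) => l; rewrite /psym /opY; ring.
  have -> : (k + j.+2 - 2 = k + j)%N by lia.
  exact: opD_lead.
Qed.

End Symbols.

(** * Jacobi-Trudi determinants *)

Section Schur.
Variable R : realFieldType.
Implicit Types (F G K f g : part -> R) (l : part) (a : R).
Local Notation pisum := (pisum R).
Local Notation psym := (psym R).

Definition hint (h : nat -> R) (a : int) : R := if a is Posz k then h k else 0.

Definition jt_gen (h : nat -> R) L (c : 'I_L -> int) : R :=
  \det (\matrix_(i < L, j < L) hint h (c i + j%:Z)).

Definition jt (h : nat -> R) L (mu : part) : R :=
  jt_gen h (fun i : 'I_L => (rows mu i)%:Z - i%:Z).

(** The last row is (0, ..., 0, 1). Oversized determinants allow a diagram and those below it to be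
    compared in the same format. *)
Lemma jt_stable h L (mu : part) : h 0%N = 1 -> rows mu L = 0%N -> jt h L.+1 mu = jt h L mu.
Proof.
move=> h0 rL; rewrite /jt /jt_gen (expand_det_row _ ord_max) (bigD1 ord_max) //=.
rewrite big1 ?addr0 => [|j jL].
  rewrite !mxE /= rL sub0r addNr /= h0 mul1r /cofactor /= -signr_odd oddD addbb expr0 mul1r.
  congr (\det _); apply/matrixP => i j; rewrite !mxE /=.
  by rewrite /bump !(leqNgt L) !ltn_ord.
rewrite !mxE /= rL sub0r.
have Hj : (j < L)%N by rewrite ltn_neqAle -ltnS ltn_ord andbT.
have -> : - L%:Z + j%:Z = Negz (L - j).-1 by lia.
by rewrite mul0r.
Qed.

Lemma jt_widen h B L (mu : part) : h 0%N = 1 -> (B <= L)%N ->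
  (forall i, (B <= i)%N -> rows mu i = 0%N) -> jt h L mu = jt h B mu.
Proof.
move=> h0 /subnK <- H; elim: (L - B)%N => // d IH.
by rewrite addSn jt_stable // H // leq_addl.
Qed.

Lemma jt_gen_row_eq h L (c : 'I_L -> int) i j : i != j -> c i = c j -> jt_gen h c = 0.
Proof.
move=> ij cij; rewrite /jt_gen; apply: (determinant_alternate ij) => k.
by rewrite !mxE cij.
Qed.

Lemma jt_gen_row0 h L (c : 'I_L -> int) i : (forall j : 'I_L, c i + j%:Z < 0) -> jt_gen h c = 0.
Proof.
move=> H; rewrite /jt_gen (expand_det_row _ i) big1 // => j _.
by rewrite !mxE; have := H j; case: (c i + _) => //= n _; rewrite mul0r.
Qed.

(** If row i is not a corner, lowering its indices either makes it equal to row i + 1 or, in the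
    bottom row, makes all its indices negative. The extra row in the format guarantees that the
    bottom row is empty. *)
Lemma jt_lower h (mu : part) (i : 'I_(psz mu).+1) :
  h 0%N = 1 ->
  jt_gen h (fun k : 'I_(psz mu).+1 => (rows mu k)%:Z - k%:Z - (k == i)%:Z) =
  if removable mu i then jt h (psz (prem mu i)).+1 (prem mu i) else 0.
Proof.
move=> h0; case: ifP => ri.
  rewrite -(@jt_widen h _ (psz mu).+1 (prem mu i)) //.
  - rewrite /jt /jt_gen; congr (\det _); apply/matrixP => k j; rewrite !mxE; congr (hint _ _).
    rewrite rows_prem // -val_eqE /=; case: eqP => [E|_]; last by lia.
    by move: ri; rewrite /removable -E; lia.
  - by have := psz_prem ri; lia.
  - by move=> k Hk; rewrite rows_default //; lia.
have [iL|iL] := ltnP i.+1 (psz mu).+1.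
  apply: (@jt_gen_row_eq _ _ _ i (Ordinal iL)).
    by rewrite -val_eqE /=; lia.
  have ne : (Ordinal iL == i) = false by rewrite -val_eqE /=; lia.
  rewrite eqxx ne /=; have := rows_noninc mu i; move: ri; rewrite /removable; lia.
apply: (@jt_gen_row0 _ _ _ i) => j; rewrite eqxx.
have iE : (i : nat) = psz mu by have := ltn_ord i; lia.
rewrite rows_default ?iE //; have := ltn_ord j; lia.
Qed.

Lemma jt_col_shift h L (c : 'I_L -> int) (q : 'I_L) : (0 < q)%N ->
  \det (\matrix_(i < L, j < L) hint h (c i + j%:Z - (j == q)%:Z)) = 0.
Proof.
move=> q0; have Hq : (q.-1 < L)%N by have := ltn_ord q; lia.
have ne : q != Ordinal Hq by rewrite -val_eqE /=; lia.
rewrite -det_tr; apply: (determinant_alternate ne) => k.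
rewrite !mxE eqxx eq_sym (negbTE ne) /=; congr (hint _ _); lia.
Qed.

(** Reindexing by the column of the lowered entry turns column weights into a combination of terms
    of column-shifted determinants. *)
Lemma perm_shift h L (c : 'I_L -> int) (s : 'S_L) (q : 'I_L -> R) :
  \sum_i \prod_j (if j == i then q (s j) * hint h (c j + (s j)%:Z - 1) else hint h (c j + (s j)%:Z))
  = \sum_i q i * \prod_j hint h (c j + (s j)%:Z - (s j == i)%:Z).
Proof.
rewrite [RHS](reindex_inj (@perm_inj _ s)) /=; apply: eq_bigr => i _.
rewrite (bigD1 i) //= eqxx [in RHS](bigD1 i) //= eqxx -mulrA; congr (_ * (_ * _)).
apply: eq_bigr => j ji; rewrite (negbTE ji) (inj_eq perm_inj) (negbTE ji).
by rewrite subr0.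
Qed.

Section Newton.
Variable h : nat -> part -> R.
Hypothesis h0 : forall l, h 0 l = 1.
Hypothesis hN : forall k l, k.+1%:R * h k.+1 l = \sum_(i < k.+1) psym i.+1 l * h (k - i) l.

(** [hm] and [hm1] are the images of h_k under the derivations d/dp_1 and sum_k (k+1) p_k
    d/dp_{k+1}. *)
Definition hm k l : R := if k is k'.+1 then h k' l else 0.
Definition hm1 k l : R := if k is k'.+1 then k'%:R * h k' l else 0.

Lemma hm_sum k l : \sum_(i < k.+1) psym i.+1 l * hm (k - i) l = k%:R * h k l.
Proof.
rewrite big_ord_recr /= subnn mulr0 addr0.
case: k => [|k]; first by rewrite big_ord0 mul0r.
rewrite hN; apply: eq_bigr => i _; rewrite subSn; last by have := ltn_ord i; lia.
by [].
Qed.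

(** Newton's identity expresses h_{k+1} through p_{i+1} and smaller h; differentiating it termwise
    and using the identity once more, one index lower, gives the two images. *)
Lemma symbol_h k : has_symbol k (h k) (hm k) (hm1 k).
Proof.
elim/ltn_ind: k => -[|k] IH.
  by apply: symbol_eq (@symbol_1 R) => l.
have n0 : k.+1%:R != 0 :> R by rewrite pnatr_eq0.
have H : has_symbol k.+1 (fun l => \sum_(i < k.+1) psym i.+1 l * h (k - i) l)
  (fun l => \sum_(i < k.+1) ((i == 0%N :> nat)%:R * h (k - i) l + psym i.+1 l * hm (k - i) l))
  (fun l => \sum_(i < k.+1) (i.+1%:R * psym i l * h (k - i) l + psym i.+1 l * hm1 (k - i) l)).
  apply: symbol_sum => i.
  have Hi : (k - i < k.+1)%N by lia.
  have := symbol_mul (@symbol_psym R i) (IH _ Hi).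
  by rewrite (_ : (i.+1 + (k - i) = k.+1)%N); last by have := ltn_ord i; lia.
apply: symbol_eq (symbol_lin k.+1%:R^-1 0 H (@symbol_0 R _)) => l; rewrite mulr0 addr0.
- by rewrite -hN mulKf.
- rewrite /= big_split /= hm_sum big_ord_recl /= subn0 mul1r big1 ?addr0.
    by rewrite -{1}[h k l]mul1r -mulrDl addrC natr1 mulKf.
  by move=> i _; rewrite mul0r.
- rewrite /= big_split /= big_ord_recl /= {1}psymE mul0r mulr0 mul0r add0r.
  apply: (mulfI n0); rewrite mulVKf // [X in _ + X]big_ord_recr /= subnn mulr0 addr0 -big_split /=.
  rewrite -hm_sum [in RHS]big_ord_recr /= subnn mulr0 addr0 mulr_sumr.
  apply: eq_bigr => i _; rewrite /bump leq0n add1n.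
  have -> : (k - i = (k - i.+1).+1)%N by have := ltn_ord i; lia.
  have -> : i.+2%:R = k.+1%:R - (k - i.+1)%:R :> R.
    by rewrite natrB ?ltn_ord // -!natr1; ring.
  rewrite /=; ring.
Qed.

Definition schurp (mu : part) l : R := jt (h^~ l) (psz mu).+1 mu.

Lemma symbol_hint (a : int) : 0 <= a -> has_symbol `|a|%N (fun l => hint (h^~ l) a)
  (fun l => hint (h^~ l) (a - 1)) (fun l => (a - 1)%:~R * hint (h^~ l) (a - 1)).
Proof.
have E k : k.+1%:Z - 1 = k%:Z by lia.
case: a => // -[|k] _; apply: symbol_eq (symbol_h _) => l; rewrite ?E //=.
by rewrite mulr0.
Qed.

(** A derivation hits one row of each term of the determinant at a time. For X this lowers the row,
    as in [jt_lower]. For Y the weight of the lowered entry is c_i + s(i) - 1: the row part c_i - 1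
    is the content of the removed box, and the column part s(i) sums to column-shifted determinants,
    which contribute nothing. *)
Lemma symbol_schurp (mu : part) : has_symbol (psz mu) (schurp mu)
  (fun l => \sum_(i < (psz mu).+1 | removable mu i) schurp (prem mu i) l)
  (fun l => \sum_(i < (psz mu).+1 | removable mu i) (content R mu i - 1) * schurp (prem mu i) l).
Proof.
set L := (psz mu).+1; pose c (i : 'I_L) : int := (rows mu i)%:Z - i%:Z.
pose ff (s : 'S_L) l := \prod_i hint (h^~ l) (c i + (s i)%:Z).
pose ff0 (s : 'S_L) l := \sum_i \prod_j (if j == i then hint (h^~ l) (c j + (s j)%:Z - 1)
   else hint (h^~ l) (c j + (s j)%:Z)).
pose ff1 (s : 'S_L) l := \sum_i \prod_j (if j == i then
     (c j + (s j)%:Z - 1)%:~R * hint (h^~ l) (c j + (s j)%:Z - 1)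
   else hint (h^~ l) (c j + (s j)%:Z)).
have Hs (s : 'S_L) : has_symbol (psz mu) (ff s) (ff0 s) (ff1 s).
  have [pos|/forallPn[i0]] := boolP [forall i, 0 <= c i + (s i)%:Z].
    (* The degrees of the factors add up to |mu| because the shifts s(i) - i cancel. *)
    have -> : psz mu = (\sum_i absz (c i + (s i)%:Z)%R)%N.
      apply/eqP; rewrite -eqz_nat (big_morph Posz PoszD (erefl _)); apply/eqP.
      transitivity (\sum_i (c i + (s i)%:Z)); last first.
        by apply: eq_bigr => i _; rewrite gez0_abs //; exact: (forallP pos i).
      rewrite big_split /= sumrB.
      have -> : \sum_(i < L) (s i : nat)%:Z = \sum_(i < L) (i : nat)%:Z.
        by rewrite [RHS](reindex_inj (@perm_inj _ s)).
      by rewrite subrK -(big_morph Posz PoszD (erefl _)) -psz_rows.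
    apply: symbol_prod; first exact: index_enum_uniq.
    by move=> i; apply: symbol_hint; exact: (forallP pos i).
  (* A factor with negative index is zero and stays zero when lowered, so the term and both its
     derivatives vanish. *)
  rewrite -ltNge => neg.
  have z d l : c i0 + (s i0)%:Z - d%:Z < 0 -> hint (h^~ l) (c i0 + (s i0)%:Z - d%:Z) = 0.
    by case: (_ - _).
  have z0 l : hint (h^~ l) (c i0 + (s i0)%:Z) = 0 by move: neg; case: (_ + _).
  have z1 l : hint (h^~ l) (c i0 + (s i0)%:Z - 1) = 0.
    by have := z 1%N l; apply; lia.
  apply: symbol_eq (@symbol_0 R _) => l; rewrite /ff /ff0 /ff1; symmetry.
  - by rewrite (bigD1 i0) //= z0 mul0r.
  - rewrite big1 // => i _; rewrite (bigD1 i0) //= z0 z1; case: ifP; by rewrite mul0r.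
  - rewrite big1 // => i _; rewrite (bigD1 i0) //= z0 z1 mulr0; case: ifP; by rewrite mul0r.
have E0 l : \sum_(i < L | removable mu i) schurp (prem mu i) l =
   \sum_(s : 'S_L) (-1) ^+ s * ff0 s l.
  transitivity (\sum_(i < L) jt_gen (h^~ l) (fun k : 'I_L => c k - (k == i)%:Z)).
    rewrite big_mkcond; apply: eq_bigr => i _.
    by rewrite jt_lower.
  rewrite /jt_gen /determinant exchange_big /=; apply: eq_bigr => s _.
  rewrite /ff0 mulr_sumr; apply: eq_bigr => i _; congr (_ * _).
  apply: eq_bigr => j _; rewrite mxE; case: eqP => _; congr (hint _ _); rewrite /=; lia.
have E1 l : \sum_(i < L | removable mu i) (content R mu i - 1) * schurp (prem mu i) l =
   \sum_(s : 'S_L) (-1) ^+ s * ff1 s l.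
  have -> : \sum_(s : 'S_L) (-1) ^+ s * ff1 s l =
    \sum_(i < L) (content R mu i - 1) * jt_gen (h^~ l) (fun k : 'I_L => c k - (k == i)%:Z) +
    \sum_(i < L) i%:R * \det (\matrix_(k < L, j < L) hint (h^~ l) (c k + j%:Z - (j == i)%:Z)).
    have dist (m : 'I_L -> R) (A : 'I_L -> 'M[R]_L) : \sum_i m i * \det (A i) =
       \sum_(s : 'S_L) (-1) ^+ s * \sum_i m i * \prod_j A i j (s j).
      rewrite /determinant; under eq_bigr => i _ do rewrite mulr_sumr.
      rewrite exchange_big; apply: eq_bigr => s _; rewrite mulr_sumr.
      by apply: eq_bigr => i _; rewrite mulrCA.
    rewrite /jt_gen !dist -big_split /=; apply: eq_bigr => s _; rewrite -mulrDr; congr (_ * _).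
    under [X in _ = _ + X]eq_bigr => i _ do under eq_bigr => j _ do rewrite mxE.
    rewrite -(perm_shift _ _ _ (fun i => i%:R)) -big_split /=; apply: eq_bigr => i _.
    rewrite (bigD1 i) //= eqxx [X in _ = _ * X + _](bigD1 i) //= [X in _ = _ + X](bigD1 i) //= !mxE eqxx.
    have -> : \prod_(j < L | j != i) (if j == i then (c j + (s j)%:Z - 1)%:~R *
        hint (h^~ l) (c j + (s j)%:Z - 1) else hint (h^~ l) (c j + (s j)%:Z)) =
       \prod_(j < L | j != i) hint (h^~ l) (c j + (s j)%:Z).
      by apply: eq_bigr => j /negbTE ->.
    have -> : \prod_(j < L | j != i) (if j == i then (s j)%:R *
        hint (h^~ l) (c j + (s j)%:Z - 1) else hint (h^~ l) (c j + (s j)%:Z)) =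
       \prod_(j < L | j != i) hint (h^~ l) (c j + (s j)%:Z).
      by apply: eq_bigr => j /negbTE ->.
    have -> : \prod_(j < L | j != i) (\matrix_(k, m) hint (h^~ l) (c k - (k == i)%:Z + m%:Z)) j (s j) =
       \prod_(j < L | j != i) hint (h^~ l) (c j + (s j)%:Z).
      by apply: eq_bigr => j /negbTE ji; rewrite mxE ji subr0.
    rewrite addrAC /c /content !(rmorphB, rmorphD) /=; ring.
  (* Column 0 carries weight 0, and any other shifted column repeats its left neighbour. *)
  rewrite [X in _ = _ + X]big1 ?addr0.
    rewrite big_mkcond; apply: eq_bigr => i _.
    by rewrite jt_lower //; case: ifP; rewrite ?mulr0.
  move=> i _; have [i0|i0] := posnP i; first by rewrite i0 mul0r.
  by rewrite jt_col_shift // mulr0.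
apply: (@symbol_eq _ _ (fun l => \sum_(s : 'S_L) (-1) ^+ s * ff s l)
   (fun l => \sum_(s : 'S_L) (-1) ^+ s * ff0 s l) (fun l => \sum_(s : 'S_L) (-1) ^+ s * ff1 s l)).
- move=> l; apply: eq_bigr => s _; congr (_ * _); apply: eq_bigr => i _; by rewrite mxE.
- by move=> l; rewrite E0.
- by move=> l; rewrite E1.
apply: symbol_sum => s; apply: symbol_eq (symbol_lin ((-1) ^+ s) 0 (Hs s) (@symbol_0 R _)) => l; rewrite mul0r addr0 //.
Qed.

End Newton.
End Schur.

(** * Relative dimensions and their symbols *)

Section Eigen.
Variable R : realFieldType.
Implicit Types (F G K f g : part -> R) (l mu : part) (a : R).
Local Notation pisum := (pisum R).
Local Notation psym := (psym R).

(** Each [opU] removes one box, so the iterate counts the chains from [l] down to [mu], that is,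
    standard tableaux of skew shape. *)
Definition dimp mu l : R :=
  if (psz mu <= psz l)%N then iter (psz l - psz mu) (@opU R) (fun l => (l == mu)%:R) l else 0.
(* dim(mu, l) / (|l| - |mu|)! is (dim(l) / n!) n ... (n-m+1) d_mu(l)
   of the relative dimension, an eigenvector of T with eigenvalue m = |mu|. *)
Definition Emu mu l : R := dimp mu l / (psz l - psz mu)`!%:R.

Lemma EmuE mu l : Emu mu l = dimp mu l / (psz l - psz mu)`!%:R.
Proof. by []. Qed.

Lemma dimp_below mu l : (psz l < psz mu)%N -> dimp mu l = 0.
Proof. by rewrite /dimp ltnNge => /negbTE ->. Qed.

Lemma dimp_level mu l : psz l = psz mu -> dimp mu l = (l == mu)%:R.
Proof. by move=> E; rewrite /dimp E leqnn subnn. Qed.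

Lemma dimp_rec mu l : (psz mu < psz l)%N -> dimp mu l = opU (dimp mu) l.
Proof.
move=> H; rewrite {1}/dimp ltnW //.
have -> : (psz l - psz mu = (psz l - psz mu).-1.+1)%N by lia.
rewrite iterS; apply: eq_bigr => i ri; have E := psz_prem ri.
rewrite /dimp ifT; last by lia.
by congr (iter _ _ _ _); lia.
Qed.

Lemma Emu_below mu l : (psz l < psz mu)%N -> Emu mu l = 0.
Proof. by move=> H; rewrite /Emu dimp_below // mul0r. Qed.

Lemma Emu_level mu l : psz l = psz mu -> Emu mu l = (l == mu)%:R.
Proof. by move=> H; rewrite /Emu dimp_level // H subnn fact0 divr1. Qed.

Lemma fact_neq0 n : n`!%:R != 0 :> R.
Proof. by rewrite pnatr_eq0 -lt0n fact_gt0. Qed.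

Lemma opT_Emu mu l : opT (Emu mu) l = (psz mu)%:R * Emu mu l.
Proof.
rewrite /opT; have [lt|gt|E] := ltngtP (psz l) (psz mu).
- rewrite Emu_below // (@opU_below _ (psz mu)) ?mulr0 ?subr0 //; last exact: ltnW.
  by move=> m; apply: Emu_below.
- have -> : opU (Emu mu) l = (psz l - psz mu)%:R * Emu mu l.
    rewrite {2}/Emu dimp_rec // /opU mulr_suml mulr_sumr; apply: eq_bigr => i ri.
    have E := psz_prem ri.
    have -> : (psz l - psz mu = (psz (prem l i) - psz mu).+1)%N by lia.
    rewrite /Emu; move: (psz (prem l i) - psz mu)%N => d; rewrite factS natrM.
    have n1 := fact_neq0 d; have n2 : d.+1%:R != 0 :> R by rewrite pnatr_eq0.
    by move: (d`!%:R) (d.+1%:R) n1 n2 => a b a0 b0; field; rewrite a0 b0.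
  by rewrite natrB ?(ltnW gt) //; ring.
- by rewrite (@opU_below _ (psz mu)) ?E ?subr0 // => m; apply: Emu_below.
Qed.

Lemma eigen_unique (a : R) F : (forall l, opT F l = a * F l) ->
  (forall l, (psz l)%:R = a -> F l = 0) -> forall l, F l = 0.
Proof. by move=> H H0 l; apply: (level_zero (a := a) (B := (psz l).+1)) => // m _ /H0. Qed.

Lemma opT_sum I (s : seq I) (P : pred I) (c : I -> R) (F : I -> part -> R) l :
  opT (fun l => \sum_(i <- s | P i) c i * F i l) l = \sum_(i <- s | P i) c i * opT (F i) l.
Proof.
elim: s => [|x s IH].
  rewrite big_nil -[RHS](mul0r (opT (fun _ => 0) l)).
  have -> : (fun l => \sum_(i <- [::] | P i) c i * F i l) = fun l => 0 * 0 + 0 * 0.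
    by apply: funext => m; rewrite big_nil; ring.
  by rewrite (opT_lin 0 0 (fun _ => 0) (fun _ => 0)); ring.
rewrite big_cons; case Px : (P x).
  have -> : (fun l => \sum_(i <- x :: s | P i) c i * F i l) =
      fun l => c x * F x l + 1 * \sum_(i <- s | P i) c i * F i l.
    by apply: funext => m; rewrite big_cons Px mul1r.
  by rewrite opT_lin IH mul1r.
by rewrite -IH; congr (opT _ l); apply: funext => m; rewrite big_cons Px.
Qed.

Lemma opD_Emu_level j mu nu : (psz nu).+1 = psz mu ->
  opD j (Emu mu) nu = \sum_(i < (psz mu).+1 | removable mu i) (content R mu i - 1) ^+ j * Emu (prem mu i) nu.
Proof.
move=> E; rewrite /opD (@widen_add _ (psz mu).+1 _ (fun i => content R nu i ^+ j * Emu mu (padd nu i))); last by lia.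
rewrite [LHS]big_mkcond [RHS]big_mkcond; apply: eq_bigr => i _.
have H := edge_eq nu mu i.
case ai: (addable nu i) H => /=; case ri : (removable mu i) => //= H.
- rewrite !Emu_level ?psz_padd //; last by have := psz_prem ri; lia.
  rewrite H eq_sym; case: eqP => [->|_]; last by rewrite !mulr0.
  by rewrite content_prem.
- by rewrite Emu_level ?psz_padd // H mulr0.
- by rewrite Emu_level ?[nu == _]eq_sym -?H ?mulr0 //; have := psz_prem ri; lia.
Qed.

(** Both sides are T-eigenfunctions with eigenvalue |mu| - 1, so they need comparing on that level
    only, where [edge_eq] lists the same edges from either end. The factor (j == 0) treats X and Y
    uniformly. *)
Lemma opD_Emu mu (j : nat) : (j < 2)%N ->
  (forall l, opTs ((psz mu)%:R - 1) (fun l => opD j (Emu mu) l - (j == 0%N)%:R * Emu mu l) l = 0) ->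
  forall l, opD j (Emu mu) l - (j == 0%N)%:R * Emu mu l =
     \sum_(i < (psz mu).+1 | removable mu i) (content R mu i - 1) ^+ j * Emu (prem mu i) l.
Proof.
move=> j2 HT l; apply/eqP; rewrite -subr_eq0; apply/eqP; move: l.
apply: (eigen_unique (a := (psz mu)%:R - 1)).
- move=> l.
  have -> : (fun l => opD j (Emu mu) l - (j == 0%N)%:R * Emu mu l -
      \sum_(i < (psz mu).+1 | removable mu i) (content R mu i - 1) ^+ j * Emu (prem mu i) l) =
    fun l => 1 * (opD j (Emu mu) l - (j == 0%N)%:R * Emu mu l) + (-1) *
      \sum_(i < (psz mu).+1 | removable mu i) (content R mu i - 1) ^+ j * Emu (prem mu i) l.
    by apply: funext => m; ring.
  have /eqP := HT l; rewrite opT_lin /opTs subr_eq0 => /eqP ->.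
  rewrite opT_sum.
  have -> : \sum_(i < (psz mu).+1 | removable mu i) (content R mu i - 1) ^+ j * opT (Emu (prem mu i)) l =
    ((psz mu)%:R - 1) * \sum_(i < (psz mu).+1 | removable mu i) (content R mu i - 1) ^+ j * Emu (prem mu i) l.
    rewrite mulr_sumr; apply: eq_bigr => i ri; rewrite opT_Emu.
    by have := congr1 (fun n => n%:R : R) (psz_prem ri); rewrite -natr1 => ->; ring.
  ring.
- move=> l E; have Hl : (psz l).+1 = psz mu.
    by apply/eqP; rewrite -(eqr_nat R) -natr1 E subrK.
  by rewrite opD_Emu_level // Emu_below ?mulr0 ?subr0 ?subrr //; lia.
Qed.

Lemma opX_Emu mu l : opX (Emu mu) l =
  \sum_(i < (psz mu).+1 | removable mu i) Emu (prem mu i) l.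
Proof.
have := @opD_Emu mu 0 isT; rewrite /= => H.
have E : (fun l => opD 0 (Emu mu) l - 1 * Emu mu l) = opX (Emu mu).
  by apply: funext => m; rewrite mul1r.
rewrite -[LHS]/(_ - _) -[X in _ - X = _]mul1r H; last first.
  move=> m; rewrite E -opX_opTs /opX /opD big1 ?sub0r; first by rewrite /opTs opT_Emu subrr oppr0.
  by move=> i _; rewrite /opTs opT_Emu subrr mulr0.
by apply: eq_bigr => i _; rewrite expr0 mul1r.
Qed.

Lemma opY_Emu mu l : opY (Emu mu) l =
  \sum_(i < (psz mu).+1 | removable mu i) (content R mu i - 1) * Emu (prem mu i) l.
Proof.
have := @opD_Emu mu 1 isT; rewrite /= => H.
have E : (fun l => opD 1 (Emu mu) l - 0 * Emu mu l) = opY (Emu mu).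
  by apply: funext => m; rewrite mul0r subr0.
rewrite /opY -[LHS]subr0 -[X in _ - X = _](mul0r (Emu mu l)) H; last first.
  move=> m; rewrite E -opY_opTs /opY /opD big1 //.
  by move=> i _; rewrite /opTs opT_Emu subrr mulr0.
by apply: eq_bigr => i _; rewrite expr1.
Qed.

Local Notation w := (Emu part0).

Lemma removable0 i : removable part0 i = false.
Proof. by rewrite /removable !rows_default. Qed.

(** [w] equals dim(l)/n! and plays the part of the constant 1: it has T-degree 0, and both X and Y
    annihilate it. *)
Lemma opX_w l : opX w l = 0.
Proof. by rewrite opX_Emu big1 // => i; rewrite removable0. Qed.

Lemma opY_w l : opY w l = 0.
Proof. by rewrite opY_Emu big1 // => i; rewrite removable0. Qed.

Lemma gdeg_w : gdeg 1 w.
Proof. by move=> l; rewrite /opTs opT_Emu mul0r subrr. Qed.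

Section Main.
Variable h : nat -> part -> R.
Hypothesis h0 : forall l, h 0 l = 1.
Hypothesis hN : forall k l, k.+1%:R * h k.+1 l = \sum_(i < k.+1) psym i.+1 l * h (k - i) l.

Lemma schur_symbol mu : gdeg (psz mu) (fun l => schurp h mu l * w l - Emu mu l).
Proof.
move: {2}(psz mu) (erefl (psz mu)) => m; elim: m mu => [|m IH] mu Hm.
  rewrite Hm => l; rewrite (psz0_part0 Hm) /schurp (@jt_widen _ _ 0) //.
    by rewrite /jt /jt_gen det_mx00 mul1r subrr.
  by move=> i _; rewrite rows_default.
have E : (fun l => schurp h mu l * w l - Emu mu l) =
    fun l => 1 * (schurp h mu l * w l) + (-1) * Emu mu l.
  by apply: funext => l; ring.
have [_ HX HY] := symbol_schurp h0 hN mu gdeg_w.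
have e : (1 + psz mu - 2 = m)%N by lia.
rewrite e in HX HY; rewrite E Hm; apply: gdeg_XY.
- have H : gdeg m (fun l => \sum_(i < (psz mu).+1 | removable mu i)
      (schurp h (prem mu i) l * w l - Emu (prem mu i) l)).
    apply: gdeg_sum => i ri; have E2 := psz_prem ri.
    by have e2 : psz (prem mu i) = m; [lia|have := IH _ e2; rewrite e2].
  apply: gdeg_eq (gdeg_D HX H) => l.
  rewrite opX_lin opX_w opX_Emu mulr0 subr0 sumrB -mulr_suml; ring.
- have H : gdeg m (fun l => \sum_(i < (psz mu).+1 | removable mu i)
      (content R mu i - 1) * (schurp h (prem mu i) l * w l - Emu (prem mu i) l)).
    apply: gdeg_sum => i ri; have E2 := psz_prem ri.
    by have e2 : psz (prem mu i) = m; [lia|apply: gdeg_Z; have := IH _ e2; rewrite e2].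
  apply: gdeg_eq (gdeg_D HY H) => l.
  rewrite opY_lin opY_w opY_Emu mulr0 subr0.
  under [X in _ + X = _]eq_bigr => i _ do rewrite mulrBr mulrA.
  rewrite sumrB -mulr_suml; ring.
Qed.

End Main.

Lemma gdeg_expand k F : gdeg k F -> exists s : seq (part * R),
  all (fun x => psz x.1 < k)%N s /\ forall l, F l = \sum_(x <- s) x.2 * Emu x.1 l.
Proof.
elim: k F => [|k IH] F HF.
  by exists [::]; split=> // l; rewrite big_nil HF.
have [s [/allP Hs Es]] := IH _ HF.
(* T - k acts on E_nu as the nonzero scalar |nu| - k, so F0 is a preimage of (T - k)F. The
   difference F - F0 is then an eigenfunction, recovered from its values on level k. *)
pose F0 l := \sum_(x <- s) x.2 / ((psz x.1)%:R - k%:R) * Emu x.1 l.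
pose G l := 1 * F l + (-1) * F0 l.
have TG l : opT G l = k%:R * G l.
  apply/eqP; rewrite -subr_eq0; apply/eqP.
  have -> : opT G l - k%:R * G l = opTs k%:R F l - (opT F0 l - k%:R * F0 l).
    by rewrite opT_lin /opTs /G; ring.
  rewrite opT_sum /F0 mulr_sumr -sumrB Es -sumrB big_seq big1 // => x xs.
  have n0 : (psz x.1)%:R - k%:R != 0 :> R.
    by rewrite subr_eq0 eqr_nat neq_ltn (Hs _ xs).
  by rewrite opT_Emu; field.
exists ([seq (mu, G mu) | mu <- Yp k] ++ [seq (x.1, x.2 / ((psz x.1)%:R - k%:R)) | x <- s]).
split.
  rewrite all_cat; apply/andP; split; apply/allP => y /mapP[x xs ->] /=.
    by move: xs; rewrite mem_Yp => /eqP ->.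
  by have := Hs _ xs; rewrite /= ltnS => /ltnW.
move=> l; rewrite big_cat !big_map /= -/(F0 l).
apply/eqP; rewrite -subr_eq0; apply/eqP.
have -> : F l - (\sum_(i <- Yp k) G i * Emu i l + F0 l) =
    1 * G l + (-1) * \sum_(i <- Yp k) G i * Emu i l by rewrite /G; ring.
move: l; apply: (eigen_unique (a := k%:R)).
  move=> l; rewrite opT_lin opT_sum TG.
  have -> : \sum_(i <- Yp k) G i * opT (Emu i) l = k%:R * \sum_(i <- Yp k) G i * Emu i l.
    rewrite mulr_sumr; apply: eq_big_seq => mu.
    by rewrite mem_Yp opT_Emu => /eqP ->; ring.
  ring.
move=> l /eqP; rewrite eqr_nat => /eqP Hl.
rewrite (bigD1_seq l) ?mem_Yp ?Hl ?Yp_uniq //= Emu_level // eqxx big_seq_cond big1 ?addr0.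
  rewrite /=; ring.
move=> mu /andP[]; rewrite mem_Yp => /eqP Hmu ne.
by rewrite Emu_level ?Hl // eq_sym (negbTE ne) mulr0.
Qed.

(** * Bounds for relative dimensions and moments of the removed content *)

Local Notation dimT := (dimp part0).

Lemma dimT0 : dimT part0 = 1.
Proof. by rewrite dimp_level // eqxx. Qed.

Lemma dimT_rec l : (0 < psz l)%N -> dimT l = opU dimT l.
Proof. exact: (@dimp_rec part0). Qed.

Lemma dimp_ge0 mu l : 0 <= dimp mu l.
Proof.
move: {2}(psz l) (erefl (psz l)) => n; elim: n l => [|n IH] l Hl.
  have [H|H] := posnP (psz mu); first by rewrite dimp_level ?H // ler0n.
  by rewrite dimp_below // Hl.
have [lt|gt|E] := ltngtP (psz l) (psz mu).
- by rewrite dimp_below.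
- rewrite dimp_rec //; apply: sumr_ge0 => i ri; apply: IH; have := psz_prem ri; lia.
- by rewrite dimp_level // ler0n.
Qed.

Lemma dimT_ge1 l : 1 <= dimT l.
Proof.
move: {2}(psz l) (erefl (psz l)) => n; elim: n l => [|n IH] l Hl.
  by rewrite (psz0_part0 Hl) dimT0.
rewrite dimT_rec ?Hl //; have [|r [rr _]] := @exists_removable l; first by rewrite Hl.
have Hr : (r < (psz l).+1)%N by have := removable_bound rr; lia.
rewrite /opU (bigD1 (Ordinal Hr)) //= -[1]addr0; apply: lerD.
  by apply: IH; have := psz_prem rr; lia.
by apply: sumr_ge0 => i _; exact: dimp_ge0.
Qed.

Lemma dimT_gt0 l : 0 < dimT l.
Proof. exact: lt_le_trans ltr01 (dimT_ge1 l). Qed.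

Lemma dimp_le mu l : dimp mu l <= dimT l.
Proof.
move: {2}(psz l) (erefl (psz l)) => n; elim: n l => [|n IH] l Hl.
  have [H|H] := posnP (psz mu); last by rewrite dimp_below ?Hl // ltW ?dimT_gt0.
  by rewrite dimp_level ?H //; apply: le_trans (dimT_ge1 l); case: (_ == _).
have [lt|gt|E] := ltngtP (psz l) (psz mu).
- by rewrite dimp_below // ltW ?dimT_gt0.
- rewrite dimp_rec // dimT_rec ?Hl //; apply: ler_sum => i ri; apply: IH.
  by have := psz_prem ri; lia.
- by rewrite dimp_level //; apply: le_trans (dimT_ge1 l); case: (_ == _).
Qed.

Definition drel mu l : R := dimp mu l / dimT l.

Lemma drel_ge0 mu l : 0 <= drel mu l.
Proof. by rewrite divr_ge0 ?dimp_ge0. Qed.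
Lemma drel_le1 mu l : drel mu l <= 1.
Proof. by rewrite ler_pdivrMr ?dimT_gt0 // mul1r dimp_le. Qed.

Lemma w_gt0 l : 0 < w l.
Proof. by rewrite /Emu divr_gt0 ?dimT_gt0 // ltr0n fact_gt0. Qed.

Lemma Emu_drel mu l : Emu mu l = (psz l ^_ psz mu)%:R * drel mu l * w l.
Proof.
have [lt|le] := ltnP (psz l) (psz mu).
  by rewrite Emu_below // ffact_small // !mul0r.
have n1 := fact_neq0 (psz l - psz mu); have n2 := fact_neq0 (psz l).
have n3 : dimT l != 0 by rewrite gt_eqF ?dimT_gt0.
have -> : (psz l ^_ psz mu)%:R = (psz l)`!%:R / (psz l - psz mu)`!%:R :> R.
  by rewrite -(ffact_fact le) natrM mulfK.
rewrite /drel /Emu subn0.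
move: (_`!%:R) (_`!%:R) (dimT l) n1 n2 n3 => a b c a0 b0 c0; field.
by rewrite a0 b0 c0.
Qed.

Lemma gdeg_expand_drel k F : gdeg k (fun l => F l * w l) -> exists s : seq (part * R),
  all (fun x => psz x.1 < k)%N s /\
  forall l, F l = \sum_(x <- s) x.2 * ((psz l ^_ psz x.1)%:R * drel x.1 l).
Proof.
move=> /gdeg_expand[s [Hs Es]]; exists s; split=> // l.
have n0 : w l != 0 by rewrite gt_eqF ?w_gt0.
apply: (mulIf n0); rewrite Es mulr_suml; apply: eq_bigr => x _.
by rewrite Emu_drel; ring.
Qed.

Lemma drel_schur h mu : (forall l, h 0%N l = 1) ->
  (forall k l, k.+1%:R * h k.+1 l = \sum_(i < k.+1) psym i.+1 l * h (k - i)%N l) ->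
  exists s : seq (part * R), all (fun x => psz x.1 < psz mu)%N s /\
  forall l, (psz l ^_ psz mu)%:R * drel mu l = schurp h mu l +
     \sum_(x <- s) x.2 * ((psz l ^_ psz x.1)%:R * drel x.1 l).
Proof.
move=> h0 hN; have [|s [Hs Es]] := @gdeg_expand_drel (psz mu)
  (fun l => (psz l ^_ psz mu)%:R * drel mu l - schurp h mu l).
  apply: gdeg_eq (gdeg_Z (-1) (schur_symbol h0 hN mu)) => l; rewrite [Emu mu l]Emu_drel; ring.
by exists s; split=> // l; rewrite -Es addrC subrK.
Qed.

(** Consider (T - (k+1))(pi_k w). Its degree is at most k. On the other hand n w = Uw and pi_k drops
    by content^k when a box is removed, so T(pi_k w) is, up to the factor w, n times the mean of
    content^k over a random removal. *)
Lemma down_moment k : exists s : seq (part * R), all (fun x => psz x.1 < k.+1)%N s /\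
  forall l, (psz l)%:R * \sum_(i < (psz l).+1 | removable l i)
       dimT (prem l i) / dimT l * (content R l i - 1) ^+ k =
     k.+1%:R * pisum k l + \sum_(x <- s) x.2 * ((psz l ^_ psz x.1)%:R * drel x.1 l).
Proof.
have HG : gdeg k.+2 (fun l => pisum k l * w l) := pi_stableP k gdeg_w.
have [|s [Hs Es]] := @gdeg_expand_drel k.+1
  (fun l => (psz l)%:R * \sum_(i < (psz l).+1 | removable l i)
       dimT (prem l i) / dimT l * (content R l i - 1) ^+ k - k.+1%:R * pisum k l); last first.
  by exists s; split=> // l; rewrite -Es addrC subrK.
apply: (@gdeg_eq _ k.+1 (opTs k.+1%:R (fun l => pisum k l * w l))); last exact: HG.
move=> l; rewrite /opTs /opT mulrBl; congr (_ - _); last by rewrite mulrA.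
have Tw : (psz l)%:R * w l = opU w l.
  by have := gdeg_w l; rewrite /opTs mul0r subr0 /opT => /eqP; rewrite subr_eq0 => /eqP.
rewrite mulrCA Tw /opU mulr_sumr -sumrB [in RHS]mulr_sumr [in RHS]mulr_suml; apply: eq_bigr => i ri.
have [ai lE] := padd_prem ri.
have -> : pisum k l = pisum k (prem l i) + (content R l i - 1) ^+ k.
  by rewrite -{1}lE pisum_padd // content_prem.
rewrite -mulrBl [pisum _ _ + _]addrC addrK.
have n3 : dimT l != 0 by rewrite gt_eqF ?dimT_gt0.
have n2 : (psz (prem l i)).+1%:R != 0 :> R by rewrite pnatr_eq0.
rewrite /Emu !subn0.
have -> : (psz l)%:R = (psz (prem l i)).+1%:R :> R by rewrite -(psz_prem ri).
have -> : (psz l)`!%:R = (psz (prem l i)).+1%:R * (psz (prem l i))`!%:R :> R.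
  by rewrite -natrM -factS -(psz_prem ri).
move: (_`!%:R) (_.+1%:R) (dimT l) (fact_neq0 (psz (prem l i))) n2 n3 => a b c a0 b0 c0.
by field; rewrite a0 b0 c0.
Qed.

End Eigen.

(** * Complete homogeneous functions as sums over partitions *)

Definition ins (j : nat) (s : seq nat) := sort geq (j :: s).

Lemma perm_ins j s : perm_eq (ins j s) (j :: s).
Proof. by rewrite perm_sort. Qed.

Lemma geq_total : total geq. Proof. by move=> x y; rewrite /geq leq_total. Qed.
Lemma geq_trans : transitive geq. Proof. by move=> x y z; rewrite /geq; lia. Qed.
Lemma geq_anti : antisymmetric geq. Proof. by move=> x y; rewrite /geq; lia. Qed.

Lemma sumn_ins j s : sumn (ins j s) = (j + sumn s)%N.
Proof. by rewrite (perm_sumn (perm_ins j s)). Qed.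

Lemma is_part_ins j s : (0 < j)%N -> is_part s -> is_part (ins j s).
Proof.
move=> j0 /andP[_ al]; rewrite /is_part sort_sorted ?geq_total //=.
by rewrite (perm_all _ (perm_ins j s)) /= j0.
Qed.

Lemma is_part_rem j s : is_part s -> is_part (rem j s).
Proof.
case/andP=> so al; apply/andP; split.
  exact: (subseq_sorted geq_trans (rem_subseq j s) so).
by apply/allP => x /mem_rem /(allP al).
Qed.

Lemma is_part_perm s t : is_part s -> is_part t -> perm_eq s t -> s = t.
Proof. by move=> /andP[s_ _] /andP[t_ _]; apply: (sorted_eq geq_trans geq_anti). Qed.

Lemma Yn_ins k i : (i <= k)%N ->
  perm_eq [seq s <- Yn k.+1 | i.+1 \in s] (map (ins i.+1) (Yn (k - i))).
Proof.
move=> ik; apply: uniq_perm.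
- exact/filter_uniq/undup_uniq.
- rewrite map_inj_in_uniq ?undup_uniq // => s t; rewrite !mem_Yn => /andP[Hs _] /andP[Ht _] E.
  apply: is_part_perm => //; rewrite -(perm_cons i.+1).
  by rewrite -(permPl (perm_ins i.+1 s)) E perm_ins.
move=> s; rewrite mem_filter mem_Yn; apply/idP/mapP.
  case/and3P=> is_ Hs /eqP Hn; exists (rem i.+1 s).
    rewrite mem_Yn is_part_rem //=; have := perm_sumn (perm_to_rem is_).
    by rewrite Hn /=; lia.
  apply: is_part_perm => //; first by apply: is_part_ins => //; apply: is_part_rem.
  by rewrite perm_sym (permPl (perm_ins _ _)) perm_sym perm_to_rem.
move=> [t]; rewrite mem_Yn => /andP[Ht /eqP Hn] ->.
rewrite (perm_mem (perm_ins _ _)) mem_head is_part_ins //= sumn_ins Hn; lia.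
Qed.

Lemma zrho_widen B s : (sumn s <= B)%N ->
  zrho s = (\prod_(1 <= i < B.+1) (i ^ count_mem i s * (count_mem i s)`!))%N.
Proof.
move=> H; rewrite /zrho [RHS](@big_cat_nat _ _ _ (sumn s).+1) //=.
rewrite [X in (_ * X)%N]big_nat_cond [X in (_ * X)%N]big1 ?muln1 // => i /andP[/andP[Hi _] _].
have -> : count_mem i s = 0%N; last by rewrite expn0 fact0.
apply/count_memPn; apply: contraL Hi => /perm_to_rem /perm_sumn /= ->.
by rewrite -leqNgt leq_addr.
Qed.

Lemma zrho_ins j s : (0 < j)%N ->
  zrho (ins j s) = (j * (count_mem j s).+1 * zrho s)%N.
Proof.
move=> j0; rewrite /zrho sumn_ins -/(zrho s) (@zrho_widen (j + sumn s) s) ?leq_addl //.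
have js : j \in index_iota 1 (j + sumn s).+1 by rewrite mem_index_iota; lia.
rewrite (bigD1_seq j) ?iota_uniq //= [in RHS](bigD1_seq j) ?iota_uniq //=.
have cE i : count_mem i (ins j s) = ((j == i) + count_mem i s)%N.
  by rewrite (seq.permP (perm_ins j s)).
rewrite cE eqxx add1n expnS factS.
rewrite [X in (_ * X)%N = _](eq_bigr (fun i => i ^ count_mem i s * (count_mem i s)`!)%N); last first.
  by move=> i ne; rewrite cE eq_sym (negbTE ne).
move: (\prod_(_ <- _ | _) _)%N (j ^ _)%N ((count_mem j s)`!) => a b c; ring.
Qed.

Lemma zrho_gt0 s : is_part s -> (0 < zrho s)%N.
Proof.
move=> Hs; rewrite /zrho big_nat_cond prodn_cond_gt0 // => i /andP[/andP[i0 _] _].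
by rewrite muln_gt0 expn_gt0 i0 fact_gt0.
Qed.

Lemma sumn_count s B : is_part s -> (sumn s <= B)%N ->
  sumn s = (\sum_(i < B) i.+1 * count_mem i.+1 s)%N.
Proof.
elim: s => [|x s IH] Hs HB; first by rewrite big1 // => i _; rewrite muln0.
have [x0 Hs'] := is_part_cons Hs; rewrite /= in HB *.
under eq_bigr => i _ do rewrite mulnDr.
rewrite big_split /= -IH //; last by lia.
have Hx : (x.-1 < B)%N by lia.
congr (_ + _)%N; rewrite (bigD1 (Ordinal Hx)) //= prednK // eqxx muln1 big1 ?addn0 // => i ne.
by case: eqP => [E|]; rewrite ?muln0 //; case/negP: ne; rewrite -val_eqE /= E.
Qed.

Section HSum.
Variable R : realFieldType.

Definition hsum (p : nat -> R) (k : nat) : R :=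
  \sum_(rho <- Yn k) (zrho rho)%:R^-1 * \prod_(r <- rho) p r.

Lemma hsum0 p : hsum p 0 = 1.
Proof.
rewrite /hsum.
have -> : \sum_(rho <- Yn 0) ((zrho rho)%:R^-1 * \prod_(r <- rho) p r) =
          \sum_(rho <- [:: [::]]) ((zrho rho)%:R^-1 * \prod_(r <- rho) p r).
  apply: perm_big; apply: uniq_perm; rewrite ?undup_uniq // => s.
  rewrite mem_Yn inE; apply/andP/eqP => [[Hs /eqP H0]|-> //].
  by apply/size0nil/eqP; rewrite -leqn0 -H0 size_part_sumn.
by rewrite big_seq1 /zrho big_geq // big_nil invr1 mulr1.
Qed.

(** Write k + 1 as the sum of i m_i over the part sizes i of rho, m_i being the multiplicity of i.
    Deleting one part i turns i m_i / z_rho into 1 / z of the smaller partition. *)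
Lemma hsum_newton p k :
  k.+1%:R * hsum p k.+1 = \sum_(i < k.+1) p i.+1 * hsum p (k - i).
Proof.
rewrite /hsum mulr_sumr.
have -> : \sum_(rho <- Yn k.+1) k.+1%:R * ((zrho rho)%:R^-1 * \prod_(r <- rho) p r) =
  \sum_(rho <- Yn k.+1) \sum_(i < k.+1) (i.+1 * count_mem i.+1 rho)%:R *
     ((zrho rho)%:R^-1 * \prod_(r <- rho) p r).
  apply: eq_big_seq => rho; rewrite mem_Yn => /andP[Hs /eqP Hn].
  by rewrite -mulr_suml -natr_sum -sumn_count ?Hn.
rewrite exchange_big /=; apply: eq_bigr => i _.
rewrite (bigID (fun s => i.+1 \in s)) /= [X in _ + X]big1 ?addr0; last first.
  by move=> s /count_memPn ->; rewrite muln0 mul0r.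
have ik : (i <= k)%N by rewrite -ltnS.
rewrite -big_filter (perm_big _ (Yn_ins ik)) big_map mulr_sumr.
apply: eq_big_seq => s; rewrite mem_Yn => /andP[Hs _].
rewrite (perm_big _ (perm_ins _ _)) big_cons zrho_ins // (seq.permP (perm_ins i.+1 s)) /= eqxx add1n.
have z0 : (zrho s)%:R != 0 :> R by rewrite pnatr_eq0 -lt0n zrho_gt0.
have c0 : (i.+1 * (count_mem i.+1 s).+1)%:R != 0 :> R by rewrite pnatr_eq0.
rewrite [(_ * zrho s)%:R]natrM; move: (zrho s)%:R (_ * _)%:R c0 z0 => b a a0 b0; field; by rewrite a0 b0.
Qed.

Lemma eq_hsum p q k : (forall r, (0 < r <= k)%N -> p r = q r) -> hsum p k = hsum q k.
Proof.
move=> H; apply: eq_big_seq => s; rewrite mem_Yn => /andP[/andP[_ al] /eqP Hn].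
congr (_ * _); apply: eq_big_seq => r rs; apply: H; rewrite (allP al) //=.
by have := perm_sumn (perm_to_rem rs); rewrite Hn /= => ->; rewrite leq_addr.
Qed.

Lemma hsum_scale t p k : hsum (fun r => t ^+ r * p r) k = t ^+ k * hsum p k.
Proof.
rewrite /hsum mulr_sumr; apply: eq_big_seq => s; rewrite mem_Yn => /andP[_ /eqP <-].
rewrite big_split /= mulrCA; congr (_ * (_ * _)).
by elim: s => [|x s IH]; rewrite ?big_nil // big_cons IH /= exprD.
Qed.

Lemma jt_scale (t : R) (h : nat -> R) L (mu : part) : t != 0 -> (forall i, (L <= i)%N -> rows mu i = 0%N) ->
  jt (fun k => t ^+ k * h k) L mu = t ^+ psz mu * jt h L mu.
Proof.
move=> t0 HL; rewrite /jt /jt_gen /determinant mulr_sumr; apply: eq_bigr => s _.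
rewrite mulrCA; congr (_ * _).
have hE a : hint (fun k => t ^+ k * h k) a = t ^ a * hint h a.
  by case: a => n //=; rewrite mulr0.
under eq_bigr => i _ do rewrite mxE hE.
rewrite big_split /=; congr (_ * _); last by apply: eq_bigr => i _; rewrite mxE.
have H (I : seq 'I_L) (a : 'I_L -> int) : \prod_(i <- I) t ^ a i = t ^ (\sum_(i <- I) a i).
  by elim: I => [|x I IH]; rewrite ?big_nil // !big_cons IH expfzDr.
rewrite H exprnP; congr (t ^ _).
rewrite big_split /= sumrB.
have -> : \sum_(i < L) (s i : nat)%:Z = \sum_(i < L) (i : nat)%:Z.
  by rewrite [RHS](reindex_inj (@perm_inj _ s)).
by rewrite subrK -(big_morph Posz PoszD (erefl _)) -psz_bound.
Qed.

End HSum.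

Section Scirc.
Variable R : realType.
Variable N : nat.

Definition pval (v : 'I_N -> R) (r : nat) : R :=
  match r with 0 => 1 | 1 => 1 | r'.+2 => oapp v 0 (insub r') end.

Lemma meval_pcirc v r : mpoly.meval v (pcirc R N r) = pval v r.
Proof.
case: r => [|[|r]] /=; rewrite ?mpoly.meval1 ?rmorph1 //.
rewrite /qvar; case: insub => [i|] /=; last by rewrite mpoly.meval0.
by rewrite mpoly.mevalXU.
Qed.

Lemma meval_hcirc v k : mpoly.meval v (hcirc R N k) = hsum (pval v) k.
Proof.
rewrite /hcirc rmorph_sum /=; apply: eq_bigr => s _.
rewrite mpoly.mevalZ; congr (_ * _).
rewrite (rmorph_prod (mpoly.meval v)). by apply: eq_bigr => r _; apply: meval_pcirc.
Qed.

Lemma size_part_rows (mu : part) i : (size (val mu) <= i)%N -> rows mu i = 0%N.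
Proof. exact: nth_default. Qed.

(** Every row other than i contains a box. This keeps the indices in the Jacobi-Trudi determinant at
    most |mu|, so that the power sums involved lie among the N variables. *)
Lemma hook_bound (mu : part) i j : (i < size (val mu))%N -> (j < size (val mu))%N ->
  (rows mu i + j <= psz mu)%N.
Proof.
case: mu => s Hs; rewrite /rows /psz /=.
elim: s i j Hs => // x s IH [|i] j /is_part_cons[x0 Hs] /=; rewrite !ltnS => Hi Hj.
  by have := size_part_sumn Hs; lia.
case: j Hj => [|j] Hj; first by have := IH i 0%N Hs Hi; lia.
by have := IH i j Hs Hi Hj; lia.
Qed.

Lemma meval_scirc v (mu : part) :
  mpoly.meval v (scirc R N (val mu)) = jt (hsum (pval v)) (size (val mu)) mu.
Proof.
rewrite /scirc -det_map_mx; congr (\det _); apply/matrixP => i j; rewrite !mxE.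
rewrite /rows /hcircZ /hint; case: (_ + _) => n /=; last by rewrite mpoly.meval0.
exact: meval_hcirc.
Qed.

(** An approximation of the moment coordinates of [iota_n]. Under the same scaling p_1 becomes
    exactly 1, in agreement with Lambda/(p_1 - 1). *)
Definition xvec (l : part) (i : 'I_N) : R := psym R i.+2 l / (psz l)%:R ^+ i.+2.

Definition hpsym (k : nat) (l : part) : R := hsum (fun r => psym R r l) k.

Lemma schurp_scirc (mu l : part) : (psz mu <= N)%N -> (0 < psz l)%N ->
  schurp hpsym mu l = (psz l)%:R ^+ psz mu * mpoly.meval (xvec l) (scirc R N (val mu)).
Proof.
move=> HN l0; have n0 : (psz l)%:R != 0 :> R by rewrite pnatr_eq0 -lt0n.
rewrite meval_scirc -jt_scale //; last by move=> i; apply: size_part_rows.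
rewrite /schurp (@jt_widen _ _ (size (val mu))).
- rewrite /jt /jt_gen; congr (\det _); apply/matrixP => i j; rewrite !mxE.
  have Hb := hook_bound (ltn_ord i) (ltn_ord j).
  have : (rows mu i)%:Z - i%:Z + j%:Z <= (psz mu)%:Z by lia.
  case: (_ + _) => // k /= Hk; rewrite -hsum_scale; apply: eq_hsum => r /andP[r0 rk].
  case: r r0 rk => [|[|r]] // _ rk; first by rewrite /psym /= pisum0 expr1 mul1r mulr1.
  have Hr : (r < N)%N by lia.
  by rewrite /= insubT /= /xvec mulrC divfK // expf_neq0.
- exact: hsum0.
- by have := size_part_sumn (valP mu); rewrite /psz; lia.
- by move=> i; apply: size_part_rows.
Qed.

End Scirc.

(** * Standard tableaux *)

Local Open Scope nat_scope.

Section SYT.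
Implicit Types (l : part) (t : nat -> nat -> nat).

(** Tableaux as total functions vanishing outside the diagram: the finite functions in [dimY] have a
    type that depends on the size, and so changes when a box is removed. *)
Definition sytP l t : Prop :=
  [/\ forall i j, (j < rows l i) = (0 < t i j), forall i j, t i j <= psz l,
      forall i j i' j', 0 < t i j -> t i j = t i' j' -> i = i' /\ j = j',
      forall i j, 0 < t i j.+1 -> t i j < t i j.+1 &
      forall i j, 0 < t i.+1 j -> t i j < t i.+1 j].

Notation filling n := {ffun 'I_n * 'I_n -> 'I_n.+1}.

Definition tof n (T : filling n) (i j : nat) : nat :=
  if insub i is Some a then if insub j is Some b then T (a, b) : nat else 0 else 0.

Definition fof n t : filling n := [ffun c : 'I_n * 'I_n => inord (t c.1 c.2)].

Lemma tofE n (T : filling n) (a b : 'I_n) : tof T a b = T (a, b).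
Proof. by rewrite /tof !valK. Qed.

Lemma tof_out n (T : filling n) i j : ~~ ((i < n) && (j < n)) -> tof T i j = 0.
Proof.
rewrite /tof; case: insubP => // a -> _; case: insubP => // b -> _ //.
Qed.

Lemma tof_inj n (T T' : filling n) : (forall i j, tof T i j = tof T' i j) -> T = T'.
Proof. by move=> H; apply/ffunP => -[a b]; apply/val_inj; rewrite /= -!tofE. Qed.

Lemma rows_bound l i j : j < rows l i -> i < psz l /\ j < psz l.
Proof.
move=> H; have Hi : i < psz l by case: (ltnP i (psz l)) H => // /rows_default ->.
split=> //; apply: leq_trans H _; rewrite (@psz_rows l (psz l)) //.
by rewrite (bigD1 (Ordinal Hi)) //= leq_addr.
Qed.

Lemma tof_fof l t : sytP l t -> forall i j, tof (fof (psz l) t) i j = t i j.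
Proof.
move=> [Hd Hb _ _ _] i j; have [/andP[Hi Hj]|out] := boolP ((i < psz l) && (j < psz l)).
  by rewrite -[ i ]/(nat_of_ord (Ordinal Hi)) -[j]/(nat_of_ord (Ordinal Hj)) tofE ffunE /= inordK // ltnS.
rewrite tof_out //; have [H|] := boolP (j < rows l i); last by rewrite Hd; lia.
by have [Hi Hj] := rows_bound H; rewrite Hi Hj in out.
Qed.

Lemma sytE l (T : filling (psz l)) : reflect (sytP l (tof T)) (syt (val l) T).
Proof.
have dg i j : in_diag (val l) i j = (j < rows l i) by [].
rewrite /syt -andbA; apply: (iffP and3P) => [[/forallP H1 /forallP H2 /forallP H3]|[H1 H2 H3 H4 H5]].
  have Hd i j : (j < rows l i) = (0 < tof T i j).
    have [/andP[Hi Hj]|out] := boolP ((i < psz l) && (j < psz l)).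
      rewrite -[ i ]/(nat_of_ord (Ordinal Hi)) -[j]/(nat_of_ord (Ordinal Hj)) tofE.
      by have /eqP := H1 (Ordinal Hi, Ordinal Hj).
    rewrite tof_out // ltnn; apply: contraNF out => H.
    by have [-> ->] := rows_bound H.
  have pos i j : 0 < tof T i j -> exists a b : 'I_(psz l), [/\ i = a, j = b & j < rows l i].
    rewrite -Hd => H; have [Hi Hj] := rows_bound H.
    by exists (Ordinal Hi), (Ordinal Hj).
  split=> //.
  - move=> i j; rewrite /tof; case: insubP => // a _ _; case: insubP => // b _ _.
    by rewrite -ltnS.
  - move=> i j i' j' p E; have p' : 0 < tof T i' j' by rewrite -E.
    have [a [b [ia jb d]]] := pos _ _ p; have [a' [b' [ia' jb' d']]] := pos _ _ p'.
    have /forallP /(_ (a', b')) := H2 (a, b); rewrite !dg /= -ia -jb -ia' -jb' d d' /=.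
    move: E; rewrite ia jb ia' jb' !tofE => E; rewrite -val_eqE /= E eqxx /=.
    by move=> /eqP[-> ->].
  - move=> i j p; have [a [b [ia jb d]]] := pos _ _ p.
    have d' : j < rows l i by lia.
    have [a' [b' [ia' jb' _]]] : exists a b : 'I_(psz l), [/\ i = a, j = b & j < rows l i].
      by apply: pos; rewrite -Hd.
    have /forallP /(_ (a, b)) := H3 (a', b'); rewrite !dg /= -ia -jb -ia' -jb' d d' /= !eqxx /=.
    by rewrite -!tofE -ia -jb -ia' -jb'.
  - move=> i j p; have [a [b [ia jb d]]] := pos _ _ p.
    have d' : j < rows l i by have := rows_noninc l i; lia.
    have [a' [b' [ia' jb' _]]] : exists a b : 'I_(psz l), [/\ i = a, j = b & j < rows l i].
      by apply: pos; rewrite -Hd.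
    have /forallP /(_ (a, b)) := H3 (a', b'); rewrite !dg /= -ia -jb -ia' -jb' d d' /= !eqxx orbT /=.
    by rewrite -!tofE -ia -jb -ia' -jb'.
split; apply/forallP => -[a b].
- by rewrite dg /= H1 tofE.
- apply/forallP => -[a' b']; apply/implyP => /and3P[d d' /eqP E].
  have [] := H3 a b a' b'; first by rewrite -H1.
    by rewrite !tofE E.
  by move=> /val_inj -> /val_inj ->.
- apply/forallP => -[a' b']; apply/implyP => /and3P[d d' /orP[]] /andP[/= /eqP E1 /eqP E2].
    by rewrite -!tofE E1 E2; apply: H4; rewrite -E1 -E2 -H1.
  by rewrite -!tofE E1 E2; apply: H5; rewrite -E1 -E2 -H1.
Qed.

(** The n boxes carry distinct nonzero labels among n possible ones, so every label is used. *)
Lemma sytP_max l t : 0 < psz l -> sytP l t -> exists i j, t i j = psz l.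
Proof.
move=> l0 Ht; have [Hd Hb Hi _ _] := Ht; set n := psz l.
pose T := fof n t; have TE (a b : 'I_n) : T (a, b) = t a b :> nat by rewrite -tofE tof_fof.
pose A := [set c : 'I_n * 'I_n | c.2 < rows l c.1].
have cA : #|A| = n.
  rewrite -sum1dep_card -(pair_big_dep xpredT (fun i j : 'I_n => j < rows l i) (fun _ _ => 1)) /=.
  transitivity (\sum_(i < n) rows l i); last by rewrite -psz_rows.
  apply: eq_bigr => i _.
  rewrite sum1dep_card; have Hr : rows l i <= psz l.
    have [->//|] := posnP (rows l i); move=> H; have := @rows_bound l i (rows l i).-1; lia.
  have winj : injective (widen_ord Hr) by move=> x y /(congr1 val) /= /val_inj.
  rewrite -[RHS]card_ord -(card_imset _ winj).
  apply: eq_card => j; rewrite !inE; apply/idP/imsetP => [jr|[k _ ->] /=]; last exact: ltn_ord.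
  by exists (Ordinal jr) => //; apply/val_inj.
have Tinj : {in A &, injective T}.
  move=> [a b] [a' b']; rewrite !inE /= Hd => p _ /(congr1 val) /=; rewrite !TE => E.
  by have [/val_inj -> /val_inj ->] := Hi _ _ _ _ p E.
have : T @: A == [set~ ord0].
  rewrite eqEcard (card_in_imset Tinj) cA cardsC1 card_ord leqnn andbT.
  apply/fintype.subsetP => _ /imsetP[[a b] + ->]; rewrite !inE /= Hd => p.
  by rewrite -val_eqE /= TE -lt0n.
move=> /eqP /setP /(_ ord_max); rewrite !inE -val_eqE /= -lt0n l0 => /imsetP[[a b] _ E].
by exists a, b; rewrite -TE -E.
Qed.

Lemma sytP_corner l t : 0 < psz l -> sytP l t ->
  exists2 r, removable l r & forall i j, t i j = psz l <-> i = r /\ j = (rows l r).-1.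
Proof.
move=> l0 Ht; have [r [c E]] := sytP_max l0 Ht; have [Hd Hb Hi Hr Hc] := Ht.
have p : 0 < t r c by rewrite E.
have rc : rows l r = c.+1.
  apply/eqP; rewrite eqn_leq Hd p andbT leqNgt Hd; apply/negP => /Hr.
  by rewrite E ltnNge Hb.
exists r.
  rewrite /removable rc ltnS leqNgt Hd; apply/negP => /Hc.
  by rewrite E ltnNge Hb.
move=> i j; rewrite rc /=; split=> [Eij|[-> ->] //].
by apply: Hi; rewrite ?E ?Eij.
Qed.

Definition trm n t i j := if t i j == n then 0 else t i j.
Definition text (n r c : nat) t i j := if (i == r) && (j == c) then n else t i j.

Lemma sytP_trm l r t : removable l r -> sytP l t -> t r (rows l r).-1 = psz l ->
  sytP (prem l r) (trm (psz l) t).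
Proof.
move=> rr Ht E; have Hn := psz_prem rr; have l0 : 0 < psz l by lia.
have [r' rr' Hcor] := sytP_corner l0 Ht; have [rE _] := (Hcor _ _).1 E; subst r'.
have [Hd Hb Hi Hr Hc] := Ht; have rl : 0 < rows l r by move: rr; rewrite /removable; lia.
have tm i j : trm (psz l) t i j = if (i == r) && (j == (rows l r).-1) then 0 else t i j.
  rewrite /trm; have [/Hcor[-> ->]|ne] := eqVneq (t i j) (psz l); first by rewrite !eqxx.
  by case: andP => // -[/eqP ie /eqP je]; case/eqP: ne; apply/Hcor.
have dE i j : (j < rows (prem l r) i) = (0 < trm (psz l) t i j).
  rewrite rows_prem // tm; case: (eqVneq i r) => [->|_] /=; last by rewrite subn0 Hd.
  by case: eqP => [->|ne]; rewrite -?Hd; lia.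
split=> //.
- move=> i j; rewrite /trm; case: eqP => // ne; have := Hb i j; lia.
- move=> i j i' j'; rewrite /trm; case: eqP => // ne p; case: eqP => [e|ne'] E'; first by lia.
  exact: Hi.
- move=> i j; rewrite -dE => p; have p2 : j.+1 < rows l i by move: p; rewrite rows_prem //; lia.
  have := Hr i j; rewrite -Hd => /(_ p2); move: p; rewrite dE /trm.
  by case: eqP => // _ _; case: eqP => // e; lia.
- move=> i j; rewrite -dE => p; have p2 : j < rows l i.+1 by move: p; rewrite rows_prem //; lia.
  have := Hc i j; rewrite -Hd => /(_ p2); move: p; rewrite dE /trm.
  by case: eqP => // _ _; case: eqP => // e; lia.
Qed.

Lemma sytP_text l r t : removable l r -> sytP (prem l r) t ->
  sytP l (text (psz l) r (rows l r).-1 t).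
Proof.
move=> rr [Hd Hb Hi Hr Hc]; have Hn := psz_prem rr.
have rl : rows l r.+1 < rows l r by move: rr; rewrite /removable.
have lt i j : t i j < psz l by rewrite Hn ltnS.
have dE i j : (j < rows l i) = (0 < text (psz l) r (rows l r).-1 t i j).
  have := Hd i j; rewrite rows_prem // /text.
  case: (eqVneq i r) => [->|_] /=; last by rewrite subn0.
  by case: eqP => [->|ne]; lia.
split=> //.
- by move=> i j; rewrite /text; case: ifP => // _; rewrite ltnW.
- move=> i j i' j'; rewrite /text; case: andP => [[/eqP -> /eqP ->]|_];
    case: andP => [[/eqP -> /eqP ->]|_] //.
  + by move=> _ e; have := lt i' j'; lia.
  + by move=> _ e; have := lt i j; lia.
  + exact: Hi.
- move=> i j; rewrite -dE => p; rewrite /text; case: (eqVneq i r) => [e|ne] /=; last first.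
    by apply: Hr; rewrite -Hd rows_prem // (negbTE ne) subn0.
  subst i; case: (eqVneq j.+1 (rows l r).-1) => [e|ne].
    by rewrite ltn_eqF ?lt // -e.
  have -> : (j == (rows l r).-1) = false by apply/eqP; lia.
  by apply: Hr; rewrite -Hd rows_prem // eqxx; lia.
- move=> i j; rewrite -dE => p; rewrite /text; case: (eqVneq i.+1 r) => [e|ne] /=.
    have -> : (i == r) = false by apply/eqP; lia.
    case: eqP => //= ne; apply: Hc; rewrite -Hd rows_prem // e eqxx; move: p; rewrite e; lia.
  case: (eqVneq i r) => [e|ne2] /=.
    subst i; have -> : (j == (rows l r).-1) = false by apply/eqP; lia.
    by apply: Hc; rewrite -Hd rows_prem // (negbTE ne) subn0.
  by apply: Hc; rewrite -Hd rows_prem // (negbTE ne) subn0.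
Qed.

(** The largest entry of a tableau sits in a corner, and erasing it is a bijection onto the tableaux
    of the smaller diagram; [text] puts it back. *)
Lemma dimY_rec l : 0 < psz l ->
  dimY (val l) = \sum_(i < (psz l).+1 | removable l i) dimY (val (prem l i)).
Proof.
move=> l0; rewrite /dimY -/(psz l) -sum1_card.
pose corner (i : 'I_(psz l).+1) (T : filling (psz l)) := tof T i (rows l i).-1 == psz l.
transitivity (\sum_(T : filling (psz l) | syt (val l) T)
   \sum_(i < (psz l).+1 | removable l i && corner i T) 1).
  apply: eq_big => // T /sytE HT; have [r rr Hcor] := sytP_corner l0 HT.
  have Hr : r < (psz l).+1 by have := removable_bound rr; lia.
  rewrite (big_pred1 (Ordinal Hr)) // => i; rewrite /corner /= -val_eqE /=.
  apply/andP/eqP => [[_ /eqP /Hcor[]] //|->]; split=> //.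
  by apply/eqP/Hcor.
rewrite (exchange_big_dep (fun i : 'I_(psz l).+1 => removable l i)) /=; last by move=> T i _ /andP[].
apply: eq_bigr => i ri; rewrite -/(psz (prem l i)).
rewrite (eq_bigl (fun T => syt (val l) T && corner i T)); last by move=> T; rewrite ri.
rewrite sum1dep_card.
pose g (T : filling (psz (prem l i))) := fof (psz l) (text (psz l) i (rows l i).-1 (tof T)).
have Hg T : syt (val (prem l i)) T -> forall a b,
    tof (g T) a b = text (psz l) i (rows l i).-1 (tof T) a b.
  by move=> /sytE HT; apply: tof_fof; apply: sytP_text.
have ginj : {in [pred T | syt (val (prem l i)) T] &, injective g}.
  move=> T T'; rewrite !inE => HT HT' E; apply: tof_inj => a b.
  have := Hg _ HT a b; rewrite E Hg // /text.
  case: andP => [[/eqP -> /eqP ->] _|//].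
  have z (U : filling (psz (prem l i))) : syt (val (prem l i)) U -> tof U i (rows l i).-1 = 0.
    move=> /sytE[Hd _ _ _ _]; apply/eqP; rewrite -leqn0 leqNgt -Hd rows_prem // eqxx; lia.
  by rewrite !z.
rewrite -(card_in_imset ginj); apply: eq_card => T; rewrite inE; apply/andP/imsetP.
  move=> [/sytE HT /eqP HC]; exists (fof (psz (prem l i)) (trm (psz l) (tof T))).
    by rewrite inE; apply/sytE; have H := sytP_trm ri HT HC;
      rewrite (_ : tof _ = trm (psz l) (tof T)) //; apply: funext => a; apply: funext => b; rewrite tof_fof.
  have H := sytP_trm ri HT HC.
  have H2 : syt (val (prem l i)) (fof (psz (prem l i)) (trm (psz l) (tof T))).
    by apply/sytE; rewrite (_ : tof _ = trm (psz l) (tof T)) //; apply: funext => a; apply: funext => b; rewrite tof_fof.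
  apply: tof_inj => a b; rewrite Hg // /text tof_fof // /trm.
  case: andP => [[/eqP -> /eqP ->]|ne]; first by rewrite HC.
  case: eqP => // e; exfalso; apply: ne.
  have [r' rr' Hcor] := sytP_corner l0 HT; have [E _] := (Hcor _ _).1 HC.
  by have [-> ->] := (Hcor _ _).1 e; rewrite -E.
move=> [T' HT' ->]; rewrite inE in HT'.
have GE : tof (g T') = text (psz l) i (rows l i).-1 (tof T').
  by apply: funext => a; apply: funext => b; apply: Hg.
split; last by rewrite /corner GE /text !eqxx.
by apply/sytE; rewrite GE; apply: sytP_text => //; apply/sytE.
Qed.

Lemma dimY0 : dimY [::] = 1.
Proof.
rewrite /dimY /=; apply: (@fintype.eq_card1 _ (fof 0 (fun _ _ => 0))) => T; rewrite !inE.
have -> : (T == fof 0 (fun _ _ => 0)) = true.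
  by apply/eqP/ffunP => -[[]].
by rewrite /syt -andbA; apply/and3P; split; apply/forallP => -[[]].
Qed.

End SYT.

Local Open Scope ring_scope.

Lemma dimYE (R : realFieldType) (l : part) : (dimY (val l))%:R%R = dimp R part0 l.
Proof.
move: {2}(psz l) (erefl (psz l)) => n; elim: n l => [|n IH] l Hl.
  by rewrite (psz0_part0 Hl) dimY0 dimT0.
rewrite dimY_rec ?Hl // dimT_rec ?Hl // natr_sum /opU ?Hl; apply: eq_bigr => i ri.
by apply: IH; have := psz_prem ri; lia.
Qed.

(** * The up-down chain of the z-measures *)

Section ZChain.
Variable R : realFieldType.
Implicit Types (F G : part -> R) (l mu nu : part).
Local Notation content := (content R).
Local Notation drel := (drel R).
Local Notation Emu := (Emu R).
Local Notation w := (Emu part0).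

Lemma edge_exchange n (f : part -> part -> nat -> R) :
  \sum_(l <- Yp n) \sum_(i < (psz l).+1 | addable l i) f l (padd l i) i =
  \sum_(m <- Yp n.+1) \sum_(i < (psz m).+1 | removable m i) f (prem m i) m i.
Proof.
transitivity (\sum_(l <- Yp n) \sum_(m <- Yp n.+1) \sum_(i < n.+2)
   if addable l i && (padd l i == m) then f l m i else 0).
  apply: eq_big_seq => l; rewrite mem_Yp => /eqP Hl.
  rewrite (@widen_add _ n.+2 l (fun i => f l (padd l i) i)) ?Hl // exchange_big /=.
  rewrite [LHS]big_mkcond; apply: eq_bigr => i _; case: ifP => ai /=; last by rewrite big1.
  rewrite (bigD1_seq (padd l i)) ?Yp_uniq ?mem_Yp ?psz_padd ?Hl //= eqxx big1 ?addr0 //.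
  by move=> m; rewrite eq_sym => /negbTE ->.
rewrite exchange_big /=; apply: eq_big_seq => m; rewrite mem_Yp => /eqP Hm.
rewrite (@widen_rem _ n.+2 m (fun i => f (prem m i) m i)) ?Hm // exchange_big /=.
rewrite [RHS]big_mkcond; apply: eq_bigr => i _.
under eq_bigr => l _ do rewrite edge_eq.
case: ifP => ri /=; last by rewrite big1.
rewrite (bigD1_seq (prem m i)) ?Yp_uniq ?mem_Yp //=; last by have := psz_prem ri; lia.
by rewrite eqxx big1 ?addr0 // => l; rewrite eq_sym => /negbTE ->.
Qed.

(** As e_2 = 2n, the function D_2 E_mu solves (T - (m-1))f = 2n E_mu, where m = |mu|. A particular
    solution is (n+m)E_mu; the homogeneous part is determined on level m - 1. *)
Lemma opD2_Emu mu l : opD 2 (Emu mu) l =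
  ((psz l)%:R + (psz mu)%:R) * Emu mu l +
  \sum_(i < (psz mu).+1 | removable mu i) (content mu i - 1) ^+ 2 * Emu (prem mu i) l.
Proof.
set m := psz mu.
pose S l := \sum_(i < m.+1 | removable mu i) (content mu i - 1) ^+ 2 * Emu (prem mu i) l.
pose Q l : R := ((psz l)%:R + m%:R) * Emu mu l.
have TS l' : opT S l' = (m%:R - 1) * S l'.
  rewrite opT_sum /S mulr_sumr; apply: eq_bigr => i ri; rewrite opT_Emu.
  by have := congr1 (fun n => n%:R : R) (psz_prem ri); rewrite -natr1 -/m => ->; ring.
have UE l' : opU (Emu mu) l' = ((psz l')%:R - m%:R) * Emu mu l'.
  by have := opT_Emu R mu l'; rewrite /opT => /eqP; rewrite subr_eq addrC -subr_eq mulrBl => /eqP <-.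
have UQ l' : opU Q l' = ((psz l')%:R - 1 + m%:R) * opU (Emu mu) l'.
  rewrite /opU mulr_sumr; apply: eq_bigr => i ri; rewrite /Q.
  by have := congr1 (fun n => n%:R : R) (psz_prem ri); rewrite -natr1 => ->; rewrite addrK.
have TD l' : opT (opD 2 (Emu mu)) l' = (m%:R - 1) * opD 2 (Emu mu) l' + esum R 2 l' * Emu mu l'.
  have := congr1 (fun f => f l') (opTs_opD (m%:R - 1) 2 (Emu mu)).
  rewrite /= subrK /opTs.
  have -> : opD 2 (fun l0 => opT (Emu mu) l0 - m%:R * Emu mu l0) l' = 0.
    by rewrite /opD big1 // => i _; rewrite opT_Emu subrr mulr0.
  by rewrite add0r => /eqP; rewrite subr_eq addrC => /eqP.
have e2 l' : esum R 2 l' = 2 * (psz l')%:R.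
  by rewrite esumS big_ord0 addr0 pisum0.
apply/eqP; rewrite -subr_eq0 -/(Q l) -/(S l); apply/eqP.
have -> : opD 2 (Emu mu) l - (Q l + S l) = 1 * (opD 2 (Emu mu) l) + (-1) * (1 * Q l + 1 * S l) by ring.
move: l; apply: (eigen_unique (a := m%:R - 1)) => l.
  rewrite opT_lin (opT_lin 1 1) TS TD e2 /opT UQ UE /Q; ring.
move=> E; have Hl : (psz l).+1 = m by apply/eqP; rewrite -(eqr_nat R) -natr1 E subrK.
by rewrite opD_Emu_level // /Q Emu_below -/m ?Hl //; rewrite /S; ring.
Qed.

Variables (t s : R).
(* t and s stand for zz' and z + z', so that zfac c = (z + c)(z' + c). *)
Definition zfac (c : R) := t + s * c + c ^+ 2.

Definition opZ F l : R := \sum_(i < (psz l).+1 | addable l i) zfac (content l i) * F (padd l i).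

Lemma opZE F l : opZ F l = t * opD 0 F l + s * opD 1 F l + opD 2 F l.
Proof.
rewrite /opZ /opD !mulr_sumr -!big_split /=; apply: eq_bigr => i _; rewrite /zfac; ring.
Qed.

Definition lowZ mu (f : part -> R) : R :=
  \sum_(i < (psz mu).+1 | removable mu i) zfac (content mu i - 1) * f (prem mu i).

Lemma opZ_Emu mu l : opZ (Emu mu) l =
  (t + (psz l)%:R + (psz mu)%:R) * Emu mu l + lowZ mu (Emu ^~ l).
Proof.
have H0 : opD 0 (Emu mu) l = opX (Emu mu) l + Emu mu l by rewrite /opX subrK.
rewrite opZE opD2_Emu H0 opX_Emu -[opD 1 _ _]/(opY _ _) opY_Emu /lowZ.
have -> : \sum_(i < (psz mu).+1 | removable mu i) zfac (content mu i - 1) * Emu (prem mu i) l =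
  t * \sum_(i < (psz mu).+1 | removable mu i) Emu (prem mu i) l +
  s * \sum_(i < (psz mu).+1 | removable mu i) (content mu i - 1) * Emu (prem mu i) l +
  \sum_(i < (psz mu).+1 | removable mu i) (content mu i - 1) ^+ 2 * Emu (prem mu i) l.
  rewrite !mulr_sumr -!big_split /=; apply: eq_bigr => i _; rewrite /zfac; ring.
ring.
Qed.

Definition boxprod (g : R -> R) l : R :=
  \prod_(i < psz l) \prod_(j < rows l i) g (j%:R - i%:R).

Lemma boxprod_widen B g l : (psz l <= B)%N ->
  boxprod g l = \prod_(i < B) \prod_(j < rows l i) g (j%:R - i%:R).
Proof.
move=> HB; rewrite /boxprod (big_ord_widen B (fun i : nat => \prod_(j < rows l i) g (j%:R - i%:R))) //.
rewrite [RHS](bigID (fun i : 'I_B => (i < psz l)%N)) /=.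
rewrite [X in _ = _ * X]big1 ?mulr1 // => i; rewrite -leqNgt => Hi.
by rewrite rows_default // big_ord0.
Qed.

Lemma boxprod_padd g l i : addable l i -> boxprod g (padd l i) = boxprod g l * g (content l i).
Proof.
move=> ai; have Hi := addable_bound ai.
rewrite (@boxprod_widen (psz l).+2) ?psz_padd // (@boxprod_widen (psz l).+2 g l); last lia.
have Hi' : (i < (psz l).+2)%N by lia.
rewrite (bigD1 (Ordinal Hi')) //= [in RHS](bigD1 (Ordinal Hi')) //=.
rewrite rows_padd // eqxx addn1 big_ord_recr /= -!mulrA; congr (_ * _).
rewrite mulrC; congr (_ * _); apply: eq_bigr => j Hj.
rewrite rows_padd //; case: eqP => [E|]; last by rewrite addn0.
by case/negP: Hj; apply/eqP/val_inj.
Qed.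

Local Notation zr := (boxprod zfac).

(** Along an edge the weight [zr] is multiplied by [zfac] of the added content, which is exactly the
    weight in [opZ]; both sides are sums over the same edges. *)
Lemma opZ_adjoint n F G :
  \sum_(l <- Yp n) zr l * (F l * opZ G l) = \sum_(l <- Yp n.+1) zr l * (opU F l * G l).
Proof.
have := edge_exchange n (fun l m i => zr m * (F l * G m)).
have -> : \sum_(l <- Yp n) \sum_(i < (psz l).+1 | addable l i) zr (padd l i) * (F l * G (padd l i)) =
   \sum_(l <- Yp n) zr l * (F l * opZ G l).
  apply: eq_bigr => l _; rewrite /opZ !mulr_sumr; apply: eq_bigr => i ai.
  rewrite boxprod_padd //; ring.
move=> ->; apply: eq_bigr => l _; rewrite /opU mulr_suml mulr_sumr.
by [].
Qed.

Definition rising n : R := \prod_(k < n) (t + k%:R).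

(** With w = dim(l)/n!, the product w^2 n! is (dim l)^2/n!. *)
Definition Mz l : R := zr l * w l ^+ 2 * (psz l)`!%:R / rising (psz l).

Hypothesis t0 : 0 < t.

Lemma rising_gt0 n : 0 < rising n.
Proof. by apply: prodr_gt0 => i _; rewrite ltr_wpDr. Qed.

Lemma risingS n : rising n.+1 = rising n * (t + n%:R).
Proof. by rewrite /rising big_ord_recr. Qed.

Definition dA mu l : R :=
  - (psz mu)%:R * ((psz mu)%:R - 1 + t) * drel mu l + lowZ mu (drel ^~ l).

Definition downavg F l : R :=
  \sum_(j < (psz l).+1 | removable l j) dimp R part0 (prem l j) / dimp R part0 l * F (prem l j).

Lemma w_ratio l j : removable l j ->
  dimp R part0 (prem l j) / dimp R part0 l = w (prem l j) / w l / (psz l)%:R.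
Proof.
move=> rj; have n3 : dimp R part0 l != 0 by rewrite gt_eqF ?dimT_gt0.
have n2 : (psz (prem l j)).+1%:R != 0 :> R by rewrite pnatr_eq0.
rewrite !EmuE !subn0.
have -> : (psz l)%:R = (psz (prem l j)).+1%:R :> R by rewrite -(psz_prem rj).
have -> : (psz l)`!%:R = (psz (prem l j)).+1%:R * (psz (prem l j))`!%:R :> R.
  by rewrite -natrM -factS -(psz_prem rj).
move: (_`!%:R) (_.+1%:R) (dimp _ _ l) (fact_neq0 R (psz (prem l j))) n2 n3 => a b c a0 b0 c0.
by field; rewrite a0 b0 c0.
Qed.

(** Coherence of the z-measures is the adjointness of U and [opZ] tested on [w], for which [opZ_Emu]
    gives the eigenvalue t + n. *)
Lemma Mz_coherent n F : \sum_(l <- Yp n) Mz l * F l = \sum_(l <- Yp n.+1) Mz l * downavg F l.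
Proof.
have := opZ_adjoint n (fun l => w l * F l) w.
have rn := rising_gt0 n; have tn : 0 < t + n%:R by rewrite ltr_wpDr.
have n1 : (n.+1)%:R != 0 :> R by rewrite pnatr_eq0.
have fn := fact_neq0 R n.
move=> E; transitivity (n`!%:R / rising n / (t + n%:R) *
  \sum_(l <- Yp n) zr l * (w l * F l * opZ w l)).
  rewrite mulr_sumr; apply: eq_big_seq => l; rewrite mem_Yp => /eqP Hl.
  rewrite opZ_Emu /lowZ big1 ?addr0; last by move=> i; rewrite removable0.
  have z0 : (psz part0)%:R = 0 :> R by [].
  rewrite /Mz Hl ?z0 ?addr0.
  move: (rising n) (t + n%:R) rn tn => a b a0 b0; field.
  by rewrite !gt_eqF.
rewrite E mulr_sumr; apply: eq_big_seq => l; rewrite mem_Yp => /eqP Hl.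
rewrite /Mz Hl risingS factS natrM.
have -> : opU (fun l => w l * F l) l = n.+1%:R * w l * downavg F l.
  rewrite /downavg mulr_sumr; apply: eq_bigr => j rj; rewrite w_ratio //.
  have -> : (psz l)%:R = n.+1%:R :> R by rewrite Hl.
  have w0 : w l != 0 by rewrite gt_eqF ?w_gt0.
  move: (n.+1%:R) n1 => a a0; field; by rewrite a0 w0.
move: (rising n) (t + n%:R) rn tn => a b a0 b0; field.
by rewrite !gt_eqF.
Qed.

(** Adjointness is applied to E_mu' and E_mu: U multiplies the first by n + 1 - m', and [opZ]
    multiplies the second by t + n + m up to the lowering term. The identity (n+1-m)(t+n+m) =
    (n+1)(t+n) - m(m-1+t) produces the diagonal coefficient of A. Coherence rewrites the remaining
    level-n sum on level n + 1. *)
Lemma Mz_dirichlet n mu mu' : (psz mu <= n)%N -> (psz mu' <= n)%N ->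
  - \sum_(l <- Yp n) Mz l * (dA mu l * drel mu' l) =
  n.+1%:R * (t + n%:R) * \sum_(l <- Yp n.+1) Mz l *
    (downavg (fun l => drel mu l * drel mu' l) l - drel mu l * drel mu' l).
Proof.
move=> Hm Hm'.
have rn := rising_gt0 n; have tn : 0 < t + n%:R by rewrite ltr_wpDr.
have n1 : (n.+1)%:R != 0 :> R by rewrite pnatr_eq0.
have fn := fact_neq0 R n.
have ffn k m : (m <= k)%N -> (k ^_ m)%:R != 0 :> R.
  by move=> H; rewrite pnatr_eq0 -lt0n ffact_gt0.
have ffS k m : (m <= k)%N -> (k.+1%:R - m%:R) * (k.+1 ^_ m)%:R = k.+1%:R * (k ^_ m)%:R :> R.
  move=> H; rewrite -natrB ?leqW // -!natrM; congr (_%:R).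
  by rewrite mulnC -ffactnSr ffactSS.
have key : \sum_(l <- Yp n) Mz l * (dA mu l * drel mu' l) +
    n.+1%:R * (t + n%:R) * \sum_(l <- Yp n) Mz l * (drel mu l * drel mu' l) =
    n.+1%:R * (t + n%:R) * \sum_(l <- Yp n.+1) Mz l * (drel mu l * drel mu' l); last first.
  under [X in _ = _ * X]eq_bigr => l _ do rewrite mulrBr.
  rewrite sumrB -Mz_coherent mulrBr -key; ring.
have := opZ_adjoint n (Emu mu') (Emu mu).
(* Division by the falling factorials converts E into relative dimensions. The factor n + 1 - m
   raises the falling factorial of order m - 1 in the lowering term to order m, and on level n + 1
   combines into [ffS]. *)
pose K : R := n`!%:R / rising n / (n ^_ (psz mu))%:R / (n ^_ (psz mu'))%:R * (n.+1%:R - (psz mu)%:R).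
move=> E; transitivity (K * \sum_(l <- Yp n) zr l * (Emu mu' l * opZ (Emu mu) l)).
  rewrite !mulr_sumr -big_split /=; apply: eq_big_seq => l; rewrite mem_Yp => /eqP Hl.
  rewrite opZ_Emu.
  have -> : lowZ mu (Emu ^~ l) = (n ^_ (psz mu).-1)%:R * w l * lowZ mu (drel ^~ l).
    rewrite /lowZ mulr_sumr; apply: eq_bigr => i ri; rewrite [Emu (prem _ _) _]Emu_drel Hl.
    have -> : psz (prem mu i) = (psz mu).-1 by have := psz_prem ri; lia.
    ring.
  have HL : (n.+1%:R - (psz mu)%:R) * ((n ^_ (psz mu).-1)%:R * lowZ mu (drel ^~ l)) =
      (n ^_ (psz mu))%:R * lowZ mu (drel ^~ l).
    have [m0|m0] := posnP (psz mu).
      rewrite /lowZ big1 ?mulr0 // => i /psz_prem; lia.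
    rewrite -natrB ?leqW // mulrA -natrM; congr (_%:R * _).
    by rewrite -[in RHS](prednK m0) ffactnSr mulnC; congr (_ * _)%N; lia.
  rewrite [Emu mu l]Emu_drel [Emu mu' l]Emu_drel Hl /K /Mz Hl /dA.
  have := ffn _ _ Hm; have := ffn _ _ Hm'; move: HL; rewrite -[n.+1%:R]natr1.
  move: (lowZ mu _) (n ^_ (psz mu).-1)%:R (n ^_ (psz mu))%:R (n ^_ (psz mu'))%:R (rising n) rn => L C A B a a0 HL B0 A0.
  have an : a != 0 by rewrite gt_eqF.
  move: (n%:R) (psz mu)%:R (drel mu l) (drel mu' l) (zr l) (w l) (n`!%:R) HL
    => x m d d' z u f HL.
  transitivity (f / a / A / B * z * B * d' * u *
    ((x + 1 - m) * (t + x + m) * (A * d * u) + u * ((x + 1 - m) * (C * L)))); last by ring.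
  by rewrite HL; field; rewrite an A0 B0.
rewrite E !mulr_sumr; apply: eq_big_seq => l; rewrite mem_Yp => /eqP Hl.
have -> : opU (Emu mu') l = (n.+1%:R - (psz mu')%:R) * Emu mu' l.
  have := opT_Emu R mu' l; rewrite /opT Hl => /eqP.
  by rewrite subr_eq addrC -subr_eq -mulrBl => /eqP <-.
rewrite [Emu mu l]Emu_drel [Emu mu' l]Emu_drel Hl /K /Mz Hl risingS factS natrM.
have A0 := ffn _ _ Hm; have B0 := ffn _ _ Hm'; have HA := ffS _ _ Hm; have HB := ffS _ _ Hm'.
have an : rising n != 0 by rewrite gt_eqF.
have tn' : t + n%:R != 0 by rewrite gt_eqF.
transitivity (n`!%:R / rising n / (n ^_ (psz mu))%:R / (n ^_ (psz mu'))%:R * zr l * w l ^+ 2 *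
   drel mu l * drel mu' l * (((n.+1)%:R - (psz mu)%:R) * (n.+1 ^_ psz mu)%:R) *
   (((n.+1)%:R - (psz mu')%:R) * (n.+1 ^_ psz mu')%:R)).
  by ring.
rewrite HA HB; move: (t + n%:R) (rising n) (n ^_ _)%:R (n ^_ _)%:R an tn' A0 B0 => a b A B a0 b0 A0 B0.
by field; rewrite a0 b0 A0 B0.
Qed.

End ZChain.

(** * Functions of prescribed decay *)

Section Decay.
Variables (R : realType) (I : Type) (P : I -> Prop) (sz : I -> nat).
Implicit Types (f g : I -> R) (a b : nat).

(** This is f = O(n^-a), uniformly at each size n. The index type is kept general in order to serve
    diagrams, edges and pairs (size, content) alike. *)
Definition decay a f : Prop :=
  exists C n0, forall i, P i -> (n0 <= sz i)%N -> `|f i| * (sz i)%:R ^+ a <= C.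

Lemma decay_ge a f : decay a f -> exists C n0, [/\ 0 <= C, (0 < n0)%N &
  forall i, P i -> (n0 <= sz i)%N -> `|f i| * (sz i)%:R ^+ a <= C].
Proof.
case=> C [n0 H]; exists (Num.max 0 C), n0.+1; split; rewrite ?le_max ?lexx //.
by move=> i Pi Hi; rewrite le_max H ?orbT // ltnW.
Qed.

Lemma decay_ext n0 a f g : (forall i, P i -> (n0 <= sz i)%N -> f i = g i) -> decay a f -> decay a g.
Proof.
move=> E [C [n1 H]]; exists C, (maxn n0 n1) => i Pi; rewrite geq_max => /andP[h0 h1].
by rewrite -E // H.
Qed.

Lemma decay_eq a f g : (forall i, P i -> f i = g i) -> decay a f -> decay a g.
Proof. by move=> E; apply: (@decay_ext 0) => i Pi _; exact: E. Qed.

Lemma decay_le a f g : (forall i, P i -> `|g i| <= `|f i|) -> decay a f -> decay a g.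
Proof.
move=> E [C [n0 H]]; exists C, n0 => i Pi Hi; apply: le_trans (H i Pi Hi).
by rewrite ler_wpM2r ?exprn_ge0 ?E.
Qed.

Lemma decayD a f g : decay a f -> decay a g -> decay a (fun i => f i + g i).
Proof.
move=> [C [n0 H]] [C' [n1 H']]; exists (C + C'), (maxn n0 n1) => i Pi.
rewrite geq_max => /andP[h0 h1]; apply: le_trans (lerD (H i Pi h0) (H' i Pi h1)).
by rewrite -mulrDl ler_wpM2r ?exprn_ge0 // ler_normD.
Qed.

Lemma decayM a b f g : decay a f -> decay b g -> decay (a + b) (fun i => f i * g i).
Proof.
move=> /decay_ge[C [n0 [C0 _ H]]] /decay_ge[C' [n1 [C0' _ H']]].
exists (C * C'), (maxn n0 n1) => i Pi; rewrite geq_max => /andP[h0 h1].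
by rewrite normrM exprD mulrACA ler_pM ?H ?H' ?mulr_ge0 ?exprn_ge0.
Qed.

Lemma decay_cst (c : R) : decay 0 (fun _ => c).
Proof. by exists `|c|, 0%N => i _ _; rewrite expr0 mulr1. Qed.

Lemma decay_0 a : decay a (fun _ => 0).
Proof. by exists 0, 0%N => i _ _; rewrite normr0 mul0r. Qed.

Lemma decay_mono a b f : (b <= a)%N -> decay a f -> decay b f.
Proof.
move=> ab /decay_ge[C [n0 [C0 n00 H]]]; exists C, n0 => i Pi Hi; apply: le_trans (H i Pi Hi).
by rewrite ler_wpM2l // ler_weXn2l // ler1n; apply: leq_trans Hi.
Qed.

Lemma decayZ a (c : R) f : decay a f -> decay a (fun i => c * f i).
Proof. by move=> H; apply: decayM (decay_cst c) H. Qed.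

Lemma decayN a f : decay a f -> decay a (fun i => - f i).
Proof. by apply: decay_le => i _; rewrite normrN. Qed.

Lemma decayB a f g : decay a f -> decay a g -> decay a (fun i => f i - g i).
Proof. by move=> H H'; apply: decayD => //; apply: decayN. Qed.

Lemma decay_sum (J : Type) (s : seq J) (Q : pred J) a (f : J -> I -> R) :
  (forall j, Q j -> decay a (f j)) -> decay a (fun i => \sum_(j <- s | Q j) f j i).
Proof.
move=> H; elim: s => [|x s IH].
  by apply: decay_eq (decay_0 a) => i _; rewrite big_nil.
case Qx : (Q x).
  by apply: decay_eq (decayD (H _ Qx) IH) => i _; rewrite big_cons Qx.
by apply: decay_eq IH => i _; rewrite big_cons Qx.
Qed.

Lemma decay_sum_in (J : eqType) (s : seq J) a (f : J -> I -> R) :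
  (forall j, j \in s -> decay a (f j)) -> decay a (fun i => \sum_(j <- s) f j i).
Proof.
move=> H; apply: (@decay_eq _ (fun i => \sum_(j <- s | j \in s) f j i)).
  by move=> i _; rewrite -big_seq.
exact: decay_sum.
Qed.

Lemma decay_invn : decay 1 (fun i => ((sz i)%:R)^-1).
Proof.
exists 1, 1%N => i _ Hi; have n0 : 0 < (sz i)%:R :> R by rewrite ltr0n.
by rewrite expr1 gtr0_norm ?invr_gt0 // mulVf // gt_eqF.
Qed.

Lemma decay_mulX a b f : decay (a + b) f -> decay a (fun i => f i * (sz i)%:R ^+ b).
Proof.
move=> [C [n0 H]]; exists C, n0 => i Pi Hi; apply: le_trans (H i Pi Hi).
by rewrite normrM [`|_ ^+ b|]ger0_norm ?exprn_ge0 // -mulrA -exprD addnC.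
Qed.

Section Taylor.
Variable N : nat.
Implicit Type p : mpoly.mpoly N R.

Lemma mpoly_ind_ring (Q : mpoly.mpoly N R -> Prop) :
  (forall c, Q (mpoly.mpolyC N c)) -> (forall i, Q (mpoly.mpolyX R (mpoly.mnm1 i))) ->
  (forall p q, Q p -> Q q -> Q (p + q)) -> (forall p q, Q p -> Q q -> Q (p * q)) ->
  forall p, Q p.
Proof.
move=> Qc QX QD QM; apply: mpoly.mpolyind; first by rewrite -mpoly.mpolyC0.
move=> c m p _ _ Qp; apply: (QD) => //; rewrite -mpoly.mul_mpolyC; apply: (QM) => //.
rewrite mpoly.mpolyXE_id; elim: (index_enum _) => [|i s IHs].
  by rewrite big_nil -mpoly.mpolyC1.
rewrite big_cons; apply: (QM) => //; elim: (m i) => [|k IH]; first by rewrite expr0 -mpoly.mpolyC1.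
by rewrite exprS; apply: (QM).
Qed.

Lemma decay_meval (x : I -> 'I_N -> R) p : (forall k, decay 0 (x ^~ k)) ->
  decay 0 (fun i => mpoly.meval (x i) p).
Proof.
move=> Hx; elim/mpoly_ind_ring: p => [c|k|p q Hp Hq|p q Hp Hq].
- by apply: decay_eq (decay_cst c) => i _; rewrite mpoly.mevalC.
- by apply: decay_eq (Hx k) => i _; rewrite mpoly.mevalXU.
- by apply: decay_eq (decayD Hp Hq) => i _; rewrite mpoly.mevalD.
- by apply: decay_eq (decayM Hp Hq) => i _; rewrite mpoly.mevalM.
Qed.

Lemma meval_lip a (x y : I -> 'I_N -> R) p : (forall k, decay 0 (x ^~ k)) ->
  (forall k, decay a (fun i => y i k - x i k)) ->
  decay a (fun i => mpoly.meval (y i) p - mpoly.meval (x i) p).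
Proof.
move=> Hx Hd.
have Hy k : decay 0 (y ^~ k).
  apply: decay_eq (decayD (Hx k) (decay_mono (leq0n a) (Hd k))) => i _; ring.
elim/mpoly_ind_ring: p => [c|k|p q Hp Hq|p q Hp Hq].
- by apply: decay_eq (decay_0 a) => i _; rewrite !mpoly.mevalC subrr.
- by apply: decay_eq (Hd k) => i _; rewrite !mpoly.mevalXU.
- apply: decay_eq (decayD Hp Hq) => i _; rewrite !mpoly.mevalD; ring.
- have := decayD (decayM (decay_meval q Hy) Hp) (decayM (decay_meval p Hx) Hq).
  apply: decay_eq => i _; rewrite !mpoly.mevalM; ring.
Qed.

(** By induction over ring operations: a product adds only the product of two increments, each of
    order 1/n. *)
Lemma taylor1 (x y : I -> 'I_N -> R) p : (forall k, decay 0 (x ^~ k)) ->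
  (forall k, decay 1 (fun i => y i k - x i k)) ->
  decay 2 (fun i => mpoly.meval (y i) p - mpoly.meval (x i) p -
     \sum_k mpoly.meval (x i) (mpoly.mderiv k p) * (y i k - x i k)).
Proof.
move=> Hx Hd.
elim/mpoly_ind_ring: p => [c|k|p q Hp Hq|p q Hp Hq].
- apply: decay_eq (decay_0 2) => i _; rewrite !mpoly.mevalC subrr sub0r big1 ?oppr0 // => k _.
  by rewrite mpoly.mderivC mpoly.meval0 mul0r.
- apply: decay_eq (decay_0 2) => i _; rewrite !mpoly.mevalXU (bigD1 k) //= big1 ?addr0.
    rewrite mpoly.mderivX mpoly.mnm1E eqxx (_ : mpoly.mnm_sub _ _ = @mpoly.mnm0 N).
      by rewrite mpoly.mpolyX0 mpoly.mevalZ mpoly.meval1 !mul1r subrr.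
    by apply/mpoly.mnmP => j; rewrite mpoly.mnmBE subnn mpoly.mnm0E.
  move=> j jk; rewrite mpoly.mderivX mpoly.mnm1E eq_sym (negbTE jk).
  by rewrite scale0r mpoly.meval0 mul0r.
- apply: decay_eq (decayD Hp Hq) => i _; rewrite !mpoly.mevalD.
  have -> : \sum_k mpoly.meval (x i) (mpoly.mderiv k (p + q)) * (y i k - x i k) =
     \sum_k mpoly.meval (x i) (mpoly.mderiv k p) * (y i k - x i k) +
     \sum_k mpoly.meval (x i) (mpoly.mderiv k q) * (y i k - x i k).
    rewrite -big_split; apply: eq_bigr => k _ /=.
    by rewrite mpoly.mderivD mpoly.mevalD mulrDl.
  ring.
- have H := decayM (meval_lip p Hx Hd) (meval_lip q Hx Hd).
  have := decayD H (decayD (decayM (decay_meval q Hx) Hp) (decayM (decay_meval p Hx) Hq)).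
  apply: decay_eq => i _; rewrite !mpoly.mevalM.
  have -> : \sum_k mpoly.meval (x i) (mpoly.mderiv k (p * q)) * (y i k - x i k) =
     mpoly.meval (x i) q * \sum_k mpoly.meval (x i) (mpoly.mderiv k p) * (y i k - x i k) +
     mpoly.meval (x i) p * \sum_k mpoly.meval (x i) (mpoly.mderiv k q) * (y i k - x i k).
    rewrite !mulr_sumr -big_split; apply: eq_bigr => k _ /=.
    by rewrite mpoly.mderivM mpoly.mevalD !mpoly.mevalM; ring.
  ring.
Qed.

End Taylor.
End Decay.

(** * Asymptotics of relative dimensions *)

Section Asympt.
Variable R : realType.
Implicit Types (F G f g : part -> R) (l mu : part).
Local Notation drel := (drel R).
Local Notation content := (content R).
Local Notation pisum := (pisum R).

Definition bigV := @decay R part (fun _ => True) psz.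
Definition bigE := @decay R (part * nat) (fun e => removable e.1 e.2) (fun e => psz e.1).
Definition lower (e : part * nat) := prem e.1 e.2.

Lemma psz_lower e : removable e.1 e.2 -> psz e.1 = (psz (lower e)).+1.
Proof. exact: psz_prem. Qed.

Lemma bigVE_top a f : bigV a f -> bigE a (fun e => f e.1).
Proof. by case=> C [n0 H]; exists C, n0 => e _ Hn; apply: H. Qed.

Lemma bigVE_low a f : bigV a f -> bigE a (fun e => f (lower e)).
Proof.
(* The factor 2^a pays for n <= 2(n - 1) at the lower end of the edge. *)
move=> /decay_ge[C [n0 [C0 n00 H]]]; exists (C * 2 ^+ a), n0.+1 => e re Hn.
have E := psz_lower re; have Hn' : (n0 <= psz (lower e))%N by lia.
apply: le_trans (ler_wpM2r (exprn_ge0 a (ler0n R 2)) (H _ I Hn')).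
rewrite -mulrA -exprMn ler_wpM2l // lerXn2r ?nnegrE ?mulr_ge0 ?ler0n //.
by rewrite -natrM ler_nat; lia.
Qed.

(* clsD: O(1) with increments O(1/n) along edges; clsZ: one order smaller, that
   is, negligible in both the functions and their rescaled gradients. *)
Definition clsD f := bigV 0 f /\ bigE 1 (fun e => f (lower e) - f e.1).
Definition clsZ f := bigV 1 f /\ bigE 2 (fun e => f (lower e) - f e.1).

Lemma cls_ext n0 f g : (forall l, (n0 <= psz l)%N -> f l = g l) ->
  (clsD f -> clsD g) /\ (clsZ f -> clsZ g).
Proof.
move=> E; have EE e : removable e.1 e.2 -> (n0.+1 <= psz e.1)%N ->
    f (lower e) - f e.1 = g (lower e) - g e.1.
  by move=> re Hn; rewrite !E //; [lia|have := psz_lower re; lia].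
have EV l : True -> (n0 <= psz l)%N -> f l = g l by move=> _; exact: E.
by split=> -[H1 H2]; split; [exact: decay_ext EV H1|exact: decay_ext EE H2|
   exact: decay_ext EV H1|exact: decay_ext EE H2].
Qed.

Lemma clsD_ext n0 f g : (forall l, (n0 <= psz l)%N -> f l = g l) -> clsD f -> clsD g.
Proof. by move=> /cls_ext[]. Qed.
Lemma clsZ_ext n0 f g : (forall l, (n0 <= psz l)%N -> f l = g l) -> clsZ f -> clsZ g.
Proof. by move=> /cls_ext[]. Qed.

Lemma clsZD f : clsZ f -> clsD f.
Proof. by case=> H1 H2; split; [exact: decay_mono H1|exact: decay_mono H2]. Qed.

Lemma clsD_cst c : clsD (fun _ => c).
Proof.
split; first exact: decay_cst.
by apply: decay_eq (@decay_0 _ _ _ _ 1) => e _; rewrite subrr.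
Qed.

Lemma clsZ_0 : clsZ (fun _ => 0).
Proof.
split; first exact: decay_0.
by apply: decay_eq (@decay_0 _ _ _ _ 2) => e _; rewrite subrr.
Qed.

Lemma clsD_add f g : clsD f -> clsD g -> clsD (fun l => f l + g l).
Proof.
move=> [f1 f2] [g1 g2]; split; first exact: decayD.
apply: decay_eq (decayD f2 g2) => e _; ring.
Qed.

Lemma clsZ_add f g : clsZ f -> clsZ g -> clsZ (fun l => f l + g l).
Proof.
move=> [f1 f2] [g1 g2]; split; first exact: decayD.
apply: decay_eq (decayD f2 g2) => e _; ring.
Qed.

Lemma clsZ_mul f g : clsZ f -> clsD g -> clsZ (fun l => f l * g l).
Proof.
move=> [f1 f2] [g1 g2]; split; first exact: decayM f1 g1.
have := decayD (decayM (bigVE_low f1) g2) (decayM f2 (bigVE_top g1)).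
apply: decay_eq => e _; ring.
Qed.

Lemma clsZ_scale c f : clsZ f -> clsZ (fun l => c * f l).
Proof.
move=> H; have [_ H2] := cls_ext (n0 := 0) (f := fun l => f l * c) (g := fun l => c * f l)
  (fun l _ => mulrC _ _).
exact: H2 (clsZ_mul H (clsD_cst c)).
Qed.

Lemma clsZ_sum (J : eqType) (s : seq J) (f : J -> part -> R) :
  (forall j, j \in s -> clsZ (f j)) -> clsZ (fun l => \sum_(j <- s) f j l).
Proof.
elim: s => [|x s IH] H.
  by apply: (@clsZ_ext 0) clsZ_0 => l _; rewrite big_nil.
apply: (@clsZ_ext 0) (clsZ_add (H x (mem_head _ _)) (IH _)).
  by move=> l _; rewrite big_cons.
by move=> j js; apply: H; rewrite inE js orbT.
Qed.

Lemma clsZ_inv k : clsZ (fun l => ((psz l)%:R - k%:R)^-1).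
Proof.
have V : bigV 1 (fun l => ((psz l)%:R - k%:R)^-1).
  (* n > 2k gives n <= 2(n - k). *)
  exists 2, (k.*2.+1) => l _ Hn.
  have n0 : 0 < (psz l)%:R - k%:R :> R by rewrite subr_gt0 ltr_nat; lia.
  rewrite expr1 gtr0_norm ?invr_gt0 // mulrC ler_pdivrMr // mulrBr lerBrDr -natrM -natrD -natrM ler_nat.
  lia.
split=> //; apply: (@decay_ext _ _ _ _ (k.+2)) (decayM (bigVE_low V) (bigVE_top V)) => e re Hn.
have E := psz_lower re; rewrite E -natr1.
have n1 : (psz (lower e))%:R - k%:R != 0 :> R.
  by rewrite -natrB; [rewrite pnatr_eq0; lia|lia].
have n2 : (psz (lower e))%:R + 1 - k%:R != 0 :> R.
  by rewrite natr1 -natrB; [rewrite pnatr_eq0; lia|lia].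
by field; rewrite n1 n2.
Qed.

Lemma clsZ_ratio1 m : clsZ (fun l => (psz l)%:R ^+ m / (psz l ^_ m)%:R - 1).
Proof.
elim: m => [|m IH].
  by apply: (@clsZ_ext 0) clsZ_0 => l _; rewrite expr0 ffactn0 divr1 subrr.
have Z := clsZ_scale m%:R (clsZ_inv m).
apply: (@clsZ_ext m.+1) (clsZ_add (clsZ_mul IH (clsZD Z)) (clsZ_add IH Z)) => l Hl.
have n1 : (psz l)%:R - m%:R != 0 :> R by rewrite -(natrB _ (ltnW Hl)) pnatr_eq0; lia.
have n2 : (psz l ^_ m)%:R != 0 :> R by rewrite pnatr_eq0 -lt0n ffact_gt0; lia.
rewrite ffactnSr natrM (natrB _ (ltnW Hl)) exprSr.
by field; rewrite n1 n2.
Qed.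

Lemma clsZ_ratio k m : (k < m)%N -> clsZ (fun l => (psz l ^_ k)%:R / (psz l ^_ m)%:R).
Proof.
elim: m => // m IH; rewrite ltnS leq_eqVlt => /orP[/eqP ->|/IH H].
  apply: (@clsZ_ext m.+1) (clsZ_inv m) => l Hl.
  have n1 : (psz l)%:R - m%:R != 0 :> R by rewrite -(natrB _ (ltnW Hl)) pnatr_eq0; lia.
  have n2 : (psz l ^_ m)%:R != 0 :> R by rewrite pnatr_eq0 -lt0n ffact_gt0; lia.
  rewrite ffactnSr natrM (natrB _ (ltnW Hl)); by field; rewrite n1 n2.
apply: (@clsZ_ext m.+1) (clsZ_mul H (clsZD (clsZ_inv m))) => l Hl.
have n1 : (psz l)%:R - m%:R != 0 :> R by rewrite -(natrB _ (ltnW Hl)) pnatr_eq0; lia.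
have n2 : (psz l ^_ m)%:R != 0 :> R by rewrite pnatr_eq0 -lt0n ffact_gt0; lia.
rewrite ffactnSr natrM (natrB _ (ltnW Hl)); by field; rewrite n1 n2.
Qed.

Definition Xk k l : R := psym R k.+1 l / (psz l)%:R ^+ k.+1.
Lemma XkE k l : Xk k l = psym R k.+1 l / (psz l)%:R ^+ k.+1.
Proof. by []. Qed.

Definition xi (e : part * nat) : R := (content e.1 e.2 - 1) / (psz e.1)%:R.

Lemma norm_sub_le (a b c : R) : 0 <= a -> a <= c -> 0 <= b -> b <= c -> `|a - b| <= c.
Proof. by move=> a0 ac b0 bc; rewrite ler_norml; apply/andP; split; lra. Qed.

Lemma boxsum_bound (g : R -> R) (B : R) l :
  (forall c : R, `|c| <= (psz l)%:R -> `|g c| <= B) -> `|boxsum g l| <= (psz l)%:R * B.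
Proof.
move=> H; rewrite -pisum0 !pisumE mulr_suml; apply: le_trans (ler_norm_sum _ _ _) _.
apply: ler_sum => i _; rewrite mulr_suml; apply: le_trans (ler_norm_sum _ _ _) _.
apply: ler_sum => j _; rewrite expr0 mul1r; apply: H.
apply: norm_sub_le; rewrite ?ler0n // ler_nat.
  by apply: leq_trans (rows_le_psz l i); exact: ltnW.
exact: ltnW.
Qed.

Lemma Xk_bound k : bigV 0 (Xk k).
Proof.
exists k.+1%:R, 1%N => l _ Hl; rewrite expr0 mulr1.
have n0 : 0 < (psz l)%:R :> R by rewrite ltr0n.
rewrite /Xk normrM [`|_^-1|]gtr0_norm ?invr_gt0 ?exprn_gt0 // ler_pdivrMr ?exprn_gt0 //.
rewrite /psym normrM ger0_norm ?ler0n // ler_wpM2l ?ler0n // exprS.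
by apply: boxsum_bound => c Hc; rewrite normrX lerXn2r ?nnegrE ?ler0n.
Qed.

Lemma xi_bound : bigE 0 xi.
Proof.
exists 1, 1%N => e re Hn; rewrite expr0 mulr1 /xi normrM.
have n0 : 0 < (psz e.1)%:R :> R by rewrite ltr0n.
rewrite [`|_^-1|]gtr0_norm ?invr_gt0 // ler_pdivrMr // mul1r !contentE.
rewrite -addrA -opprD natr1; apply: norm_sub_le; rewrite ?ler0n // ler_nat.
  exact: rows_le_psz.
exact: removable_bound.
Qed.

Lemma shift_ratio k : bigE 2 (fun e =>
  ((psz e.1)%:R / (psz (lower e))%:R) ^+ k - 1 - k%:R / (psz e.1)%:R).
Proof.
have V1 : bigE 1 (fun e => ((psz e.1)%:R)^-1 : R) := @decay_invn _ _ _ _.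
have W1 : bigE 1 (fun e => ((psz (lower e))%:R)^-1 : R) := bigVE_low (@decay_invn _ _ _ _).
have B1 : bigE 2 (fun e => (psz e.1)%:R / (psz (lower e))%:R - 1 - ((psz e.1)%:R)^-1 : R).
  apply: (@decay_ext _ _ _ _ 2) (decayM V1 W1) => e re Hn; have E := psz_lower re; rewrite E -natr1.
  have n1 : (psz (lower e))%:R != 0 :> R by rewrite pnatr_eq0; lia.
  have n2 : (psz (lower e))%:R + 1 != 0 :> R by rewrite natr1 pnatr_eq0.
  by field; rewrite n1 n2.
elim: k => [|k IH].
  by apply: decay_eq (@decay_0 _ _ _ _ 2) => e _; rewrite expr0 mul0r subrr subr0.
have C k' : bigE 0 (fun e => 1 + k'%:R / (psz e.1)%:R : R).
  by apply: decayD; [exact: decay_cst|apply: decayZ; apply: decay_mono V1].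
have := decayD (decayM B1 (decayD (decay_mono (leq0n 2) IH) (C k)))
   (decayD (decayM IH (C 1%N)) (decayZ k%:R (decayM V1 V1))).
apply: decay_eq => e _; rewrite exprS -[k.+1%:R]natr1.
move: (_ / _) ((psz e.1)%:R^-1) (_ ^+ k) => u v p; ring.
Qed.

(** The rescaling (n/(n-1))^(k+1) = 1 + (k+1)/n + O(1/n^2) accounts for the term with [Xk], and the
    removed content for the power of [xi]. *)
Lemma Xk_edge k : bigE 2 (fun e =>
  Xk k (lower e) - Xk k e.1 - k.+1%:R * (Xk k e.1 - xi e ^+ k) / (psz e.1)%:R).
Proof.
have V1 : bigE 1 (fun e => ((psz e.1)%:R)^-1 : R) := @decay_invn _ _ _ _.
have S1 := shift_ratio k.+1.
have X1 := bigVE_top (Xk_bound k).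
have xk m : bigE 0 (fun e => xi e ^+ m).
  elim: m => [|m IH]; first by apply: decay_eq (@decay_cst _ _ _ _ 1) => e _; rewrite expr0.
  by apply: decay_eq (decayM xi_bound IH) => e _; rewrite exprS.
have S2 : bigE 1 (fun e => ((psz e.1)%:R / (psz (lower e))%:R) ^+ k.+1 - 1 : R).
  apply: decay_eq (decayD (decay_mono _ S1) (decayZ k.+1%:R V1)) => // e _; ring.
have := decayB (decayM S1 X1) (decayM (decayZ k.+1%:R (decayM V1 (xk k))) S2).
apply: (@decay_ext _ _ _ _ 2) => e re Hn; have E := psz_lower re.
have n1 : (psz (lower e))%:R != 0 :> R by rewrite pnatr_eq0; lia.
have n2 : (psz e.1)%:R != 0 :> R by rewrite pnatr_eq0; lia.
have -> : Xk k (lower e) = (Xk k e.1 - k.+1%:R * (xi e ^+ k / (psz e.1)%:R)) *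
    ((psz e.1)%:R / (psz (lower e))%:R) ^+ k.+1.
  rewrite /Xk /psym /=; have [ai lE] := padd_prem re.
  have -> : pisum k e.1 = pisum k (lower e) + (content e.1 e.2 - 1) ^+ k.
    by rewrite -{1}lE pisum_padd // content_prem.
  rewrite /xi; move: (psz (lower e))%:R (psz e.1)%:R n1 n2 => p q p0 q0.
  rewrite !expr_div_n !exprS; move: (p ^+ k) (q ^+ k) (expf_neq0 k p0) (expf_neq0 k q0) => a b a0 b0.
  by field; rewrite a0 b0 p0 q0.
move: ((_ / _) ^+ k.+1) => u; ring.
Qed.

Lemma clsD_Xk k : clsD (Xk k).
Proof.
split; first exact: Xk_bound.
have V1 : bigE 1 (fun e => ((psz e.1)%:R)^-1 : R) := @decay_invn _ _ _ _.
have xk m : bigE 0 (fun e => xi e ^+ m).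
  elim: m => [|m IH]; first by apply: decay_eq (@decay_cst _ _ _ _ 1) => e _; rewrite expr0.
  by apply: decay_eq (decayM xi_bound IH) => e _; rewrite exprS.
have H := decayM (decayZ k.+1%:R (decayB (bigVE_top (Xk_bound k)) (xk k))) V1.
apply: decay_eq (decayD (decay_mono _ (Xk_edge k)) H) => // e _; ring.
Qed.

Variable N : nat.
Local Notation xv := (@xvec R N).

Definition polyOf (s : seq (part * R)) : mpoly.mpoly N R :=
  \sum_(x <- s) x.2 *: scirc R N (val x.1).
Definition dl (s : seq (part * R)) l : R := \sum_(x <- s) x.2 * drel x.1 l.

Lemma meval_clsD (p : mpoly.mpoly N R) : clsD (fun l => mpoly.meval (xv l) p).
Proof.
split; first by apply: decay_meval => k; exact: Xk_bound.
apply: meval_lip => k; first exact: bigVE_top (Xk_bound _).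
by have [_] := clsD_Xk k.+1.
Qed.

(** Divide [drel_schur] by the falling factorial of order |mu|. The correction terms become smaller
    relative dimensions, in [clsD] by induction, times quotients of falling factorials, which
    [clsZ_ratio] places in [clsZ]. *)
Lemma drel_clsZ mu : (psz mu <= N)%N ->
  clsZ (fun l => drel mu l - mpoly.meval (xv l) (scirc R N (val mu))).
Proof.
move: {2}(psz mu) (leqnn (psz mu)) => m; elim/ltn_ind: m mu => m IH mu Hm HN.
have [s [/allP Hs Es]] := drel_schur (h := @hpsym R) mu (fun l => hsum0 _) (fun k l => hsum_newton _ _).
have Hx x : x \in s -> clsD (drel x.1).
  move=> xs; have Hx : (psz x.1 < psz mu)%N := Hs _ xs.
  have H : clsZ (fun l => drel x.1 l - mpoly.meval (xv l) (scirc R N (val x.1))).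
    by apply: (IH (psz x.1)) => //; lia.
  apply: (@clsD_ext 0) (clsD_add (clsZD H) (meval_clsD (scirc R N (val x.1)))) => l _; ring.
have HZ : clsZ (fun l => \sum_(x <- s) x.2 * ((psz l ^_ psz x.1)%:R / (psz l ^_ psz mu)%:R * drel x.1 l)).
  apply: clsZ_sum => x xs; apply: clsZ_scale; apply: clsZ_mul (Hx x xs).
  by apply: clsZ_ratio; exact: Hs.
have HM := clsZ_mul (clsZ_ratio1 (psz mu)) (meval_clsD (scirc R N (val mu))).
apply: (@clsZ_ext (psz mu).+1) (clsZ_add HM HZ) => l Hl.
have f0 : (psz l ^_ psz mu)%:R != 0 :> R by rewrite pnatr_eq0 -lt0n ffact_gt0; lia.
have := Es l; rewrite (@schurp_scirc R N) //; last by lia.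
move=> /(congr1 (fun u => (psz l ^_ psz mu)%:R^-1 * u)); rewrite mulKf // => ->.
have -> : \sum_(x <- s) x.2 * ((psz l ^_ psz x.1)%:R / (psz l ^_ psz mu)%:R * drel x.1 l) =
  (psz l ^_ psz mu)%:R^-1 * \sum_(x <- s) (x.2 * ((psz l ^_ psz x.1)%:R * drel x.1 l)).
  by rewrite mulr_sumr; apply: eq_bigr => x _; ring.
ring.
Qed.

Definition wfl (s : seq (part * R)) := all (fun x => psz x.1 <= N)%N s.

Lemma dl_clsZ s : wfl s -> clsZ (fun l => dl s l - mpoly.meval (xv l) (polyOf s)).
Proof.
move=> /allP Hs.
have : clsZ (fun l => \sum_(x <- s) x.2 * (drel x.1 l - mpoly.meval (xv l) (scirc R N (val x.1)))).
  by apply: clsZ_sum => x xs; apply: clsZ_scale; apply: drel_clsZ; exact: Hs.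
apply: (@clsZ_ext 0) => l _; rewrite /dl /polyOf.
rewrite (raddf_sum (mpoly.meval (xv l))) -sumrB; apply: eq_bigr => x _.
by rewrite [X in _ = _ - X]mpoly.mevalZ mulrBr.
Qed.

Definition grad (s : seq (part * R)) (e : part * nat) : R :=
  \sum_i mpoly.meval (xv e.1) (mpoly.mderiv i (polyOf s)) *
     (i.+2%:R * (Xk i.+1 e.1 - xi e ^+ i.+1)).

Lemma xi_pow m : bigE 0 (fun e => xi e ^+ m).
Proof.
elim: m => [|m IH]; first by apply: decay_eq (@decay_cst _ _ _ _ 1) => e _; rewrite expr0.
by apply: decay_eq (decayM xi_bound IH) => e _; rewrite exprS.
Qed.

Lemma grad_bound s : bigE 0 (grad s).
Proof.
apply: decay_sum => i _; apply: (@decayM _ _ _ _ 0 0).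
  exact: (bigVE_top (decay_meval _ (fun k => Xk_bound k.+1))).
exact: (decayZ _ (decayB (bigVE_top (Xk_bound _)) (xi_pow _))).
Qed.

Lemma dl_edge s : wfl s -> bigE 2 (fun e => dl s (lower e) - dl s e.1 - grad s e / (psz e.1)%:R).
Proof.
move=> Hs; have [_ H1] := dl_clsZ Hs.
have Hb k : bigE 0 (fun e => xv e.1 k) by exact: bigVE_top (Xk_bound _).
have Hd k : bigE 1 (fun e => xv (lower e) k - xv e.1 k) by have [_] := clsD_Xk k.+1.
have H2 := taylor1 (polyOf s) Hb Hd.
have H3 : bigE 2 (fun e => \sum_k mpoly.meval (xv e.1) (mpoly.mderiv k (polyOf s)) *
    (xv (lower e) k - xv e.1 k - k.+2%:R * (Xk k.+1 e.1 - xi e ^+ k.+1) / (psz e.1)%:R)).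
  apply: decay_sum => k _; apply: (@decayM _ _ _ _ 0 2); last exact: Xk_edge.
  by apply: decay_meval.
apply: decay_eq (decayD H1 (decayD H2 H3)) => e _.
have -> : \sum_k mpoly.meval (xv e.1) (mpoly.mderiv k (polyOf s)) *
    (xv (lower e) k - xv e.1 k - k.+2%:R * (Xk k.+1 e.1 - xi e ^+ k.+1) / (psz e.1)%:R) =
  \sum_k mpoly.meval (xv e.1) (mpoly.mderiv k (polyOf s)) * (xv (lower e) k - xv e.1 k) -
  grad s e / (psz e.1)%:R.
  rewrite /grad mulr_suml -sumrB; apply: eq_bigr => k _; ring.
ring.
Qed.

(** * Averages over the removal of a random box *)

Definition avgE (f : part * nat -> R) l : R :=
  \sum_(j < (psz l).+1 | removable l j) dimp R part0 (prem l j) / dimp R part0 l * f (l, j : nat).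

Lemma avgE1 l : (0 < psz l)%N -> avgE (fun _ => 1) l = 1.
Proof.
move=> Hl; rewrite /avgE -mulr_suml mulr1 -mulr_suml.
rewrite -/(opU (dimp R part0) l) -dimT_rec // mulfV // gt_eqF ?dimT_gt0 //.
Qed.

Lemma avgE_bound a (f : part * nat -> R) : bigE a f -> bigV a (avgE f).
Proof.
move=> /decay_ge[C [n0 [C0 n00 H]]]; exists C, n0 => l _ Hl.
have l0 : (0 < psz l)%N by lia.
have EC : C = \sum_(j < (psz l).+1 | removable l j)
    dimp R part0 (prem l j) / dimp R part0 l * 1 * C by rewrite -mulr_suml -/(avgE (fun _ => 1) l) avgE1 ?mul1r.
rewrite EC /avgE.
apply: le_trans (ler_wpM2r (exprn_ge0 a (ler0n R _)) (ler_norm_sum _ _ _)) _.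
rewrite mulr_suml; apply: ler_sum => j rj.
have p0 : 0 <= dimp R part0 (prem l j) / dimp R part0 l by rewrite divr_ge0 ?dimp_ge0.
rewrite normrM (ger0_norm p0) -mulrA mulr1 ler_wpM2l //.
exact: (H (l, j : nat)).
Qed.

Lemma avgE_center (A B : part * nat -> R) (g h : part -> R) l :
  avgE (fun e => (A e - g e.1) * (B e - h e.1)) l =
  avgE (fun e => A e * B e) l - g l * avgE B l - h l * avgE A l + g l * h l * avgE (fun _ => 1) l.
Proof.
by rewrite /avgE !mulr_sumr -!sumrB -big_split; apply: eq_bigr => k _ /=; ring.
Qed.

Lemma avgE_subdiv (A B : part * nat -> R) (c : part -> R) l :
  avgE (fun e => A e - B e / c e.1) l = avgE A l - avgE B l / c l.
Proof.
by rewrite /avgE mulr_suml -sumrB; apply: eq_bigr => k _ /=; ring.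
Qed.

Lemma avgE_sum (J : Type) (s : seq J) (f : J -> part * nat -> R) l :
  avgE (fun e => \sum_(j <- s) f j e) l = \sum_(j <- s) avgE (f j) l.
Proof. by rewrite /avgE exchange_big; apply: eq_bigr => i _; rewrite mulr_sumr. Qed.

(** The error terms of [down_moment] are at most of order n^k, since relative dimensions lie in
    [0, 1], and the normalization divides them by n^(k+1). *)
Lemma avg_xi k : bigV 1 (fun l => avgE (fun e => xi e ^+ k) l - Xk k l).
Proof.
have [s [/allP Hs Es]] := down_moment R k.
have H : bigV 1 (fun l => \sum_(x <- s) x.2 * ((psz l ^_ psz x.1)%:R * drel x.1 l / (psz l)%:R ^+ k.+1)).
  apply: decay_sum_in => x xs; apply: decayZ; exists 1, 1%N => l _ Hl.
  have n0 : 0 < (psz l)%:R :> R by rewrite ltr0n.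
  rewrite expr1 ger0_norm; last first.
    by apply: divr_ge0; [apply: mulr_ge0; [exact: ler0n|exact: drel_ge0]|exact: exprn_ge0].
  have nn : (psz l)%:R != 0 :> R by rewrite gt_eqF.
  rewrite exprSr invfM mulrA (divfK nn) ler_pdivrMr ?exprn_gt0 // mul1r.
  apply: le_trans (ler_piMr (ler0n _ _) (drel_le1 _ _ _)) _.
  have Hx : (psz x.1 < k.+1)%N := Hs _ xs; rewrite -natrX ler_nat.
  apply: (@leq_trans (psz l ^ psz x.1)); last by rewrite leq_pexp2l.
  elim: (psz x.1) => // m IH; rewrite ffactnSr expnSr leq_mul //; lia.
apply: (@decay_ext _ _ _ _ 1) H => l _ Hl.
have n0 : (psz l)%:R != 0 :> R by rewrite pnatr_eq0; lia.
rewrite /Xk /psym /= -(@mulKf _ (psz l)%:R n0 (avgE _ l)).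
have -> : (psz l)%:R * avgE (fun e => xi e ^+ k) l =
   (k.+1%:R * pisum k l + \sum_(x <- s) x.2 * ((psz l ^_ psz x.1)%:R * drel x.1 l)) / (psz l)%:R ^+ k.
  rewrite -Es -mulrA; congr (_ * _); rewrite mulr_suml; apply: eq_bigr => j _.
  by rewrite /xi expr_div_n mulrA.
have -> : \sum_(x <- s) x.2 * ((psz l ^_ psz x.1)%:R * drel x.1 l / (psz l)%:R ^+ k.+1) =
  (\sum_(x <- s) x.2 * ((psz l ^_ psz x.1)%:R * drel x.1 l)) / (psz l)%:R ^+ k.+1.
  by rewrite mulr_suml; apply: eq_bigr => x _; rewrite mulrA.
have nk := expf_neq0 k n0; rewrite exprS.
move: (\sum_(x <- s) _) (pisum k l) => S p.
move: nk n0; move: ((psz l)%:R ^+ k) => a.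
move: (psz l)%:R => b a0 b0.
by field; rewrite a0 b0.
Qed.

Definition GamX (p q : mpoly.mpoly N R) l : R :=
  \sum_(i < N) \sum_(j < N) (i.+2%:R * j.+2%:R * (Xk (i.+1 + j.+1) l - Xk i.+1 l * Xk j.+1 l)) *
    mpoly.meval (xv l) (mpoly.mderiv i p) * mpoly.meval (xv l) (mpoly.mderiv j q).

Lemma avg_grad s s' : bigV 1 (fun l => avgE (fun e => grad s e * grad s' e) l - GamX (polyOf s) (polyOf s') l).
Proof.
pose W (i j : nat) l : R := avgE (fun e => (Xk i.+1 e.1 - xi e ^+ i.+1) * (Xk j.+1 e.1 - xi e ^+ j.+1)) l.
pose mP (i : 'I_N) l := mpoly.meval (xv l) (mpoly.mderiv i (polyOf s)).
pose mQ (i : 'I_N) l := mpoly.meval (xv l) (mpoly.mderiv i (polyOf s')).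
have E l : avgE (fun e => grad s e * grad s' e) l =
   \sum_(i < N) \sum_(j < N) i.+2%:R * j.+2%:R * W i j l * mP i l * mQ j l.
  rewrite (_ : (fun e => grad s e * grad s' e) = fun e => \sum_(i < N) \sum_(j < N)
     (mP i e.1 * (i.+2%:R * (Xk i.+1 e.1 - xi e ^+ i.+1))) *
     (mQ j e.1 * (j.+2%:R * (Xk j.+1 e.1 - xi e ^+ j.+1)))); last first.
    by apply: funext => e; rewrite /grad mulr_suml; apply: eq_bigr => i _; rewrite mulr_sumr.
  rewrite avgE_sum; apply: eq_bigr => i _; rewrite avgE_sum; apply: eq_bigr => j _.
  rewrite [RHS](_ : _ = (i.+2%:R * j.+2%:R * mP i l * mQ j l) * W i j l); last by ring.
  rewrite /W /avgE [RHS]mulr_sumr; apply: eq_bigr => k _ /=; ring.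
have HW i j : bigV 1 (fun l => W i j l - (Xk (i.+1 + j.+1) l - Xk i.+1 l * Xk j.+1 l)).
  have B k k' : bigV 1 (fun l => Xk k l * (avgE (fun e => xi e ^+ k') l - Xk k' l)).
    exact: (@decayM _ _ _ _ 0 1 _ _ (Xk_bound k) (avg_xi k')).
  apply: (@decay_ext _ _ _ _ 1) (decayB (decayB (avg_xi (i.+1 + j.+1)) (B i.+1 j.+1)) (B j.+1 i.+1)).
  move=> l _ Hl; rewrite /W.
  have -> : avgE (fun e => (Xk i.+1 e.1 - xi e ^+ i.+1) * (Xk j.+1 e.1 - xi e ^+ j.+1)) l =
    Xk i.+1 l * Xk j.+1 l * avgE (fun _ => 1) l - Xk i.+1 l * avgE (fun e => xi e ^+ j.+1) l -
    Xk j.+1 l * avgE (fun e => xi e ^+ i.+1) l + avgE (fun e => xi e ^+ (i.+1 + j.+1)) l.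
    rewrite /avgE !mulr_sumr -!sumrB -big_split; apply: eq_bigr => k _ /=; rewrite exprD; ring.
  rewrite avgE1 //; ring.
have mB p i : bigV 0 (fun l => mpoly.meval (xv l) (mpoly.mderiv i p)).
  by apply: decay_meval => k; exact: Xk_bound.
have : bigV 1 (fun l => \sum_(i < N) \sum_(j < N) i.+2%:R * j.+2%:R *
   (W i j l - (Xk (i.+1 + j.+1) l - Xk i.+1 l * Xk j.+1 l)) * mP i l * mQ j l).
  apply: decay_sum => i _; apply: decay_sum => j _.
  apply: (@decayM _ _ _ _ 1 0); last exact: mB.
  apply: (@decayM _ _ _ _ 1 0); last exact: mB.
  exact: (decayZ _ (HW i j)).
apply: decay_eq => l _; rewrite E /GamX -sumrB; apply: eq_bigr => i _.
rewrite -sumrB; apply: eq_bigr => j _; rewrite /mP /mQ; ring.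
Qed.

(** The product of the values at [l] replaces the product of the averages; by [downavg_drel] they
    agree for relative dimensions of diagrams smaller than [l]. *)
Definition covl (f g : part -> R) l : R := downavg (fun l => f l * g l) l - f l * g l.

(** Relative dimensions are harmonic for the down chain: this is the branching rule of dim(mu, l)
    divided by dim(l). *)
Lemma downavg_drel mu l : (psz mu < psz l)%N -> downavg (drel mu) l = drel mu l.
Proof.
move=> H; rewrite {2}/drel dimp_rec // /downavg /opU mulr_suml; apply: eq_bigr => j rj.
have d0 : dimp R part0 (prem l j) != 0 by rewrite gt_eqF ?dimT_gt0.
rewrite /drel; field; by rewrite d0 gt_eqF ?dimT_gt0.
Qed.

Lemma cov_dl s s' : wfl s -> wfl s' ->
  bigV 1 (fun l => (psz l)%:R ^+ 2 * covl (dl s) (dl s') l - GamX (polyOf s) (polyOf s') l).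
Proof.
move=> Hs Hs'.
have V1 : bigE 1 (fun e => ((psz e.1)%:R)^-1 : R) := @decay_invn _ _ _ _.
have e1 := dl_edge Hs; have e2 := dl_edge Hs'.
have g1 := decayM (grad_bound s) V1; have g2 := decayM (grad_bound s') V1.
have H3 : bigE 3 (fun e => (dl s (lower e) - dl s e.1) * (dl s' (lower e) - dl s' e.1) -
   grad s e * grad s' e / (psz e.1)%:R ^+ 2).
  have := decayD (decayM e1 g2) (decayD (decayM g1 e2) (decay_mono (a := 4) (b := 3) isT (decayM e1 e2))).
  apply: decay_eq => e _; rewrite expr2 invfM; ring.
have H1 := decay_mulX (a := 1) (b := 2) (avgE_bound H3).
(* Sizes above N are required so that every diagram in the combinations is strictly smaller than
   [l], as [downavg_drel] demands. *)
apply: (@decay_ext _ _ _ _ N.+1) (decayD H1 (avg_grad s s')) => l _ Hl.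
have n0 : (psz l)%:R != 0 :> R by rewrite pnatr_eq0; lia.
have l0 : (0 < psz l)%N by lia.
have davg s0 : wfl s0 -> avgE (fun e => dl s0 (lower e)) l = dl s0 l.
  move=> /allP H0; rewrite /dl avgE_sum; apply: eq_big_seq => x xs.
  rewrite -[in RHS](@downavg_drel x.1); last by have Hx : (psz x.1 <= N)%N := H0 _ xs; lia.
  rewrite /avgE /downavg mulr_sumr; apply: eq_bigr => j _; rewrite /lower /=; ring.
have -> : covl (dl s) (dl s') l = avgE (fun e => (dl s (lower e) - dl s e.1) * (dl s' (lower e) - dl s' e.1)) l.
  rewrite (avgE_center (fun e => dl s (lower e)) (fun e => dl s' (lower e))) !davg // avgE1 //.
  rewrite /covl /downavg -/(avgE (fun e => dl s (lower e) * dl s' (lower e)) l).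
  move: (avgE _ _) (dl s l) (dl s' l) => a b c; ring.
rewrite (avgE_subdiv _ (fun e => grad s e * grad s' e) (fun l => (psz l)%:R ^+ 2)).
have nn := expf_neq0 2 n0; move: (_ ^+ 2) nn => a a0.
by rewrite mulrBl divfK //; ring.
Qed.

End Asympt.

(** * Frobenius coordinates *)

Lemma count_downclosed (p : pred nat) m : (forall i, p i.+1 -> p i) ->
  (forall i, (m <= i)%N -> ~~ p i) -> forall i, (i < count p (iota 0 m))%N = p i.
Proof.
move=> pS pm.
have ex : exists i, ~~ p i by exists m; apply: pm.
case: (ex_minnP ex) => d pd dmin.
have pE i : p i = (i < d)%N.
  have [lt|ge] := ltnP i d; first by apply: contraTT lt => /dmin; rewrite -leqNgt.
  apply: contraNF pd => pi; move: pi; rewrite -(subnK ge); elim: (i - d)%N => // k IH /pS.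
  by rewrite -/addn; exact: IH.
have dm : (d <= m)%N by apply: dmin; apply: pm.
suff -> : count p (iota 0 m) = d by move=> i; rewrite pE.
rewrite (eq_count (a2 := fun i => (i < d)%N)); last exact: pE.
have : count (fun i => i < d)%N (iota 0 m) = minn d m; last by move/minn_idPl: dm => ->.
elim: m {pm dm} => [|m IH]; first by rewrite minn0.
rewrite -addn1 iotaD count_cat IH /= add0n addn0; lia.
Qed.

Section Frobenius.
Variable R : realType.
Implicit Types (l : part).
Local Notation content := (content R).
Local Notation Xk := (Xk R).

Definition conjp l j := conj_part (val l) j.

Lemma ltn_conjp l i j : (i < conjp l j)%N = (j < rows l i)%N.
Proof.
have sE : val l = mkseq (rows l) (size (val l)) by rewrite mkseq_nth.
rewrite /conjp /conj_part sE count_map.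
apply: (@count_downclosed (fun i => j < rows l i)%N) => [k|k Hk].
  by move=> /leq_trans; apply; exact: rows_noninc.
by rewrite (size_part_rows Hk).
Qed.

Lemma ltn_ndiag l i : (i < ndiag (val l))%N = (i < rows l i)%N.
Proof.
rewrite /ndiag; apply: (@count_downclosed (fun i => i < rows l i)%N) => [k|k Hk].
  by have := rows_noninc l k; lia.
by rewrite (size_part_rows Hk).
Qed.

Lemma eq_from_ltn a b : (forall m, (m < a)%N = (m < b)%N) -> a = b.
Proof. by move=> H; have := H a; have := H b; rewrite !ltnn; lia. Qed.

Lemma conjp_padd l i j : addable l i -> conjp (padd l i) j = (conjp l j + (j == rows l i))%N.
Proof.
move=> ai.
have H m : (rows l i < rows l m)%N = (m < i)%N.
  have [le|lt] := leqP i m; first by have := rows_mono l le; lia.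
  move: ai; rewrite /addable; case: i lt => // i lt /=.
  by have := @rows_mono l m i; rewrite -ltnS => /(_ lt); lia.
have [E|ne] := eqVneq j (rows l i); last first.
  rewrite addn0; apply: eq_from_ltn => m; rewrite !ltn_conjp rows_padd //.
  by case: (eqVneq m i) ne => [->|]; lia.
have -> : conjp l j = i by apply: eq_from_ltn => m; rewrite ltn_conjp E H.
apply: eq_from_ltn => m; rewrite ltn_conjp rows_padd // E.
by have := H m; case: (eqVneq m i) => [->|]; lia.
Qed.

Lemma conjp_addable l i : addable l i -> conjp l (rows l i) = i.
Proof.
move=> ai; apply: eq_from_ltn => m; rewrite ltn_conjp.
have [le|lt] := leqP i m; first by have := rows_mono l le; lia.
move: ai; rewrite /addable; case: i lt => // i lt /=.
by have := @rows_mono l m i; rewrite -ltnS => /(_ lt); lia.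
Qed.

(** With 0-based rows the modified Frobenius coordinates are [rows l i - i - 1/2]. The guard
    replaces the bound i < d, and the legs enter [frobB] with a negative sign, as in a super power
    sum. *)
Definition frobA K l i : R := if (i < rows l i)%N then ((rows l i)%:R - i%:R - 2^-1) ^+ K else 0.
Definition frobB K l i : R := if (i < conjp l i)%N then (- ((conjp l i)%:R - i%:R - 2^-1)) ^+ K else 0.
Definition frob K l : R := \sum_(i < psz l) frobA K l i - \sum_(i < psz l) frobB K l i.

Lemma frob_default K l i : (psz l <= i)%N -> frobA K l i = 0 /\ frobB K l i = 0.
Proof. by move=> Hi; rewrite /frobA /frobB ltn_conjp rows_default. Qed.

Lemma frob_widen K l B : (psz l <= B)%N ->
  frob K l = \sum_(i < B) frobA K l i - \sum_(i < B) frobB K l i.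
Proof.
move=> /subnK <-; elim: (B - psz l)%N => // d IH; rewrite addSn !big_ord_recr /=.
by have [-> ->] := @frob_default K l (d + psz l) (leq_addl _ _); rewrite !addr0.
Qed.

Lemma frob_padd K l i : addable l i ->
  frob K (padd l i) = frob K l + ((content l i + 2^-1) ^+ K - (content l i - 2^-1) ^+ K).
Proof.
move=> ai; set B := (psz l).+2; have Hi := addable_bound ai.
have Hr := rows_le_psz l i.
rewrite (@frob_widen K (padd l i) B) ?psz_padd // (@frob_widen K l B); last by rewrite /B; lia.
have iB : (i < B)%N by rewrite /B; lia.
have rB : (rows l i < B)%N by rewrite /B; lia.
have EA : \sum_(k < B) frobA K (padd l i) k - \sum_(k < B) frobA K l k =
   frobA K (padd l i) i - frobA K l i.
  rewrite -sumrB (bigD1 (Ordinal iB)) //= big1 ?addr0 // => k ne.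
  have nk : (k == i :> nat) = false by apply/negbTE; rewrite -val_eqE in ne.
  by rewrite /frobA rows_padd // nk addn0 subrr.
have EB : \sum_(k < B) frobB K (padd l i) k - \sum_(k < B) frobB K l k =
   frobB K (padd l i) (rows l i) - frobB K l (rows l i).
  rewrite -sumrB (bigD1 (Ordinal rB)) //= big1 ?addr0 // => k ne.
  have nk : (k == rows l i :> nat) = false by apply/negbTE; rewrite -val_eqE in ne.
  by rewrite /frobB conjp_padd // nk addn0 subrr.
have E : frobA K (padd l i) i - frobA K l i - (frobB K (padd l i) (rows l i) - frobB K l (rows l i))
  = (content l i + 2^-1) ^+ K - (content l i - 2^-1) ^+ K.
  rewrite /frobA /frobB rows_padd // conjp_padd // conjp_addable // !eqxx /= !addn1 !contentE.
  rewrite -[(rows l i).+1%:R]natr1 -[i.+1%:R]natr1.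
  have e1 : (rows l i)%:R + 1 - i%:R - 2^-1 = (rows l i)%:R - i%:R + 2^-1 :> R.
    by lra.
  have e2 : - (i%:R + 1 - (rows l i)%:R - 2^-1) = (rows l i)%:R - i%:R - 2^-1 :> R.
    by lra.
  have e3 : - (i%:R - (rows l i)%:R - 2^-1) = (rows l i)%:R - i%:R + 2^-1 :> R.
    by ring.
  (* A box above the diagonal lengthens an arm, one below lengthens a leg, and a diagonal box
     creates both coordinates 1/2; the increment is the same in all three cases. *)
  rewrite e1 e2 e3 !ltnS; case: (ltngtP i (rows l i)) => _; ring.
by rewrite -E -EA -EB; ring.
Qed.

Lemma frobE K l : frob K l = boxsum (fun c : R => (c + 2^-1) ^+ K - (c - 2^-1) ^+ K) l.
Proof.
move: {2}(psz l) (erefl (psz l)) => n; elim: n l => [|n IH] l Hl.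
  by rewrite /frob /boxsum Hl !big_ord0 subrr.
have [|r [rr _]] := @exists_removable l; first by rewrite Hl.
have [ar lE] := padd_prem rr; rewrite -lE frob_padd // boxsum_padd // IH //.
by have := psz_prem rr; lia.
Qed.

Lemma lim_series_finite (f : nat -> R) d : (forall i, (d <= i)%N -> f i = 0) ->
  limn (series f) = \sum_(i < d) f i.
Proof.
move=> H; apply: lim_near_cst => //.
near=> n; have Hn : (d <= n)%N by near: n; exact: nbhs_infty_ge.
rewrite /series /= big_mkord -(subnK Hn); elim: (n - d)%N => // k IH.
by rewrite addSn big_ord_recr /= IH H ?leq_addl // addr0.
Unshelve. all: by end_near.
Qed.

Lemma qmom_iota k l : qmom k (@iota_n R (psz l) (val l)) = frob k.+1 l / (psz l)%:R ^+ k.+1.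
Proof.
rewrite /qmom /iota_n /=.
rewrite (@lim_series_finite _ (psz l)); last first.
  by move=> i Hi; rewrite ltn_ndiag rows_default // expr0n.
rewrite (@lim_series_finite _ (psz l)); last first.
  by move=> i Hi; rewrite ltn_ndiag rows_default // expr0n.
rewrite /frob mulrBl mulr_suml; congr (_ + _).
  apply: eq_bigr => i _; rewrite ltn_ndiag /frobA -/(rows l i); case: ifP => _.
    by rewrite expr_div_n.
  by rewrite expr0n mul0r.
rewrite mulr_sumr mulr_suml -sumrN; apply: eq_bigr => i _.
rewrite ltn_ndiag /frobB ltn_conjp -/(conjp l i); case: ifP => _; last by rewrite expr0n mulr0 mul0r oppr0.
by rewrite expr_div_n [(- (_ - _)) ^+ k.+1]exprNn [(-1) ^+ k.+1]exprS; ring.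
Qed.

(** Per box, (c + 1/2)^(k+1) - (c - 1/2)^(k+1) differs from (k+1)c^k by O(n^(k-1)); summed over n
    boxes and divided by n^(k+1) this leaves O(1/n). *)
Lemma Xk_qmom k : bigV 1 (fun l => Xk k l - qmom k (@iota_n R (psz l) (val l))).
Proof.
set K := k.+1.
(* Estimating over all pairs (n, c) with |c| <= n makes the constant uniform over the boxes. *)
pose PI (x : nat * R) := `|x.2| <= x.1%:R.
have V1 : @decay R _ PI fst 1 (fun x => (x.1%:R)^-1) := @decay_invn _ _ _ _.
pose u (x : nat * R) : R := x.2 / x.1%:R.
have U0 : @decay R _ PI fst 0 u.
  exists 1, 1%N => -[n c] /= Hc Hn; rewrite expr0 mulr1 /u normrM /=.
  have n0 : 0 < n%:R :> R by rewrite ltr0n.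
  by rewrite [`|_^-1|]gtr0_norm ?invr_gt0 // ler_pdivrMr // mul1r.
have UX m : @decay R _ PI fst 0 (fun x => u x ^+ m).
  elim: m => [|m IH]; first by apply: decay_eq (@decay_cst _ _ _ _ 1) => x _; rewrite expr0.
  by apply: decay_eq (decayM U0 IH) => x _; rewrite exprS.
have T (h : R) m : @decay R _ PI fst 2 (fun x =>
    (u x + h / x.1%:R) ^+ m.+1 - u x ^+ m.+1 - m.+1%:R * u x ^+ m * (h / x.1%:R)).
  have W := decayZ h V1.
  elim: m => [|m IH].
    by apply: decay_eq (@decay_0 _ _ _ _ 2) => x _; rewrite !expr1 expr0; ring.
  have := decayD (decayM (decayD U0 (decay_mono (leq0n 1) W)) IH) (decayZ m.+1%:R (decayM (UX m) (decayM W W))).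
  apply: decay_eq => x _; rewrite [_ ^+ m.+2]exprS [u x ^+ m.+2]exprS [u x ^+ m.+1]exprS -[m.+2%:R]natr1.
  move: (h / _) ((_ + _) ^+ m.+1) (u x ^+ m) m.+1%:R => v w p q; ring.
have /decay_ge[C [n0 [C0 n00 HC]]] := decayB (T 2^-1 k) (T (- 2^-1) k).
exists C, n0 => l _ Hl; have l0 : (0 < psz l)%N by lia.
have np : 0 < (psz l)%:R :> R by rewrite ltr0n.
have nn : (psz l)%:R != 0 :> R by rewrite gt_eqF.
rewrite qmom_iota frobE !XkE !psymE /= expr1 -mulrBl !pisumE -boxsumZ.
have -> : boxsum (fun c => K%:R * c ^+ k) l - boxsum (fun c : R => (c + 2^-1) ^+ K - (c - 2^-1) ^+ K) l
  = boxsum (fun c => K%:R * c ^+ k + (-1) * ((c + 2^-1) ^+ K - (c - 2^-1) ^+ K)) l.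
  by rewrite -[- boxsum _ _]mulN1r -boxsumZ -boxsumD.
rewrite normrM [`|_^-1|]gtr0_norm ?invr_gt0 ?exprn_gt0 //.
have -> : forall a : R, a / (psz l)%:R ^+ K * (psz l)%:R = a / (psz l)%:R ^+ k.
  by move=> a; rewrite /K exprSr invfM mulrA divfK.
rewrite ler_pdivrMr ?exprn_gt0 //.
(* For k = 0 the bound n^(k-1) has no natural exponent, but the summand is exactly zero. *)
case: k @K T HC => [|k] K T HC.
  apply: le_trans (boxsum_bound (B := 0) _) _; last by rewrite mulr0 expr0 mulr1.
  move=> c _; rewrite /K !expr1 expr0.
  by have -> : 1%:R * 1 + -1 * (c + 2^-1 - (c - 2^-1)) = 0 :> R; [lra|rewrite normr0].
apply: le_trans (boxsum_bound (B := C * (psz l)%:R ^+ k) _) _; last first.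
  by rewrite exprS mulrCA.
move=> c Hc; have := HC (psz l, c) Hc Hl.
set D := (X in `|X| * _ <= _).
have -> : K%:R * c ^+ k.+1 + -1 * ((c + 2^-1) ^+ K - (c - 2^-1) ^+ K) = - (D * (psz l)%:R ^+ K).
  have eu (h : R) m : (c / (psz l)%:R + h / (psz l)%:R) ^+ m = (c + h) ^+ m / (psz l)%:R ^+ m.
    by rewrite -mulrDl expr_div_n.
  rewrite /D /u /= !eu !expr_div_n /K.
  rewrite ![_ ^+ k.+2]exprS ![(psz l)%:R ^+ k.+1]exprS.
  move: (c ^+ k.+1) ((c + 2^-1) ^+ k.+1) ((c - 2^-1) ^+ k.+1) (k.+2%:R) => p a b K'.
  move: nn (expf_neq0 k nn); move: (psz l)%:R ((psz l)%:R ^+ k) => n q m0 q0.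
  by field; rewrite q0 m0.
move=> HD; rewrite normrN normrM [`|_ ^+ K|]ger0_norm ?exprn_ge0 // /K -addn2 addnC exprD mulrA.
by rewrite ler_wpM2r ?exprn_ge0.
Qed.

End Frobenius.

(** * Continuity on the Thoma simplex *)

Local Open Scope classical_set_scope.

Section Continuity.
Variable R : realType.

Definition subprob (a : nat -> R) : Prop :=
  [/\ forall i, 0 <= a i, forall i, a i.+1 <= a i & forall n, \sum_(i < n) a i <= 1].

Lemma Omega_subprob w : @Omega R w -> subprob w.1 /\ subprob w.2.
Proof.
case=> p1 p2 d1 d2 s; split; split=> // n; apply: le_trans (s n);
  by apply: ler_sum => i _; rewrite ?lerDl ?lerDr.
Qed.

Lemma subprob_bound a i : subprob a -> a i <= i.+1%:R^-1.
Proof.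
case=> p d s; rewrite -[leRHS]mul1r ler_pdivlMr ?ltr0n //.
apply: le_trans (s i.+1); rewrite mulr_natr -[X in _ *+ X]card_ord -sumr_const.
have mono (m n : nat) : (m <= n)%N -> a n <= a m.
  by move=> /subnK <-; elim: (n - m)%N => // k IH; rewrite addSn; exact: le_trans (d _) IH.
by apply: ler_sum => j _; apply: mono; rewrite -ltnS.
Qed.

(** A nonincreasing sequence of sum at most 1 satisfies a_i <= 1/(i+1). An exponent of at least 2
    leaves one such factor to bound the tail, uniformly in the sequence. *)
Lemma tail_bound K a I n : subprob a ->
  \sum_(i < n) a i ^+ K.+2 <= \sum_(i < I) a i ^+ K.+2 + I.+1%:R^-1.
Proof.
move=> sa; have [p d s] := sa.
have i0 : 0 <= I.+1%:R^-1 :> R by rewrite invr_ge0.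
have [nI|In] := leqP n I.
  rewrite (big_ord_widen I (fun i => a i ^+ K.+2) nI) -[leLHS]addr0 lerD //.
  rewrite [leRHS](bigID (fun i : 'I_I => (i < n)%N)) /= lerDl.
  by apply: sumr_ge0 => i _; rewrite exprn_ge0.
have a1 i : a i <= 1 by apply: le_trans (subprob_bound i sa) _; rewrite invf_le1 ?ler1n.
have term i : (I <= i)%N -> a i ^+ K.+2 <= I.+1%:R^-1 * a i.
  move=> Ii; rewrite exprS mulrC; apply: ler_wpM2r => //.
  rewrite exprS; apply: (@le_trans _ _ (a i * 1)).
    by apply: ler_wpM2l => //; rewrite exprn_ile1.
  rewrite mulr1; apply: le_trans (subprob_bound i sa) _.
  by rewrite lef_pV2 ?posrE ?ltr0n // ler_nat.
rewrite -(subnKC (ltnW In)) big_split_ord /= lerD2l.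
apply: (@le_trans _ _ (\sum_(i < n - I) I.+1%:R^-1 * a (I + i)%N)).
  by apply: ler_sum => i _; apply: term; exact: leq_addr.
rewrite -mulr_sumr -[leRHS]mulr1; apply: ler_wpM2l => //.
apply: le_trans (s n); rewrite -[in leRHS](subnKC (ltnW In)) big_split_ord /= lerDr.
exact: sumr_ge0.
Qed.

Definition psum K (a : nat -> R) : R := limn (series (fun i => a i ^+ K)).

Lemma series_ord (f : nat -> R) n : series f n = \sum_(i < n) f i.
Proof. by rewrite /series /= big_mkord. Qed.

Lemma psum_cvg K a : subprob a -> cvgn (series (fun i => a i ^+ K.+2)).
Proof.
move=> sa; have [p _ _] := sa; apply: nondecreasing_is_cvgn.
  apply/nondecreasing_seqP => n; rewrite !series_ord big_ord_recr /= lerDl exprn_ge0 //.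
exists 1 => _ [n _ <-]; rewrite series_ord.
by apply: le_trans (tail_bound K 0 n sa) _; rewrite big_ord0 add0r invr1.
Qed.

Lemma psum_approx K a I : subprob a ->
  `|psum K.+2 a - \sum_(i < I) a i ^+ K.+2| <= I.+1%:R^-1.
Proof.
move=> sa; have [p _ _] := sa; have cv := @psum_cvg K a sa.
have lo : \sum_(i < I) a i ^+ K.+2 <= psum K.+2 a.
  apply: limr_ge => //; near=> n; have In : (I <= n)%N by near: n; exact: nbhs_infty_ge.
  rewrite series_ord -(subnKC In) big_split_ord /= lerDl.
  by apply: sumr_ge0 => i _; rewrite exprn_ge0.
have hi : psum K.+2 a <= \sum_(i < I) a i ^+ K.+2 + I.+1%:R^-1.
  by apply: limr_le => //; near=> n; rewrite series_ord; exact: tail_bound.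
by rewrite ger0_norm ?subr_ge0 // lerBlDl.
Unshelve. all: by end_near.
Qed.

Lemma cvg_expn (u : nat -> R) (a : R) n : u @ \oo --> a -> (fun m => u m ^+ n) @ \oo --> a ^+ n.
Proof.
move=> cu; elim: n => [|n IH].
  by under eq_fun do rewrite expr0; rewrite expr0; exact: cvg_cst.
by under eq_fun do rewrite exprS; rewrite exprS; apply: cvgM.
Qed.

Lemma cvg_ordsum I (f : nat -> nat -> R) (g : nat -> R) :
  (forall i, f i @ \oo --> g i) -> (fun m => \sum_(i < I) f i m) @ \oo --> \sum_(i < I) g i.
Proof.
move=> H; elim: I => [|I IH].
  by under eq_fun do rewrite big_ord0; rewrite big_ord0; exact: cvg_cst.
by under eq_fun do rewrite big_ord_recr; rewrite big_ord_recr; apply: cvgD.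
Qed.

(** Coordinatewise convergence handles finitely many terms, and the uniform tail bound handles the
    rest at both ends. *)
Lemma psum_continuous K (u : nat -> nat -> R) (a : nat -> R) :
  (forall m, subprob (u m)) -> subprob a -> (forall k, (fun m => u m k) @ \oo --> a k) ->
  (fun m => psum K.+2 (u m)) @ \oo --> psum K.+2 a.
Proof.
move=> su sa cv; apply/cvgrPdist_le => e e0.
have e3 : 0 < e / 3 by rewrite divr_gt0.
have [I HI] : exists I : nat, I.+1%:R^-1 <= e / 3 :> R.
  exists (Num.truncn (e / 3)^-1); rewrite -[leRHS]invrK lef_pV2 ?posrE ?ltr0n ?invr_gt0 //.
  by apply: ltW; apply: truncnS_gt.
have cs : (fun m => \sum_(i < I) u m i ^+ K.+2) @ \oo --> \sum_(i < I) a i ^+ K.+2.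
  apply: (@cvg_ordsum I (fun i m => u m i ^+ K.+2) (fun i => a i ^+ K.+2)) => i.
  exact: cvg_expn.
move/cvgrPdist_le: cs => /(_ _ e3) cs.
near=> m.
have h1 := le_trans (@psum_approx K a I sa) HI.
have h2 := le_trans (@psum_approx K (u m) I (su m)) HI.
have h3 : `|\sum_(i < I) a i ^+ K.+2 - \sum_(i < I) u m i ^+ K.+2| <= e / 3 by near: m.
move: h1 h2 h3; move: (psum _ a) (psum _ (u m)) (\sum_(i < I) a i ^+ _) (\sum_(i < I) u m i ^+ _) => A B S S'.
clear -e0; rewrite !ler_norml => /andP[? ?] /andP[? ?] /andP[? ?]; apply/andP; split; lra.
Unshelve. all: by end_near.
Qed.

Local Notation cont := (@continuous_on_Omega R).

Lemma qmom_continuous k : cont (@qmom R k.+1).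
Proof.
move=> w x Ow Ox c1 c2.
have s1 m := (Omega_subprob (Ow m)).1; have s2 m := (Omega_subprob (Ow m)).2.
have [t1 t2] := Omega_subprob Ox.
apply: cvgD; first exact: (@psum_continuous k (fun m => (w m).1) x.1 s1 t1 c1).
by apply: cvgM; [exact: cvg_cst|exact: (@psum_continuous k (fun m => (w m).2) x.2 s2 t2 c2)].
Qed.

Lemma cont_cst c : cont (fun _ => c).
Proof. by move=> *; exact: cvg_cst. Qed.

Lemma contD f g : cont f -> cont g -> cont (fun w => f w + g w).
Proof. by move=> cf cg w x *; apply: cvgD; [exact: cf|exact: cg]. Qed.

Lemma contM f g : cont f -> cont g -> cont (fun w => f w * g w).
Proof. by move=> cf cg w x *; apply: cvgM; [exact: cf|exact: cg]. Qed.

Lemma cont_sum (J : Type) (s : seq J) (f : J -> Tpt R -> R) :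
  (forall j, cont (f j)) -> cont (fun w => \sum_(j <- s) f j w).
Proof.
move=> H; elim: s => [|x s IH].
  by under [X in cont X]funext do rewrite big_nil; exact: cont_cst.
by under [X in cont X]funext do rewrite big_cons; exact: contD.
Qed.

Lemma cont_evalO N (p : mpoly.mpoly N R) : cont (evalO p).
Proof.
elim/(@mpoly_ind_ring R): p => [c|i|p q Hp Hq|p q Hp Hq].
- rewrite (_ : evalO _ = fun _ => c); first exact: cont_cst.
  by apply/funext => w; rewrite /evalO mpoly.mevalC.
- rewrite (_ : evalO _ = @qmom R i.+1); first exact: qmom_continuous.
  by apply/funext => w; rewrite /evalO mpoly.mevalXU.
- rewrite (_ : evalO _ = fun w => evalO p w + evalO q w); first exact: contD.
  by apply/funext => w; rewrite /evalO mpoly.mevalD.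
- rewrite (_ : evalO _ = fun w => evalO p w * evalO q w); first exact: contM.
  by apply/funext => w; rewrite /evalO mpoly.mevalM.
Qed.

Lemma cont_Gamma N (p q : mpoly.mpoly N R) : cont (Gamma p q).
Proof.
apply: cont_sum => i; apply: cont_sum => j.
apply: contM; last exact: cont_evalO.
apply: contM; last exact: cont_evalO.
apply: contM; first exact: cont_cst.
apply: contD; first by rewrite addSn; exact: qmom_continuous.
rewrite (_ : (fun w => - _) = fun w => (-1) * (@qmom R i.+1 w * @qmom R j.+1 w)).
  apply: contM; first exact: cont_cst.
  by apply: contM; exact: qmom_continuous.
by apply/funext => w; rewrite mulN1r.
Qed.

End Continuity.

(** * Parameters of the z-measures *)

Section ZParameters.
Variables (R : realType) (z z' : R[i]).
Local Notation C := R[i].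
Local Notation rc := (real_complex R).

(** At an integer m, [zfac] is (z+m)(z'+m). In the principal series it is |z+m|^2 with nonzero
    imaginary part of z; in the complementary series no integer separates z from z', so the two
    factors have the same sign. *)
Lemma z_parameters : principal_series z z' \/ complementary_series z z' ->
  [/\ z * z' = rc (complex.Re (z * z')), z + z' = rc (complex.Re (z + z')) &
      forall m : int, 0 < zfac (complex.Re (z * z')) (complex.Re (z + z')) m%:~R].
Proof.
case: z z' => a b [a' b'].
case=> [[/= b0 [-> ->]]|[N [/= -> -> /andP[Na aN] /andP[Na' aN']]]].
  split; [by apply/eqP; rewrite eq_complex /=; apply/andP; split; apply/eqP; ring|
          by apply/eqP; rewrite eq_complex /=; apply/andP; split; apply/eqP; ring|].
  move=> m; rewrite /zfac.
  have -> : a * a - b * - b + (a + a) * m%:~R + m%:~R ^+ 2 = (a + m%:~R) ^+ 2 + b ^+ 2 by ring.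
  by apply: ltr_wpDl; [exact: sqr_ge0|rewrite lt_def sqr_ge0 sqrf_eq0 b0].
split; [by apply/eqP; rewrite eq_complex /=; apply/andP; split; apply/eqP; ring|
        by apply/eqP; rewrite eq_complex /=; apply/andP; split; apply/eqP; ring|].
move=> m; rewrite /zfac.
have -> : a * a' - 0 * 0 + (a + a') * m%:~R + m%:~R ^+ 2 = (a + m%:~R) * (a' + m%:~R) by ring.
have [pos|neg] := lerP 0 (N + m).
  have H : 0 <= (N + m)%:~R :> R by rewrite ler0z.
  rewrite intrD in H; apply: mulr_gt0; lra.
have H : (N + m + 1)%:~R <= 0 :> R by rewrite lerz0 -ltzD1 addrC; lia.
rewrite !intrD in H; rewrite -mulrNN; apply: mulr_gt0; lra.
Qed.

Hypothesis Hz : principal_series z z' \/ complementary_series z z'.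
Local Notation t := (complex.Re (z * z')).
Local Notation s := (complex.Re (z + z')).

Lemma zfac_gt0 (i j : nat) : 0 < zfac t s (j%:R - i%:R).
Proof.
have [_ _ /(_ (j%:Z - i%:Z))] := z_parameters Hz.
by rewrite rmorphB.
Qed.

Lemma t_gt0 : 0 < t.
Proof.
have [_ _ /(_ 0)] := z_parameters Hz.
by rewrite /zfac mulr0 addr0 expr0n /= addr0.
Qed.

Lemma cbox (i j : nat) :
  (z + j%:R - i%:R) * (z' + j%:R - i%:R) = rc (zfac t s (j%:R - i%:R)).
Proof.
have [E1 E2 _] := z_parameters Hz.
have -> : (z + j%:R - i%:R) * (z' + j%:R - i%:R) =
  z * z' + (z + z') * (j%:R - i%:R) + (j%:R - i%:R) ^+ 2 by ring.
have <- : rc (j%:R - i%:R) = j%:R - i%:R by rewrite rmorphB /= !rmorph_nat.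
by rewrite {1}E1 {1}E2 -rmorphM -rmorphXn -!rmorphD.
Qed.

Lemma cprod_empty (l : part) :
  cprod z (val l) [::] * cprod z' (val l) [::] = rc (boxprod (zfac t s) l).
Proof.
rewrite /boxprod rmorph_prod.
rewrite /cprod -big_split /=.
have Hs : (size (val l) <= psz l)%N := size_part_sumn (valP l).
rewrite (big_ord_widen (psz l) (fun i => (\prod_(nth 0%N [::] i <= j < nth 0%N (val l) i) (z + j%:R - i%:R)) *
   (\prod_(nth 0%N [::] i <= j < nth 0%N (val l) i) (z' + j%:R - i%:R)))) //.
rewrite big_mkcond; apply: eq_bigr => i _.
have -> : nth 0%N [::] i = 0%N by rewrite nth_nil.
rewrite rmorph_prod -big_split /= big_mkord -/(rows l i); case: ifP => Hi.
  by apply: eq_bigr => j _; rewrite cbox.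
by rewrite size_part_rows ?big_ord0 // leqNgt Hi.
Qed.

Lemma poch_rising n : poch (z * z') n = rc (rising t n).
Proof.
have [E1 _ _] := z_parameters Hz.
rewrite /poch /rising rmorph_prod; apply: eq_bigr => k _.
by rewrite {1}E1 rmorphD /= rmorph_nat.
Qed.

Lemma zmeasureE (l : part) : zmeasure z z' (psz l) (val l) = Mz t s l.
Proof.
rewrite /zmeasure cprod_empty poch_rising -fmorphV -rmorphM /= dimYE /Mz /Emu subn0.
have f0 := fact_neq0 R (psz l).
have r0 : rising t (psz l) != 0 by rewrite gt_eqF // rising_gt0 // t_gt0.
by move: (_`!%:R) (rising _ _) f0 r0 => a b a0 b0; field; rewrite a0 b0.
Qed.

Lemma Mz_ge0 (l : part) : 0 <= Mz t s l.
Proof.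
rewrite /Mz mulr_ge0 ?invr_ge0 ?(ltW (rising_gt0 t_gt0 _)) // mulr_ge0 ?ler0n // mulr_ge0 ?sqr_ge0 //.
by apply: prodr_ge0 => i _; apply: prodr_ge0 => j _; rewrite ltW // zfac_gt0.
Qed.

Lemma cprod_prem (mu : part) i : removable mu i ->
  complex.Re (cprod z (val mu) (val (prem mu i)) * cprod z' (val mu) (val (prem mu i)))
  = zfac t s (content R mu i - 1).
Proof.
move=> ri; have rp : (0 < rows mu i)%N by move: ri; rewrite /removable; lia.
have Hi : (i < size (val mu))%N.
  by rewrite ltnNge; apply/negP => /size_part_rows E; rewrite E in rp.
have H (y : C) : cprod y (val mu) (val (prem mu i)) = y + (rows mu i).-1%:R - i%:R.
  rewrite /cprod (bigD1 (Ordinal Hi)) //= -/(rows (prem mu i) i) -/(rows mu i) rows_prem // eqxx.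
  have -> : \prod_(rows mu i - true <= j < rows mu i) (y + j%:R - i%:R) = y + (rows mu i).-1%:R - i%:R.
    by rewrite -{2}(prednK rp) -subn1 /= big_nat1.
  rewrite big1 ?mulr1 // => k ki; rewrite -/(rows (prem mu i) k) -/(rows mu k) rows_prem //.
  have -> : (k == i :> nat) = false by apply/negbTE; rewrite -val_eqE in ki.
  by rewrite subn0 big_geq.
rewrite !H cbox /=; congr (zfac _ _ _); rewrite /content -{2}(prednK rp) -natr1; ring.
Qed.

Lemma subdiag_rows (nu mu : part) :
  subdiag (val nu) (val mu) = [forall i : 'I_(psz nu).+1, (rows nu i <= rows mu i)%N].
Proof.
apply/allP/forallP => [H i|H i]; last first.
  rewrite mem_iota /= add0n => Hi; have Hi' : (i < (psz nu).+1)%N := leq_trans Hi (leqW (size_part_sumn (valP nu))).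
  exact: (H (Ordinal Hi')).
have [Hi|Hi] := ltnP i (size (val nu)); last by rewrite size_part_rows.
by apply: H; rewrite mem_iota.
Qed.

(** Containment with size difference one means that exactly one row is shorter, by one box. For
    empty [mu] the predecessor is truncated, and the size condition makes the sum empty. *)
Lemma sum_lower (V : zmodType) (mu : part) (f : seq nat -> V) :
  \sum_(nu <- Yn (sumn (val mu)).-1 | ((sumn nu).+1 == sumn (val mu)) && subdiag nu (val mu)) f nu
  = \sum_(i < (psz mu).+1 | removable mu i) f (val (prem mu i)).
Proof.
rewrite -(val_Yp (sumn (val mu)).-1) big_map -/(psz mu).
have key (nu : part) : ((psz nu).+1 == psz mu) && subdiag (val nu) (val mu) =
   [exists i : 'I_(psz mu).+1, removable mu i && (prem mu i == nu)].
  apply/andP/existsP => [[/eqP Hs Hd]|[i /andP[ri /eqP <-]]].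
    have le k : (rows nu k <= rows mu k)%N.
      have [Hk|Hk] := leqP k (psz nu); last by rewrite rows_default // ltnW.
      by move: Hd; rewrite subdiag_rows => /forallP /(_ (Ordinal (n := (psz nu).+1) (m := k) Hk)).
    have E : (\sum_(k < (psz mu).+1) (rows mu k - rows nu k) = 1)%N.
      have : (\sum_(k < (psz mu).+1) (rows mu k - rows nu k) + \sum_(k < (psz mu).+1) rows nu k = psz mu)%N.
        rewrite -big_split /= [RHS](@psz_rows mu (psz mu).+1) //.
        by apply: eq_bigr => k _; rewrite subnK.
      by rewrite -psz_rows; lia.
    have [i Hi] : exists i : 'I_(psz mu).+1, (rows mu i - rows nu i != 0)%N.
      apply/existsP; rewrite -negb_forall; apply/negP => /forallP H.
      by move: E; rewrite big1 // => k _; apply/eqP/H.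
    move: E; rewrite (bigD1 i) //= => E.
    have Ei : (rows mu i - rows nu i = 1)%N by lia.
    have Ez k : k != i -> rows mu k = rows nu k.
      move=> ki; have : (\sum_(k < (psz mu).+1 | k != i) (rows mu k - rows nu k) == 0)%N by move: E; rewrite Ei add1n => -[->].
      by rewrite sum_nat_eq0 => /forallP /(_ k) /implyP /(_ ki); have := le k; lia.
    have Ez' k : k != i :> nat -> rows mu k = rows nu k.
      move=> ki; have [Hk|Hk] := leqP k (psz mu).
        by apply: (Ez (Ordinal (n := (psz mu).+1) (m := k) Hk)); rewrite -val_eqE.
      by rewrite !rows_default //; lia.
    have ri : removable mu i.
      rewrite /removable (Ez' i.+1); last by lia.
      by have := rows_noninc nu i; have := le i; lia.
    exists i; rewrite ri /=; apply/eqP/rows_inj => k; rewrite rows_prem //.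
    by case: eqP => [->|/eqP /Ez' ->]; [have := le i; lia|rewrite subn0].
  have E := psz_prem ri; split; first by rewrite -E.
  by rewrite subdiag_rows; apply/forallP => k; rewrite rows_prem // leq_subr.
rewrite (eq_bigl _ _ key).
transitivity (\sum_(nu <- Yp (psz mu).-1) \sum_(i < (psz mu).+1 | removable mu i && (prem mu i == nu)) f (val nu)).
  rewrite big_mkcond; apply: eq_bigr => nu _.
  case: existsP => [[i /andP[ri /eqP Ei]]|H]; last first.
    by rewrite big_pred0 // => i; apply/negP => Hi; apply: H; exists i.
  rewrite (big_pred1 i) // => k /=; apply/andP/eqP => [[rk /eqP Ek]|->]; last by rewrite ri Ei eqxx.
  apply/val_inj/eqP/negPn/negP => ne.
  have := rows_prem k rk; rewrite Ek -Ei rows_prem // eqxx (negbTE ne) subn0.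
  by move: rk; rewrite /removable; lia.
rewrite (exchange_big_dep (fun i : 'I_(psz mu).+1 => removable mu i)) /=; last by move=> nu i _ /andP[].
apply: eq_bigr => i ri.
rewrite big_mkcond (bigD1_seq (prem mu i)) ?Yp_uniq ?mem_Yp //=; last by have := psz_prem ri; lia.
rewrite ri eqxx big1 ?addr0 // => nu.
by rewrite eq_sym => /negbTE ->.
Qed.

Variable N : nat.

Lemma AschurE (mu : part) : Aschur N z z' (val mu) =
  (- (psz mu)%:R * ((psz mu)%:R - 1 + t)) *: scirc R N (val mu) +
  \sum_(i < (psz mu).+1 | removable mu i) zfac t s (content R mu i - 1) *: scirc R N (val (prem mu i)).
Proof.
rewrite /Aschur sum_lower; congr (_ + _).
by apply: eq_bigr => i ri; rewrite cprod_prem.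
Qed.

Definition partl (F : seq (seq nat * R)) : seq (part * R) :=
  [seq (insubd part0 x.1, x.2) | x <- F].

Lemma wfl_partl F : wf_comb N F -> wfl N (partl F).
Proof.
move=> /allP H; apply/allP => _ /mapP[x xF ->] /=; have /andP[Hp Hs] := H _ xF.
by rewrite /psz val_insubd Hp.
Qed.

Lemma comb_partl F : wf_comb N F -> comb N F = polyOf N (partl F).
Proof.
move=> /allP H; rewrite /comb /polyOf big_map; apply: eq_big_seq => x xF /=.
by have /andP[Hp _] := H _ xF; rewrite val_insubd Hp.
Qed.

Lemma Acomb_partl F : wf_comb N F -> Acomb N z z' F =
  \sum_(x <- partl F) x.2 *: Aschur N z z' (val x.1).
Proof.
move=> /allP H; rewrite /Acomb big_map; apply: eq_big_seq => x xF /=.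
by have /andP[Hp _] := H _ xF; rewrite val_insubd Hp.
Qed.

End ZParameters.

(** * Passage to the limit *)

Section Bilinear.
Variables (R : realType) (t s : R).
Hypothesis t0 : 0 < t.
Implicit Types (F G : seq (part * R)) (l : part).

Lemma covl_dl F G l : covl (dl F) (dl G) l =
  \sum_(x <- F) \sum_(y <- G) x.2 * y.2 * covl (drel R x.1) (drel R y.1) l.
Proof.
pose B m : R := \sum_(x <- F) \sum_(y <- G) x.2 * y.2 * (drel R x.1 m * drel R y.1 m).
have BE m : dl F m * dl G m = B m.
  rewrite /dl mulr_suml; apply: eq_bigr => x _; rewrite mulr_sumr; apply: eq_bigr => y _; ring.
rewrite /covl BE /B; under [RHS]eq_bigr => x _ do under eq_bigr => y _ do rewrite mulrBr.
under [RHS]eq_bigr => x _ do rewrite sumrB.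
rewrite sumrB; congr (_ - _); rewrite /downavg.
under eq_bigr => j _ do rewrite BE /B mulr_sumr.
rewrite exchange_big /=; apply: eq_bigr => x _.
under eq_bigr => j _ do rewrite mulr_sumr.
rewrite exchange_big /=; apply: eq_bigr => y _.
by rewrite mulr_sumr; apply: eq_bigr => j _; ring.
Qed.

Definition dAl F l : R := \sum_(x <- F) x.2 * dA t s x.1 l.

Lemma Mz_dirichlet_dl n N F G : (N <= n)%N -> wfl N F -> wfl N G ->
  - \sum_(l <- Yp n) Mz t s l * (dAl F l * dl G l) =
  n.+1%:R * (t + n%:R) * \sum_(l <- Yp n.+1) Mz t s l * covl (dl F) (dl G) l.
Proof.
move=> Nn /allP HF /allP HG.
have -> : \sum_(l <- Yp n) Mz t s l * (dAl F l * dl G l) =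
  \sum_(x <- F) \sum_(y <- G) x.2 * y.2 * \sum_(l <- Yp n) Mz t s l * (dA t s x.1 l * drel R y.1 l).
  under [RHS]eq_bigr => x _ do under eq_bigr => y _ do rewrite mulr_sumr.
  under [RHS]eq_bigr => x _ do rewrite exchange_big.
  rewrite exchange_big /=; apply: eq_bigr => l _.
  rewrite /dAl /dl mulr_suml mulr_sumr; apply: eq_bigr => x _.
  by rewrite mulr_sumr mulr_sumr; apply: eq_bigr => y _; ring.
have -> : \sum_(l <- Yp n.+1) Mz t s l * covl (dl F) (dl G) l =
  \sum_(x <- F) \sum_(y <- G) x.2 * y.2 * \sum_(l <- Yp n.+1) Mz t s l * covl (drel R x.1) (drel R y.1) l.
  under [RHS]eq_bigr => x _ do under eq_bigr => y _ do rewrite mulr_sumr.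
  under [RHS]eq_bigr => x _ do rewrite exchange_big.
  rewrite exchange_big /=; apply: eq_bigr => l _.
  rewrite covl_dl mulr_sumr; apply: eq_bigr => x _.
  by rewrite mulr_sumr; apply: eq_bigr => y _; ring.
rewrite -sumrN mulr_sumr; apply: eq_big_seq => x xF.
rewrite -sumrN mulr_sumr; apply: eq_big_seq => y yG.
rewrite -mulrN Mz_dirichlet //; first by ring.
- exact: leq_trans (HF _ xF) Nn.
- exact: leq_trans (HG _ yG) Nn.
Qed.

End Bilinear.

Section Limits.
Variables (R : realType) (z z' : R[i]).
Hypothesis Hz : principal_series z z' \/ complementary_series z z'.
Variable P : probability (TM R) R.
Hypothesis HP : boundary_zmeasure z z' P.
Local Notation t := (complex.Re (z * z')).
Local Notation s := (complex.Re (z + z')).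
Local Notation M := (Mz t s).
Implicit Types (l : part).

Definition iot l : Tpt R := @iota_n R (psz l) (val l).

Lemma zmeasure_sum n (phi : Tpt R -> R) :
  \sum_(lam <- Yn n) zmeasure z z' n lam * phi (@iota_n R n lam) =
  \sum_(l <- Yp n) M l * phi (iot l).
Proof.
rewrite -val_Yp big_map; apply: eq_big_seq => l; rewrite mem_Yp => /eqP <-.
by rewrite zmeasureE.
Qed.

Lemma zlimit (phi : Tpt R -> R) : continuous_on_Omega phi ->
  (fun n => \sum_(l <- Yp n) M l * phi (iot l)) @ \oo --> Rintegral P (@Omega R) phi.
Proof.
by move=> cphi; have := HP.2 _ cphi; under eq_fun do rewrite zmeasure_sum.
Qed.

(** The weak limit tested on the constant 1 makes the total masses converge; boundedness is all that
    the error estimates use. *)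
Lemma zmass_bounded : exists B : R, forall n, \sum_(l <- Yp n) M l <= B.
Proof.
have cv := zlimit (@cont_cst R 1).
have /cvgP/cvg_seq_bounded [A [_ HA]] := cv.
exists (A + 1) => n.
have := HA (A + 1); rewrite ltrDl ltr01 => /(_ isT n I) /=.
under eq_bigr => l _ do rewrite mulr1.
exact: le_trans (ler_norm _).
Qed.

Lemma avg_vanish (f : part -> R) : bigV 1 f -> (fun n => \sum_(l <- Yp n) M l * f l) @ \oo --> (0 : R).
Proof.
move=> /decay_ge[C [n0 [C0 n00 H]]]; have [B HB] := zmass_bounded.
have B0 : 0 <= B by apply: le_trans (HB 0%N); apply: sumr_ge0 => l _; exact: Mz_ge0.
apply/cvgrPdist_le => e e0.
near=> n; have n0n : (n0 <= n)%N by near: n; exact: nbhs_infty_ge.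
have np : 0 < n%:R :> R by rewrite ltr0n; lia.
rewrite sub0r normrN; apply: le_trans (ler_norm_sum _ _ _) _.
apply: (@le_trans _ _ (\sum_(l <- Yp n) M l * (C / n%:R))).
  rewrite big_seq [leRHS]big_seq; apply: ler_sum => l; rewrite mem_Yp => /eqP Hl.
  rewrite normrM ger0_norm ?Mz_ge0 // ler_wpM2l ?Mz_ge0 // ler_pdivlMr //.
  by have := H l I; rewrite Hl expr1; apply.
rewrite -mulr_suml; apply: (@le_trans _ _ (B * (C / n%:R))).
  by rewrite ler_wpM2r // divr_ge0.
rewrite mulrA ler_pdivrMr // -ler_pdivrMl //.
by near: n; exact: nbhs_infty_ger.
Unshelve. all: by end_near.
Qed.

Variable N : nat.

Lemma evalO_iot (p : mpoly.mpoly N R) :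
  bigV 1 (fun l => evalO p (iot l) - mpoly.meval (xvec R (N := N) l) p).
Proof.
apply: meval_lip => k; first exact: Xk_bound.
apply: decay_eq (decayN (@Xk_qmom R k.+1)) => l _; rewrite opprB.
by [].
Qed.

Lemma evalO_bounded (p : mpoly.mpoly N R) : bigV 0 (fun l => evalO p (iot l)).
Proof.
have H : bigV 0 (fun l => mpoly.meval (xvec R (N := N) l) p).
  by apply: decay_meval => k; exact: Xk_bound.
by apply: decay_eq (decayD (decay_mono (leq0n 1) (evalO_iot p)) H) => l _; rewrite subrK.
Qed.

Lemma decay_mul_diff (f f' g g' : part -> R) : bigV 0 f -> bigV 0 g' ->
  bigV 1 (fun l => f l - f' l) -> bigV 1 (fun l => g l - g' l) ->
  bigV 1 (fun l => f l * g l - f' l * g' l).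
Proof.
move=> f0 g0 df dg.
have H1 : bigV 1 (fun l => f l * (g l - g' l)) by exact: (decayM f0 dg).
have H2 : bigV 1 (fun l => (f l - f' l) * g' l) by exact: (decayM df g0).
apply: decay_eq (decayD H1 H2) => l _; ring.
Qed.

Lemma qmom_bounded k : bigV 0 (fun l => qmom k.+1 (iot l)).
Proof.
have := decayB (Xk_bound R k.+1) (decay_mono (leq0n 1) (@Xk_qmom R k.+1)).
apply: decay_eq => l _; rewrite /iot; ring.
Qed.

Lemma Gamma_iot (p q : mpoly.mpoly N R) :
  bigV 1 (fun l => Gamma p q (iot l) - GamX p q l).
Proof.
have X0 k : bigV 0 (Xk R k) := Xk_bound R k.
have m0 (r : mpoly.mpoly N R) : bigV 0 (fun l => mpoly.meval (xvec R (N := N) l) r).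
  by apply: decay_meval => k; exact: Xk_bound.
have Xq k : bigV 1 (fun l => qmom k.+1 (iot l) - Xk R k.+1 l).
  by apply: decay_eq (decayN (@Xk_qmom R k.+1)) => l _; rewrite opprB.
have T (i j : 'I_N) : bigV 1 (fun l =>
    ((i.+2%:R * j.+2%:R * (qmom (i.+1 + j.+1) (iot l) - qmom i.+1 (iot l) * qmom j.+1 (iot l)))
       * evalO (mpoly.mderiv i p) (iot l) * evalO (mpoly.mderiv j q) (iot l)) -
    ((i.+2%:R * j.+2%:R * (Xk R (i.+1 + j.+1) l - Xk R i.+1 l * Xk R j.+1 l)) *
      mpoly.meval (xvec R (N := N) l) (mpoly.mderiv i p) * mpoly.meval (xvec R (N := N) l) (mpoly.mderiv j q))).
  have B : bigV 0 (fun l => i.+2%:R * j.+2%:R * (qmom (i.+1 + j.+1) (iot l) - qmom i.+1 (iot l) * qmom j.+1 (iot l))).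
    apply: decayZ; apply: decayB; first exact: qmom_bounded.
    exact: (decayM (qmom_bounded i) (qmom_bounded j)).
  apply: decay_mul_diff (m0 _) _ (evalO_iot _).
    exact: (decayM B (evalO_bounded _)).
  apply: decay_mul_diff (m0 _) _ (evalO_iot _) => //.
  have D := decay_mul_diff (qmom_bounded i) (X0 j.+1) (Xq i) (Xq j).
  apply: decay_eq (decayZ (i.+2%:R * j.+2%:R) (decayB (Xq (i + j.+1)%N) D)) => l _.
  by rewrite addSn -mulrBr; congr (_ * _); ring.
apply: decay_eq (decay_sum (index_enum 'I_N) (Q := xpredT)
  (fun i _ => decay_sum (index_enum 'I_N) (Q := xpredT) (fun j _ => T i j))) => l _.
rewrite /Gamma /GamX -sumrB; apply: eq_bigr => i _; rewrite -sumrB; exact: eq_bigr.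
Qed.

Lemma dl_bounded F : wfl N F -> bigV 0 (dl (R := R) F).
Proof.
move=> HF; have [H _] := dl_clsZ HF; have [H2 _] := @meval_clsD R N (polyOf N F).
apply: decay_eq (decayD (decay_mono (leq0n 1) H) H2) => l _; ring.
Qed.

Lemma evalO_dl F : wfl N F -> bigV 1 (fun l => evalO (polyOf N F) (iot l) - dl F l).
Proof.
move=> HF; have [H _] := dl_clsZ HF.
apply: decay_eq (decayB (evalO_iot (polyOf N F)) H) => l _; ring.
Qed.

Lemma evalO_scirc mu : (psz mu <= N)%N -> bigV 1 (fun l => evalO (scirc R N (val mu)) (iot l) - drel R mu l).
Proof.
move=> Hmu; have := @evalO_dl [:: (mu, 1)]; rewrite /wfl /= Hmu => /(_ isT).
by apply: decay_eq => l _; rewrite /polyOf /dl !big_seq1 /= scale1r mul1r.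
Qed.

Lemma meval_sumZ (v : 'I_N -> R) (I : Type) (r : seq I) (Q : pred I) (c : I -> R)
    (p : I -> mpoly.mpoly N R) :
  mpoly.meval v (\sum_(i <- r | Q i) c i *: p i) = \sum_(i <- r | Q i) c i * mpoly.meval v (p i).
Proof.
by rewrite (raddf_sum (mpoly.meval v)); apply: eq_bigr => i _; exact: mpoly.mevalZ.
Qed.

Lemma evalO_Aschur mu : (psz mu <= N)%N ->
  bigV 1 (fun l => evalO (Aschur N z z' (val mu)) (iot l) - dA t s mu l).
Proof.
move=> Hmu.
have H2 : bigV 1 (fun l => \sum_(i < (psz mu).+1 | removable mu i) zfac t s (content R mu i - 1) *
    (evalO (scirc R N (val (prem mu i))) (iot l) - drel R (prem mu i) l)).
  apply: decay_sum => i ri; apply: decayZ; apply: evalO_scirc.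
  by have := psz_prem ri; lia.
apply: decay_eq (decayD (decayZ (- (psz mu)%:R * ((psz mu)%:R - 1 + t)) (evalO_scirc Hmu)) H2) => l _.
rewrite /dA /lowZ AschurE // /evalO mpoly.mevalD mpoly.mevalZ.
rewrite meval_sumZ.
under [X in _ + X = _]eq_bigr => i _ do rewrite mulrBr.
rewrite sumrB mulrBr.
move: (\sum_(i < _ | _) _) (\sum_(i < _ | _) _) => a b; ring.
Qed.

Lemma evalO_Acomb F : wf_comb N F ->
  bigV 1 (fun l => evalO (Acomb N z z' F) (iot l) - dAl t s (partl F) l).
Proof.
move=> HF; have /allP Hp := wfl_partl HF.
have : bigV 1 (fun l => \sum_(x <- partl F) x.2 *
    (evalO (Aschur N z z' (val x.1)) (iot l) - dA t s x.1 l)).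
  apply: decay_sum_in => x xF; apply: decayZ; apply: evalO_Aschur; exact: Hp.
apply: decay_eq => l _; rewrite Acomb_partl // /evalO meval_sumZ /dAl -sumrB.
by apply: eq_bigr => x _; rewrite mulrBr.
Qed.

Lemma dirichlet_limit F G : wf_comb N F -> wf_comb N G ->
  - Rintegral P (@Omega R) (fun w => evalO (Acomb N z z' F) w * evalO (comb N G) w)
  = Rintegral P (@Omega R) (Gamma (comb N F) (comb N G)).
Proof.
move=> HF HG.
have wF := wfl_partl HF; have wG := wfl_partl HG.
pose f w := evalO (Acomb N z z' F) w * evalO (comb N G) w.
pose g := Gamma (comb N F) (comb N G).
have cf : (fun n => \sum_(l <- Yp n) M l * f (iot l)) @ \oo --> Rintegral P (@Omega R) f.
  by apply: zlimit; apply: contM; exact: cont_evalO.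
have cg : (fun n => \sum_(l <- Yp n) M l * g (iot l)) @ \oo --> Rintegral P (@Omega R) g.
  by apply: zlimit; exact: cont_Gamma.
pose e1 l := f (iot l) - dAl t s (partl F) l * dl (partl G) l.
have E1 : bigV 1 e1.
  apply: decay_mul_diff (evalO_bounded _) (dl_bounded wG) (evalO_Acomb HF) _.
  by rewrite comb_partl //; exact: evalO_dl.
(* On level n + 1 the prefactor is (n+1)(t+n). *)
pose e2 l := (psz l)%:R * (t + (psz l)%:R - 1) * covl (dl (partl F)) (dl (partl G)) l - g (iot l).
have E2 : bigV 1 e2.
  have c1 := cov_dl wF wG.
  have G1 := Gamma_iot (polyOf N (partl F)) (polyOf N (partl G)).
  have c0 : bigV 0 (fun l => (psz l)%:R ^+ 2 * covl (dl (partl F)) (dl (partl G)) l).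
    have b0 : bigV 0 (Gamma (polyOf N (partl F)) (polyOf N (partl G)) \o iot).
      apply: decay_sum => i _; apply: decay_sum => j _.
      apply: (decayM (a := 0) (b := 0)); last exact: evalO_bounded.
      apply: (decayM (a := 0) (b := 0)); last exact: evalO_bounded.
      apply: decayZ; apply: decayB; first exact: qmom_bounded.
      exact: (decayM (qmom_bounded i) (qmom_bounded j)).
    apply: decay_eq (decayD (decay_mono (leq0n 1) (decayB c1 G1)) b0) => l _ /=; ring.
  (* This is the gap between the prefactor n(n+t-1) and n^2, namely (t-1)n times a covariance of
     order n^-2. *)
  have c2 : bigV 1 (fun l => (t - 1) * (((psz l)%:R)^-1 *
      ((psz l)%:R ^+ 2 * covl (dl (partl F)) (dl (partl G)) l))).
    by apply: decayZ; exact: (decayM (@decay_invn _ _ _ _) c0).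
  apply: (@decay_ext _ _ _ _ 1) (decayD (decayB c1 G1) c2) => l _ Hl.
  rewrite /e2 /g !comb_partl //.
  have n0 : (psz l)%:R != 0 :> R by rewrite pnatr_eq0; lia.
  move: (covl _ _ l) (Gamma _ _ _) (GamX _ _ _) => c u v; field.
  exact: n0.
have key n : (N <= n)%N ->
  - (\sum_(l <- Yp n) M l * f (iot l)) - \sum_(l <- Yp n.+1) M l * g (iot l) =
  \sum_(l <- Yp n.+1) M l * e2 l - \sum_(l <- Yp n) M l * e1 l.
  move=> Nn; have D := Mz_dirichlet_dl s (t_gt0 Hz) Nn wF wG.
  have -> : \sum_(l <- Yp n) M l * f (iot l) = \sum_(l <- Yp n) M l * e1 l +
     \sum_(l <- Yp n) M l * (dAl t s (partl F) l * dl (partl G) l).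
    by rewrite -big_split /=; apply: eq_bigr => l _; rewrite /e1; ring.
  have -> : \sum_(l <- Yp n.+1) M l * e2 l =
     n.+1%:R * (t + n%:R) * \sum_(l <- Yp n.+1) M l * covl (dl (partl F)) (dl (partl G)) l -
     \sum_(l <- Yp n.+1) M l * g (iot l).
    rewrite mulr_sumr -sumrB; apply: eq_big_seq => l; rewrite mem_Yp => /eqP Hl.
    rewrite /e2 Hl -natr1; ring.
  rewrite -D; ring.
have lim0 : (fun n => - (\sum_(l <- Yp n) M l * f (iot l)) - \sum_(l <- Yp n.+1) M l * g (iot l))
    @ \oo --> (0 : R).
  have l2 := avg_vanish E2; have l1 := avg_vanish E1.
  have l2' : (fun n => \sum_(l <- Yp n.+1) M l * e2 l) @ \oo --> (0 : R).
    by rewrite (cvg_shiftS (fun n => \sum_(l <- Yp n) M l * e2 l)).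
  pose u n : R := \sum_(l <- Yp n.+1) M l * e2 l - \sum_(l <- Yp n) M l * e1 l.
  have Hu : u @ \oo --> (0 : R) by rewrite -[X in _ --> X](subrr (0 : R)); exact: cvgB l2' l1.
  (* The discrete identity is available only for n >= N, so both sequences are compared after a
     shift by N. *)
  rewrite -(cvg_shiftn N u) in Hu.
  by rewrite -(cvg_shiftn N); under eq_fun do rewrite key ?leq_addl //.
have lim1 : (fun n => - (\sum_(l <- Yp n) M l * f (iot l)) - \sum_(l <- Yp n.+1) M l * g (iot l))
    @ \oo --> - Rintegral P (@Omega R) f - Rintegral P (@Omega R) g.
  apply: cvgB; first exact: cvgN.
  by rewrite (cvg_shiftS (fun n => \sum_(l <- Yp n) M l * g (iot l))).
apply/eqP; rewrite -subr_eq0; apply/eqP; exact: cvg_unique lim1 lim0.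
Qed.

End Limits.

Unset Implicit Arguments.

(* f = comb N F, g = comb N G are arbitrary elements of Lambda°, written as
   finite combinations of Schur functions s°_mu with |mu| <= N, viewed as
   polynomials in q_1..q_N; A_{z,z'} f = Acomb N z z' F. *)
Theorem theorem7p4 (R : realType) (z z' : R[i]) :
  principal_series z z' \/ complementary_series z z' ->
  forall P : probability (TM R) R, boundary_zmeasure z z' P ->
  forall (N : nat) (F G : seq (seq nat * R)),
    wf_comb N F -> wf_comb N G ->
    - Rintegral P (@Omega R)
        (fun w => evalO (Acomb N z z' F) w * evalO (comb N G) w)
    = Rintegral P (@Omega R) (Gamma (comb N F) (comb N G)).
Proof. by move=> Hz P HP N F G; apply: dirichlet_limit. Qed.
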